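(* Let $n\ge1$, $\gamma\in(0,+\infty)\setminus\mathbb N$ and $s=\frac n2+\gamma$. For every $f\in C(\mathbb S^n)$ there exists a unique $u\in C^2(\mathbb B^{n+1})$ solving $$-\Delta_+u-s(n-s)u=0\ \text{in }\mathbb B^{n+1},\qquad \lim_{\rho_0\to0^+}\rho_0^{s-n}u=f\ \text{on }\mathbb S^n,$$ and it is given by $$u(x)=\pi^{-\frac n2}\frac{2^{-s}\Gamma(\frac n2+\gamma)}{\Gamma(\gamma)}\int_{\mathbb S^n}\left(\frac{1-|x|^2}{|x-\xi|^2}\right)^sf(\xi)\,dV_{\mathbb S^n}(\xi).$$ Furthermore, if $f=\sum_{l=0}^\infty Y_l$ with $Y_l\in\mathscr H_l$, then $u(x)=\rho_0^{n-s}\sum_{l=0}^\infty\varphi_l(r^2)r^lY_l$, where $$\varphi_l(t)=\frac{F(l+\frac n2-\gamma,\frac12-\gamma;l+\frac{n+1}2;t)}{F(l+\frac n2-\gamma,\frac12-\gamma;l+\frac{n+1}2;1)}=\frac{\Gamma(\gamma+\frac12)}{\Gamma(2\gamma)}\frac{\Gamma(l+\gamma+\frac n2)}{\Gamma(l+\frac{n+1}2)}F\left(l+\frac n2-\gamma,\frac12-\gamma;l+\frac{n+1}2;t\right).$$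
   Context: $\mathbb B^{n+1}=\{x\in\mathbb R^{n+1}:|x|<1\}$, $\mathbb S^n=\partial\mathbb B^{n+1}$, $r=|x|$, $x=r\theta$; $\mathbb N=\{1,2,\dots\}$. $\Delta_+$ is the Laplace–Beltrami operator of the Poincaré metric $g_{\mathbb B}=\frac{4|dx|^2}{(1-|x|^2)^2}$, i.e. $\Delta_+=\frac{1-|x|^2}4\left[(1-|x|^2)\Delta_{\mathbb R^{n+1}}+2(n-1)\sum_ix_i\partial_{x_i}\right]$. $\rho_0=\frac{1-r^2}2$. $\mathscr H_l$ is the space of spherical harmonics of degree $l$, and $Y_l(\theta)$ is evaluated at $\theta=x/|x|$. $F(a,b;c;z)=\sum_{k\ge0}\frac{(a)_k(b)_k}{(c)_k}\frac{z^k}{k!}$ is the Gauss hypergeometric function, $(a)_k$ the rising Pochhammer symbol. *)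

(* Defs.v *)
From HB Require Import structures.
From mathcomp Require Import all_boot all_order all_algebra.
From mathcomp Require Import all_classical all_reals all_analysis.
Set Implicit Arguments. Unset Strict Implicit. Unset Printing Implicit Defensive.
Import Order.TTheory GRing.Theory Num.Theory.
Import numFieldNormedType.Exports.
Local Open Scope classical_set_scope.
Local Open Scope ring_scope.

Section Defs.
Variable R : realType.
Variable n : nat.
Local Notation V := 'rV[R]_(n.+1).

Definition enorm (x : V) : R := Num.sqrt (\sum_(i < n.+1) x ord0 i ^+ 2).

Definition unit_ball : set V := [set x | enorm x < 1].
Definition sphere : set V := [set x | enorm x = 1].

Definition rho0 (x : V) : R := (1 - enorm x ^+ 2) / 2.

Definition ecoord (i : 'I_n.+1) : V := delta_mx ord0 i.

(* theta = x/|x| (with the convention theta(0) = e_0, only used with r^l) *)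
Definition theta (x : V) : V := if x == 0 then ecoord ord0 else (enorm x)^-1 *: x.

Definition partial (i : 'I_n.+1) (u : V -> R) : V -> R :=
  fun x => 'D_(ecoord i) u x.

Definition C2_on (D : set V) (u : V -> R) : Prop :=
  forall x, D x ->
    {for x, continuous u} /\
    forall i j : 'I_n.+1,
      derivable u x (ecoord i) /\ {for x, continuous (partial i u)} /\
      derivable (partial i u) x (ecoord j) /\
      {for x, continuous (partial j (partial i u))}.

(* Euclidean Laplacian and the Laplace-Beltrami operator of the Poincare metric *)
Definition laplacian (u : V -> R) : V -> R :=
  fun x => \sum_(i < n.+1) partial i (partial i u) x.

Definition hyp_laplacian (u : V -> R) : V -> R :=
  fun x => (1 - enorm x ^+ 2) / 4 *
    ((1 - enorm x ^+ 2) * laplacian u x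
     + 2 * (n%:R - 1) * \sum_(i < n.+1) x ord0 i * partial i u x).

Fixpoint iter_int (k : nat) (F : seq R -> R) : R :=
  match k with
  | 0 => F [::]
  | k'.+1 => Rintegral lebesgue_measure setT
               (fun t : R => iter_int k' (fun s => F (t :: s)))
  end.

Definition ball_integral (g : V -> R) : R :=
  iter_int n.+1 (fun s => let x : V := \row_i nth 0 s i in
                          \1_unit_ball x * g x).

(* integral over S^n w.r.t. the standard surface measure dV_{S^n}, via the
   cone-measure identity  int_{S^n} g dV = (n+1) int_{B^{n+1}} g(x/|x|) dx *)
Definition sphere_integral (g : V -> R) : R :=
  n.+1%:R * ball_integral (fun x => g (theta x)).

Definition homog_poly (l : nat) (P : V -> R) : Prop :=
  exists c : {ffun 'I_l -> 'I_n.+1} -> R,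
    forall x, P x = \sum_(k : {ffun 'I_l -> 'I_n.+1})
                      c k * \prod_(j < l) x ord0 (k j).

Definition spherical_harmonic (l : nat) (Y : V -> R) : Prop :=
  exists P : V -> R, homog_poly l P /\ (forall x, laplacian P x = 0) /\
    (forall xi, sphere xi -> Y xi = P xi).

End Defs.

Definition Gamma (R : realType) (x : R) : R :=
  Rintegral lebesgue_measure `]0, +oo[%classic
    (fun t : R => t `^ (x - 1) * expR (- t)).

Definition poch (R : realType) (a : R) (k : nat) : R := \prod_(i < k) (a + i%:R).

Definition hyp2F1 (R : realType) (a b c z : R) : R :=
  limn (series (fun k : nat => poch a k * poch b k / poch c k * z ^+ k / (k`!)%:R)).

Arguments sphere {R n}.
Arguments unit_ball {R n}.

(* Main.v *)
Require Import Defs.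
From HB Require Import structures.
From mathcomp Require Import all_boot all_order all_algebra.
From mathcomp Require Import all_classical all_reals all_analysis.
From mathcomp Require Import measurable_realfun ring lra.
Set Implicit Arguments. Unset Strict Implicit. Unset Printing Implicit Defensive.
Import Order.TTheory GRing.Theory Num.Theory.
Import numFieldNormedType.Exports.
Local Open Scope classical_set_scope.
Local Open Scope ring_scope.

(** The Poisson kernel [((1 - |x|^2) / |x - xi|^2)^s] solves the equation in [x], so its integral
    against [f] does too, by differentiation under the integral sign.  The equation has no maximum
    principle when [s (n - s) > 0], but the quotient of a solution by a positive strict
    supersolution has one.  With the supersolution [rho0^(n/2)] one sees that the radial solution
    [rho0^(n - s) F(|x|^2)] is nonnegative; adding it to [rho0^(n/2)] gives a supersolution of
    boundary order [rho0^(n - s)], whence uniqueness.  The Poisson integral of 1 is radial by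
    rotation invariance, hence a multiple of that radial solution; Gauss's evaluation of
    [F(a, b; c; 1)], the duplication formula for Gamma and the area of the sphere show that the
    stated constant normalizes its boundary value to 1, and the kernel is then an approximate
    identity.  For a homogeneous harmonic polynomial [P] of degree [l], separation of variables
    turns the equation for [rho0^(n - s) phi(|x|^2) P] into the hypergeometric equation, so by
    uniqueness this is the Poisson integral of [P] on the sphere; the expansion of a general [f]
    follows since [f |-> u x] is continuous for the L^2 norm. *)

(** The sphere integral is an iterated one-variable integral of a function that jumps across the
    sphere and, through [theta], at the origin; as [Rintegral] reads an infinite integral as 0, even
    linearity has to be earned. It is proved by induction on the number of variables for uniformly
    continuous functions of compact support ([uc]) and carried over by bounded convergence along
    continuous cut-offs; rotation invariance takes the same road. Solutions are handled through
    explicit first and second derivatives, jointly continuous in the point and in a parameter on the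
    sphere. The compactness of the sphere then makes all estimates uniform in the parameter, and
    derivatives of integrals can be named. The exponents come from the indicial polynomial
    [b^2 - n b + s (n - s)], the leading effect of the operator on [rho0^b] at the sphere. Its roots
    are [s] and [n - s]; at the vertex [n/2] it equals [- gamma^2 < 0], hence the strict
    supersolution [rho0^(n/2)]. That function is much smaller at the sphere than [rho0^(n - s)], the
    size of the solutions, so it cannot absorb an error that is merely small relative to
    [rho0^(n - s)]; this forces the detour through the radial solution. *)

Section IteratedIntegral.
Variable R : realType.
Local Notation mu := (@lebesgue_measure R).

Lemma continuous_supp_integrable (g : R -> R) (A : R) :
  continuous g -> (forall t, A < `|t| -> g t = 0) ->
  mu.-integrable setT (EFin \o g).
Proof.
move=> cg g0.
have -> : EFin \o g = (EFin \o g) \_ `[-A, A]%classic.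
  apply/funext => t; rewrite patchE; case: ifPn => // /negP; rewrite inE /= in_itv /=.
  by move=> /negP; rewrite -ler_norml -ltNge => /g0 ->.
have := integrable_mkcond (mu := mu) (EFin \o g) (measurable_itv `[-A, A]).
case=> + _; apply.
apply: continuous_compact_integrable; first exact: segment_compact.
exact: continuous_subspaceT.
Qed.

Lemma Rintegral_supp_bound (g : R -> R) (A M : R) : 0 <= A ->
  continuous g -> (forall t, A < `|t| -> g t = 0) ->
  (forall t, `|g t| <= M) -> `|\int[mu]_t g t| <= M * (2 * A).
Proof.
move=> A0 cg g0 gM.
have ig := continuous_supp_integrable cg g0.
apply: (le_trans (le_normr_Rintegral measurableT ig)).
have -> : \int[mu]_t `|g t| = \int[mu]_(t in `[-A, A]) `|g t|.
  rewrite [RHS]Rintegral_mkcond; apply: eq_Rintegral => t _ /=.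
  rewrite patchE; case: ifPn => // /negP; rewrite inE /= in_itv /=.
  by move=> /negP; rewrite -ler_norml -ltNge => /g0 ->; rewrite normr0.
have -> : M * (2 * A) = \int[mu]_(t in `[-A, A]) M.
  rewrite Rintegral_cst; last exact: measurable_itv.
  rewrite [X in fine X](lebesgue_measure_itv `[-A, A]) /= lte_fin.
  case: ltP => h /=; first by ring.
  have -> : A = 0 by lra.
  by rewrite !mulr0.
apply: le_Rintegral => //.
- apply: continuous_compact_integrable; first exact: segment_compact.
  by apply: continuous_subspaceT => t; apply: continuous_comp; [exact: cg|exact: norm_continuous].
- apply: continuous_compact_integrable; first exact: segment_compact.
  by apply: continuous_subspaceT => t; exact: cst_continuous.
Qed.

Lemma dominated_Rintegral (D : set R) (f_ : nat -> R -> R) (f g : R -> R) :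
  measurable D -> (forall j, measurable_fun D (f_ j)) ->
  (forall t, D t -> f_ ^~ t @ \oo --> f t) ->
  mu.-integrable D (EFin \o g) -> (forall j t, D t -> `|f_ j t| <= g t) ->
  \int[mu]_(t in D) f_ j t @[j --> \oo] --> \int[mu]_(t in D) f t.
Proof.
move=> mD mf ff ig fg.
have [] := @dominated_convergence _ (measurableTypeR R) R mu D mD
  (fun j => EFin \o f_ j) (EFin \o f) (EFin \o g).
- by move=> j; apply/measurable_EFinP; exact: mf.
- by apply/measurable_EFinP; exact: (measurable_fun_cvg mf ff).
- by apply: aeW => t Dt; apply: cvg_EFin; [exact: nearW|exact: ff].
- exact: ig.
- by apply: aeW => t j Dt; rewrite /= lee_fin; exact: fg.
move=> iL _ cL.
apply: (fine_cvg (f := fun j => (\int[mu]_(t in D) (f_ j t)%:E)%E)).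
by rewrite /Rintegral fineK //; exact: integrable_fin_num iL.
Qed.

(** Functions of [k] real variables: bounded by [M], supported in the cube of half-side [A],
    uniformly continuous for the sup distance. All three conditions pass to slices with the same [A]
    and [M], so an induction on [k] needs no product measure. *)
Definition uc (k : nat) (A M : R) (F : seq R -> R) : Prop :=
  [/\ forall s, size s = k -> `|F s| <= M,
      forall s, size s = k -> ~~ all (fun t => `|t| <= A) s -> F s = 0 &
      forall e, 0 < e -> exists2 d, 0 < d & forall s t, size s = k -> size t = k ->
        all2 (fun a b => `|a - b| <= d) s t -> `|F s - F t| <= e].

Lemma iter_int_ext k (F G : seq R -> R) :
  (forall s, size s = k -> F s = G s) -> iter_int k F = iter_int k G.
Proof.
elim: k F G => [|k IH] F G FG /=; first exact: FG.
apply: eq_Rintegral => t _; apply: IH => s ss; apply: FG.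
by rewrite /= ss.
Qed.

Lemma all2_refl_dist (s : seq R) d : 0 < d -> all2 (fun a b => `|a - b| <= d) s s.
Proof. by move=> d0; elim: s => //= a s ->; rewrite subrr normr0 ltW. Qed.

Lemma uc_section k A M F t : uc k.+1 A M F -> uc k A M (fun s => F (t :: s)).
Proof.
case=> FM F0 Fc; split.
- by move=> s ss; apply: FM => /=; rewrite ss.
- by move=> s ss sA; apply: F0 => /=; rewrite ?ss // negb_and sA orbT.
- move=> e e0; have [d d0 Hd] := Fc e e0; exists d => // s s' ss ss' ?.
  by apply: Hd; rewrite /= ?ss ?ss' // subrr normr0 ltW.
Qed.

Lemma uc_ge0 k A M F : uc k A M F -> 0 <= M.
Proof.
case=> FM _ _; apply: le_trans (FM (nseq k 0) _); rewrite ?size_nseq //.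
Qed.

Lemma uc_lin k A M N (a : R) F G : uc k A M F -> uc k A N G ->
  uc k A (`|a| * M + N) (fun s => a * F s + G s).
Proof.
move=> uF uG; have M0 := uc_ge0 uF; case: uF => FM F0 Fc; case: uG => GM G0 Gc; split.
- move=> s ss; apply: (le_trans (ler_normD _ _)); rewrite normrM.
  by apply: lerD; [apply: ler_wpM2l => //; exact: FM|exact: GM].
- by move=> s ss sA; rewrite F0 // G0 // mulr0 addr0.
- move=> e e0.
  have a1 : 0 < `|a| + 1 by rewrite ltr_wpDl.
  have [d d0 Hd] := Fc (e / 2 / (`|a| + 1)) ltac:(by rewrite !divr_gt0).
  have [d' d'0 Hd'] := Gc (e / 2) ltac:(by rewrite !divr_gt0).
  exists (Num.min d d'); first by rewrite lt_min d0.
  move=> s t ss st st_d.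
  have sub x : Num.min d d' <= x -> all2 (fun a0 b : R => `|a0 - b| <= x) s t.
    move=> dx; move: st_d {ss st}; elim: s t => [|u s IH] [|v t] //= /andP[uv /IH ->].
    by rewrite (le_trans uv).
  have -> : a * F s + G s - (a * F t + G t) = a * (F s - F t) + (G s - G t) by ring.
  apply: (le_trans (ler_normD _ _)); rewrite normrM.
  have -> : e = e / 2 + e / 2 by field.
  apply: lerD; last by apply: Hd' => //; apply: sub; rewrite ge_min lexx orbT.
  apply: (@le_trans _ _ (`|a| * (e / 2 / (`|a| + 1)))).
    by apply: ler_wpM2l => //; apply: Hd => //; apply: sub; rewrite ge_min lexx.
  rewrite mulrA ler_pdivrMr // mulrC ler_wpM2l //; [lra|].
  by rewrite lerDl.
Qed.

(** Uniform continuity makes the difference of two close slices a function of class [uc] with bound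
    [e]. The bound on its integral is then the continuity of the partial integral in [t]. *)
Lemma uc_sectionB k A M F t : 0 <= A -> uc k.+1 A M F -> forall e, 0 < e ->
  exists2 d, 0 < d & forall t', `|t - t'| <= d ->
    uc k A e (fun s => (-1) * F (t' :: s) + F (t :: s)).
Proof.
move=> A0 uF e e0; have [_ _ Fc] := uF.
have [d d0 Hd] := Fc e e0; exists d => // t' tt'.
have [_ h2 h3] := uc_lin (-1) (uc_section t' uF) (uc_section t uF).
split => // s ss.
rewrite mulN1r addrC; apply: Hd; rewrite /= ?ss // tt' /=.
exact: all2_refl_dist.
Qed.

(* Bound and linearity are proved together: continuity of the partial integral,
   needed for integrability at the next level, uses both. *)
Definition bounded_linear_int k A :=
  (forall M F, uc k A M F -> `|iter_int k F| <= M * (2 * A) ^+ k) /\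
  (forall M N a F G, uc k A M F -> uc k A N G ->
     iter_int k (fun s => a * F s + G s) = a * iter_int k F + iter_int k G).

Lemma partial_int_aux k A M F : 0 <= A -> bounded_linear_int k A -> uc k.+1 A M F ->
  (forall t, A < `|t| -> iter_int k (fun s => F (t :: s)) = 0) /\
  continuous (fun t => iter_int k (fun s => F (t :: s))).
Proof.
move=> A0 [IHb IHl] uF; split.
  move=> t At; case: uF => [FM F0 _]; apply/eqP; rewrite -normr_le0.
  (* Beyond the support the slice is of class [uc] with bound 0, so the inductive bound forces its
     integral to vanish. *)
  rewrite -(mul0r ((2 * A) ^+ k)); apply: IHb; split => [s ss|s ss _|e e0].
  - by rewrite F0 ?normr0 //= ?ss // negb_and -ltNge At.
  - by rewrite F0 //= ?ss // negb_and -ltNge At.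
  - exists 1 => // s s' ss ss' _.
    by rewrite !F0 /= ?subrr ?normr0 ?ss ?ss' // ?negb_and -?ltNge ?At // ltW.
move=> t; apply/cvgrPdist_le => e e0.
have c0 : 0 < (2 * A) ^+ k + 1 by rewrite ltr_wpDl // exprn_ge0 // mulr_ge0.
have [d d0 Hd] := uc_sectionB t A0 uF (e := e / ((2 * A) ^+ k + 1)) ltac:(by rewrite divr_gt0).
near=> t'.
have tt' : `|t - t'| <= d by near: t'; exact: cvgr_dist_le.
have := IHb _ _ (Hd t' tt').
rewrite (IHl _ _ _ _ _ (uc_section t' uF) (uc_section t uF)) mulN1r addrC => /le_trans; apply.
rewrite -mulrA ler_piMr ?(ltW e0) // mulrC ler_pdivrMr // mul1r.
by rewrite lerDl.
Unshelve. all: by end_near. Qed.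

Lemma iter_int_bounded_linear k A : 0 <= A -> bounded_linear_int k A.
Proof.
move=> A0; elim: k => [|k IH].
  by split => [M F [FM _ _]|//]; rewrite expr0 mulr1; exact: FM.
split => [M F uF /=|M N a F G uF uG /=].
  have [J0 Jc] := partial_int_aux A0 IH uF.
  rewrite exprSr mulrA; apply: Rintegral_supp_bound => //.
  by move=> t; apply: IH.1; exact: uc_section.
have [F0 Fc] := partial_int_aux A0 IH uF.
have [G0 Gc] := partial_int_aux A0 IH uG.
have iF := continuous_supp_integrable Fc F0.
have iG := continuous_supp_integrable Gc G0.
under eq_Rintegral do rewrite (IH.2 _ _ _ _ _ (uc_section _ uF) (uc_section _ uG)).
rewrite RintegralD // ?RintegralZl //.
have := integrableZl measurableT a iF; congr (is_true (integrable _ _ _)).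
Qed.

Section Fixed.
Variables (k : nat) (A : R).
Hypothesis A0 : 0 <= A.

Lemma iter_int_bound M F : uc k A M F -> `|iter_int k F| <= M * (2 * A) ^+ k.
Proof. exact: (iter_int_bounded_linear k A0).1. Qed.

Lemma iter_int_lin M N a F G : uc k A M F -> uc k A N G ->
  iter_int k (fun s => a * F s + G s) = a * iter_int k F + iter_int k G.
Proof. exact: (iter_int_bounded_linear k A0).2. Qed.

Lemma partial_int_supp M F t : uc k.+1 A M F -> A < `|t| ->
  iter_int k (fun s => F (t :: s)) = 0.
Proof.
by move=> uF; have [h _] := partial_int_aux A0 (iter_int_bounded_linear k A0) uF; exact: h.
Qed.

Lemma partial_int_cont M F : uc k.+1 A M F ->
  continuous (fun t => iter_int k (fun s => F (t :: s))).
Proof. by move=> uF; have [] := partial_int_aux A0 (iter_int_bounded_linear k A0) uF. Qed.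

End Fixed.

Lemma iter_int_ge0 k (F : seq R -> R) : (forall s, size s = k -> 0 <= F s) -> 0 <= iter_int k F.
Proof.
elim: k F => [|k IH] F F0 /=; first exact: F0.
by apply: Rintegral_ge0 => t _; apply: IH => s ss; apply: F0; rewrite /= ss.
Qed.

(** Dominated convergence one variable at a time: the inner integrals are bounded by the constant
    [M (2 A)^k] on [[-A, A]] and vanish outside. The limit may be discontinuous, which is how the
    indicator of the ball is reached. *)
Lemma iter_int_bounded_cvg k A M (F_ : nat -> seq R -> R) (F : seq R -> R) : 0 <= A ->
  (forall j, uc k A M (F_ j)) ->
  (forall s, size s = k -> F_ ^~ s @ \oo --> F s) ->
  iter_int k (F_ j) @[j --> \oo] --> iter_int k F.
Proof.
move=> A0; elim: k F_ F => [|k IH] F_ F uF FF /=; first exact: FF.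
pose J j t := iter_int k (fun s => F_ j (t :: s)).
pose g := (fun=> M * (2 * A) ^+ k) \_ `[-A, A]%classic.
have ig : mu.-integrable setT (EFin \o g).
  rewrite /g -restrict_EFin.
  have [h _] := integrable_mkcond (mu := mu) (EFin \o (fun=> M * (2 * A) ^+ k)) (measurable_itv `[-A, A]).
  apply: h; apply: continuous_compact_integrable; first exact: segment_compact.
  by apply: continuous_subspaceT => t; exact: cst_continuous.
have M0 := uc_ge0 (uF 0%N).
apply: (dominated_Rintegral measurableT _ _ ig) => [j|t _|j t _].
- apply: (@continuous_measurable_fun _ (J j)).
  exact: (partial_int_cont A0 (uF j)).
- apply: IH => [j|s ss]; first exact: uc_section (uF j).
  by apply: FF; rewrite /= ss.
- rewrite /g patchE; case: ifPn => [_|/negP]; last first.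
    rewrite inE /= in_itv /= -ler_norml => /negP tA.
    by rewrite /J (partial_int_supp A0 (uF j)) ?normr0 // ltNge.
  by apply: iter_int_bound => //; exact: uc_section (uF j).
Qed.

End IteratedIntegral.

(** * Fubini, shears and rotations for continuous functions of compact support in the plane *)

Section PlaneInvariance.
Variable R : realType.
Local Notation mu := (@lebesgue_measure R).

Lemma continuous_pos_part (T : topologicalType) (g : T -> R) :
  continuous g -> continuous (fun t => Num.max (g t) 0).
Proof.
by move=> cg t; apply: (@continuous_max _ _ g (fun=> 0)); [exact: cg|exact: cst_continuous].
Qed.

Lemma pos_neg_parts (x : R) : x = Num.max x 0 - Num.max (- x) 0.
Proof. by rewrite !maxEle; case: (leP x 0); case: (leP (-x) 0) => h1 h2; lra. Qed.

Lemma Rintegral_affine_ge0 (g : R -> R) (c a : R) : 0 < c ->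
  continuous g -> (forall t, 0 <= g t) ->
  \int[mu]_t (g (c * t + a) * c) = \int[mu]_t g t.
Proof.
move=> c0 cg g0.
have D t : is_derive t (1 : R) (fun t => c * t + a) c.
  by apply: is_derive_eq; rewrite addr0 [c *: 1]mulr1.
have D1 : derive1 (fun t : R => c * t + a) = fun=> c.
  by apply/funext => t; rewrite derive1E (@derive_val _ _ _ _ _ _ _ (D t)).
rewrite /Rintegral; congr fine; apply/esym.
rewrite (@increasing_ge0_integration_by_substitutionT _ (fun t => c * t + a) g).
- by apply: eq_integral => t _; rewrite /= D1.
- by move=> x y xy; rewrite ltrD2r ltr_pM2l.
- by rewrite D1 => x; exact: cst_continuous.
- by rewrite D1; exact: is_cvg_cst.
- by rewrite D1; exact: is_cvg_cst.
- by move=> x; apply: (@ex_derive _ _ _ _ _ _ _ (D x)).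
- apply/cvgrNyPle => M; near=> x.
  have : x <= (M - a) / c by near: x; apply: nbhs_ninfty_le; exact: num_real.
  by rewrite ler_pdivlMr // mulrC; lra.
- apply/cvgryPge => M; near=> x.
  have : (M - a) / c <= x by near: x; apply: nbhs_pinfty_ge; exact: num_real.
  by rewrite ler_pdivrMr // mulrC; lra.
- exact: cg.
- exact: g0.
Unshelve. all: by end_near. Qed.

(** The change of variables on the whole line is available for nonnegative functions, so it is
    applied to the positive and negative parts, both of compact support and hence integrable. *)
Lemma Rintegral_affine (g : R -> R) (c a A : R) : 0 < c -> continuous g ->
  (forall t, A < `|t| -> g t = 0) -> \int[mu]_t g (c * t + a) = c^-1 * \int[mu]_t g t.
Proof.
move=> c0 cg g0.
have caf : continuous (fun t : R => c * t + a).
  move=> t; apply: cvgD; last exact: cvg_cst.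
  by apply: cvgM; [exact: cvg_cst|exact: cvg_id].
have caff (h : R -> R) : continuous h -> continuous (fun t => h (c * t + a)).
  by move=> ch t; apply: continuous_comp; [exact: caf|exact: ch].
have saff (h : R -> R) : (forall t, A < `|t| -> h t = 0) ->
    forall t, (`|A| + `|a|) / c < `|t| -> h (c * t + a) = 0.
  move=> h0 t; rewrite ltr_pdivrMr // => ht; apply: h0.
  have := ler_normB (c * t + a) a; rewrite addrK normrM (gtr0_norm c0).
  have := ler_norm A; lra.
have key (h : R -> R) : continuous h -> (forall t, A < `|t| -> h t = 0) -> (forall t, 0 <= h t) ->
    \int[mu]_t h (c * t + a) = c^-1 * \int[mu]_t h t.
  move=> ch h0 hp; rewrite -(Rintegral_affine_ge0 a c0 ch hp) RintegralZr //.
    by rewrite mulrCA mulVf ?gt_eqF // mulr1.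
  exact: (continuous_supp_integrable (caff _ ch) (saff _ h0)).
pose gp t := Num.max (g t) 0; pose gn t := Num.max (- g t) 0.
have cgp : continuous gp by exact: continuous_pos_part.
have cgn : continuous gn.
  by apply: (@continuous_pos_part _ (fun t => - g t)) => t; apply: cvgN; exact: cg.
have sgp t : A < `|t| -> gp t = 0 by move=> At; rewrite /gp g0 // maxxx.
have sgn t : A < `|t| -> gn t = 0 by move=> At; rewrite /gn g0 // oppr0 maxxx.
have pgp t : 0 <= gp t by rewrite /gp le_max lexx orbT.
have pgn t : 0 <= gn t by rewrite /gn le_max lexx orbT.
have -> : g = fun t => gp t - gn t by apply/funext => t; exact: pos_neg_parts.
rewrite !RintegralB //; try exact: (continuous_supp_integrable (A := A)).
- by rewrite mulrBr !key.
- exact: (continuous_supp_integrable (caff _ cgp) (saff _ sgp)).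
- exact: (continuous_supp_integrable (caff _ cgn) (saff _ sgn)).
Qed.

(** The product sigma-algebra is generated by rectangles; an open set belongs to it as the union of
    the countably many rational open squares that it contains. *)
Lemma open_prod_measurable (U : set (R * R)) : open U -> measurable U.
Proof.
move=> oU.
pose box (q : rat * rat * rat) : set (R * R) :=
  `](ratr q.1.1 - ratr q.2), (ratr q.1.1 + ratr q.2)[%classic `*`
  `](ratr q.1.2 - ratr q.2), (ratr q.1.2 + ratr q.2)[%classic.
have -> : U = \bigcup_(q in [set q | box q `<=` U]) box q.
  apply/seteqP; split => [[x y] Uxy|z [q qU qz]]; last exact: qU.
  have /nbhs_ballP[e /= e0 he] : nbhs (x, y) U by exact: open_nbhs_nbhs.
  have e4 : 0 < e / 4 by rewrite divr_gt0.
  have e2 : e / 4 < e / 2 by lra.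
  have [r] := rat_in_itvoo e2; rewrite in_itv /= => /andP[r1 r2].
  have [p] : exists p : rat, ratr p \in `](x - e / 4), (x + e / 4)[.
    by apply: rat_in_itvoo; lra.
  rewrite in_itv /= => /andP[p1 p2].
  have [q] : exists p : rat, ratr p \in `](y - e / 4), (y + e / 4)[.
    by apply: rat_in_itvoo; lra.
  rewrite in_itv /= => /andP[q1 q2].
  exists (p, q, r).
    move=> [a b] [] /=; rewrite !in_itv /= => /andP[a1 a2] /andP[b1 b2].
    apply: he; split => /=; rewrite /ball /= ltr_norml; apply/andP; split; lra.
  by split => /=; rewrite in_itv /=; apply/andP; split; lra.
rewrite bigcup_mkcond; apply: countable_bigcupT_measurable => // q.
case: ifPn => _; last exact: measurable0.
by apply: measurableX; exact: measurable_itv.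
Qed.

Lemma continuous_prod_measurable (f : R * R -> R) :
  continuous f -> measurable_fun setT f.
Proof.
move=> cf; apply: (measurability _ (RGenOInfty.measurableE R)) => //.
move=> /= _ [_ [a ->] <-]; rewrite setTI; apply: open_prod_measurable.
move/continuousP : cf; apply; exact: interval_open.
Qed.

Lemma continuous_pair (T U V : topologicalType) (f : T -> U) (g : T -> V) x :
  {for x, continuous f} -> {for x, continuous g} ->
  {for x, continuous (fun t => (f t, g t))}.
Proof. by move=> cf cg; apply: (cvg_pair (F := nbhs x)); [exact: cf|exact: cg]. Qed.

Definition cc2 (G : R -> R -> R) :=
  (exists A, forall t1 t2, (A < `|t1|) || (A < `|t2|) -> G t1 t2 = 0) /\
  continuous (fun p : R * R => G p.1 p.2).

Definition int2 (G : R -> R -> R) := \int[mu]_t1 (\int[mu]_t2 G t1 t2).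

Lemma cc2_section1 G t1 : cc2 G -> continuous (G t1).
Proof.
move=> [_ cG] t2; apply: (@continuous_comp _ _ _ (fun t : R => (t1, t)) (fun p => G p.1 p.2)).
  by apply: continuous_pair; [exact: cvg_cst|exact: cvg_id].
exact: cG.
Qed.

Lemma cc2_swap G : cc2 G -> cc2 (fun t1 t2 => G t2 t1).
Proof.
move=> [[A GA] cG]; split; first by exists A => t1 t2; rewrite orbC; exact: GA.
move=> p; apply: (@continuous_comp _ _ _ (fun p : R * R => (p.2, p.1)) (fun p => G p.1 p.2)).
  by apply: continuous_pair; [exact: cvg_snd|exact: cvg_fst].
exact: cG.
Qed.

Lemma cc2_integrable G t1 : cc2 G -> mu.-integrable setT (EFin \o (G t1)).
Proof.
move=> cG; have [[A GA] _] := cG.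
apply: (continuous_supp_integrable (A := A)); first exact: cc2_section1.
by move=> t tA; apply: GA; rewrite tA orbT.
Qed.

Lemma fubini_cc2_ge0 G : cc2 G -> (forall t1 t2, 0 <= G t1 t2) ->
  int2 G = int2 (fun t1 t2 => G t2 t1).
Proof.
move=> cG G0; have cG' := cc2_swap cG.
rewrite /int2 /Rintegral; congr fine.
under eq_integral => t1 _ do rewrite fineK ?(integrable_fin_num measurableT (cc2_integrable t1 cG)) //.
under [RHS]eq_integral => t1 _ do rewrite fineK ?(integrable_fin_num measurableT (cc2_integrable t1 cG')) //.
apply: (fubini_tonelli (m1 := mu) (m2 := mu) (fun p => (G p.1 p.2)%:E)).
- by apply/measurable_EFinP; apply: continuous_prod_measurable; have [] := cG.
- by move=> p; rewrite lee_fin.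
Qed.

Lemma cc2_pos G : cc2 G -> cc2 (fun t1 t2 => Num.max (G t1 t2) 0).
Proof.
move=> [[A GA] cG]; split; last exact: continuous_pos_part.
by exists A => t1 t2 h; rewrite GA // maxxx.
Qed.

Lemma cc2_opp G : cc2 G -> cc2 (fun t1 t2 => - G t1 t2).
Proof.
move=> [[A GA] cG]; split; last by move=> p; apply: cvgN; exact: cG.
by exists A => t1 t2 h; rewrite GA // oppr0.
Qed.

(** Needed to split the outer integral of a difference: the inner integral is at most the maximum of
    [G] times the length of the support, and vanishes outside a segment. *)
Lemma cc2_ge0_int_integrable G : cc2 G -> (forall t1 t2, 0 <= G t1 t2) ->
  mu.-integrable setT (EFin \o (fun t1 => \int[mu]_t2 G t1 t2)).
Proof.
move=> cG G0; have [[A GA] cG2] := cG.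
(* The support bound [A] may be negative, while the square on which the maximum is taken must be
   nonempty. *)
pose B := `|A|.
have GB t1 t2 : (B < `|t1|) || (B < `|t2|) -> G t1 t2 = 0.
  by have hA := ler_norm A; move=> /orP[]h; apply: GA; apply/orP; [left|right]; exact: le_lt_trans h.
have [M0 M0p GM] : exists2 M, 0 <= M & forall t1 t2, G t1 t2 <= M.
  have cK : compact (`[-B, B]%classic `*` `[-B, B]%classic : set (R * R)).
    by apply: compact_setX; exact: segment_compact.
  have nK : (`[-B, B]%classic `*` `[-B, B]%classic : set (R * R)) !=set0.
    by exists (0, 0); split => /=; rewrite in_itv /= oppr_le0 normr_ge0.
  have [p _ pM] := compact_EVT_max nK cK (continuous_subspaceT cG2).
  exists (G p.1 p.2) => // t1 t2.
  case: (boolP ((B < `|t1|) || (B < `|t2|))) => [/GB -> //|].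
  rewrite negb_or -!leNgt => /andP[h1 h2].
  by apply: (pM (t1, t2)); rewrite inE; split => /=; rewrite in_itv /= -ler_norml.
have mG : measurable_fun setT (fun t1 : R => \int[mu]_t2 (G t1 t2)%:E)%E.
  apply: (measurable_fun_fubini_tonelli_F (m2 := mu) (fun p : R * R => (G p.1 p.2)%:E)).
    by apply/measurable_EFinP; exact: continuous_prod_measurable.
  by move=> p; rewrite lee_fin.
have fE t1 : ((\int[mu]_t2 G t1 t2)%:E = \int[mu]_t2 (G t1 t2)%:E)%E.
  by rewrite fineK // (integrable_fin_num measurableT (cc2_integrable t1 cG)).
have [hi _] := integrable_mkcond (mu := mu) (EFin \o (fun=> M0 * (2 * B)))
                 (measurable_itv `[-B, B]).
apply: (le_integrable measurableT _ _ (hi _)).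
- by move: mG; congr (measurable_fun _ _); apply/funext => t1 /=; rewrite fE.
- move=> t1 _; rewrite patchE; case: ifPn => [_|/negP].
    rewrite /= lee_fin ger0_norm; last by apply: Rintegral_ge0.
    apply: le_trans (ler_norm _); apply: le_trans (ler_norm _) _.
    apply: Rintegral_supp_bound => //; first exact: normr_ge0.
    + exact: cc2_section1.
    + by move=> t ht; apply: GB; rewrite ht orbT.
    + by move=> t; rewrite ger0_norm.
  rewrite inE /= in_itv /= -ler_norml => /negP; rewrite -ltNge => tB.
  rewrite (_ : Rintegral _ _ _ = 0) ?normr0 //.
  rewrite -[RHS](@Rintegral_set0 _ _ _ mu (fun=> 0)) Rintegral_mkcond.
  by apply: eq_Rintegral => t _; rewrite patch_set0 GB // tB.
- apply: continuous_compact_integrable; first exact: segment_compact.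
  by apply: continuous_subspaceT => t; exact: cst_continuous.
Qed.

Lemma int2_pos_neg G : cc2 G -> int2 G =
  int2 (fun t1 t2 => Num.max (G t1 t2) 0) - int2 (fun t1 t2 => Num.max (- G t1 t2) 0).
Proof.
move=> cG; rewrite /int2 -RintegralB //.
- apply: eq_Rintegral => t1 _.
  have i1 := cc2_integrable t1 (cc2_pos cG).
  have i2 := cc2_integrable t1 (cc2_pos (cc2_opp cG)).
  by rewrite -RintegralB //; apply: eq_Rintegral => t2 _; exact: pos_neg_parts.
- by apply: cc2_ge0_int_integrable; [exact: cc2_pos|move=> *; rewrite le_max lexx orbT].
- apply: cc2_ge0_int_integrable; [|by move=> *; rewrite le_max lexx orbT].
  by apply: cc2_pos; exact: cc2_opp.
Qed.

Lemma fubini_cc2 G : cc2 G -> int2 G = int2 (fun t1 t2 => G t2 t1).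
Proof.
move=> cG; rewrite int2_pos_neg // (int2_pos_neg (cc2_swap cG)).
congr (_ - _); (rewrite fubini_cc2_ge0 //; last by move=> *; rewrite le_max lexx orbT).
  exact: cc2_pos.
by apply: cc2_pos; exact: cc2_opp.
Qed.

Lemma cc2_shear2 G a : cc2 G -> cc2 (fun t1 t2 => G t1 (t2 + a * t1)).
Proof.
move=> [[A GA] cG]; split.
  exists (`|A| + `|a| * `|A|) => t1 t2 h.
  have hA := ler_norm A; have a0 := normr_ge0 a.
  have aA : 0 <= `|a| * `|A| by rewrite mulr_ge0.
  apply: GA; case: (ltP `|A| `|t1|) => h1; first by apply/orP; left; lra.
  apply/orP; right; have h2 : `|a| * `|t1| <= `|a| * `|A| by rewrite ler_wpM2l.
  have := ler_normB (t2 + a * t1) (a * t1); rewrite addrK normrM.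
  by case/orP: h; lra.
move=> p; apply: (@continuous_comp _ _ _ (fun p : R * R => (p.1, p.2 + a * p.1)) (fun p => G p.1 p.2)).
  apply: continuous_pair; first exact: cvg_fst.
  apply: cvgD; first exact: cvg_snd.
  by apply: cvgM; [exact: cvg_cst|exact: cvg_fst].
exact: cG.
Qed.

Lemma int2_shear2 G a : cc2 G -> int2 (fun t1 t2 => G t1 (t2 + a * t1)) = int2 G.
Proof.
move=> cG; apply: eq_Rintegral => t1 _.
have [[A GA] _] := cG.
have := @Rintegral_affine (G t1) 1 (a * t1) A ltr01 (cc2_section1 (t1 := t1) cG).
rewrite invr1 mul1r => <-; last by move=> t tA; apply: GA; rewrite tA orbT.
by apply: eq_Rintegral => t _; rewrite mul1r.
Qed.

Lemma cc2_shear1 G a : cc2 G -> cc2 (fun t1 t2 => G (t1 + a * t2) t2).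
Proof. by move=> /cc2_swap /(cc2_shear2 a) /cc2_swap. Qed.

(** A shear of the first variable is not a translation of the inner integral; exchanging the two
    integrals makes it one. *)
Lemma int2_shear1 G a : cc2 G -> int2 (fun t1 t2 => G (t1 + a * t2) t2) = int2 G.
Proof.
move=> cG; rewrite (fubini_cc2 (cc2_shear1 a cG)).
by rewrite (int2_shear2 a (cc2_swap cG)) -fubini_cc2.
Qed.

(* A rotation of the plane is a product of three shears (except the half turn). *)
Lemma int2_rot G c d : cc2 G -> c ^+ 2 + d ^+ 2 = 1 ->
  int2 (fun t1 t2 => G (c * t1 - d * t2) (d * t1 + c * t2)) = int2 G.
Proof.
have main H c' d' : cc2 H -> c' ^+ 2 + d' ^+ 2 = 1 -> d' != 0 ->
    cc2 (fun t1 t2 => H (c' * t1 - d' * t2) (d' * t1 + c' * t2)) /\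
    int2 (fun t1 t2 => H (c' * t1 - d' * t2) (d' * t1 + c' * t2)) = int2 H.
  (* With [c'] and [d'] the cosine and sine of an angle, [tau] is the tangent of its half. The three
     shears have coefficients [- tau], [d'], [- tau]. *)
  move=> cH cd d0; pose tau := (1 - c') / d'.
  have -> : (fun t1 t2 => H (c' * t1 - d' * t2) (d' * t1 + c' * t2)) =
    (fun t1 t2 => (fun t1 t2 => (fun t1 t2 => H (t1 + (- tau) * t2) t2) t1 (t2 + d' * t1))
      (t1 + (- tau) * t2) t2).
    apply/funext => t1; apply/funext => t2 /=.
    have td : tau * d' = 1 - c' by rewrite /tau; field.
    have tc : tau * (1 + c') = d'.
      apply: (mulIf d0); rewrite mulrAC td; move: cd; rewrite !expr2 => cd.
      have : d' * d' = 1 - c' * c' by lra.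
      by move=> ->; ring.
    congr H.
      have -> : c' * t1 - d' * t2 = (1 - tau * d') * t1 - (tau * (1 + c')) * t2 by rewrite tc td; ring.
      have -> : c' = 1 - tau * d' by rewrite td; ring.
      by ring.
    have -> : d' * t1 + c' * t2 = d' * t1 + (1 - tau * d') * t2 by rewrite td; ring.
    by ring.
  have c1 := cc2_shear1 (- tau) cH.
  have c2 := cc2_shear2 d' c1.
  have c3 := cc2_shear1 (- tau) c2.
  by split => //; rewrite (int2_shear1 _ c2) (int2_shear2 _ c1) int2_shear1.
move=> cG cd; have [d0|d0] := eqVneq d 0; last by have [] := main G c d cG cd d0.
have : c = 1 \/ c = -1.
  move: cd; rewrite d0 expr0n addr0 => /eqP; rewrite sqrf_eq1 => /orP[]/eqP; tauto.
case=> ->; rewrite d0.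
  by congr int2; apply/funext => t1; apply/funext => t2; rewrite !mul1r !mul0r subr0 add0r.
(* The half turn has zero sine and escapes the shear formula; it is the quarter turn applied
   twice. *)
have e1 : (0 : R) ^+ 2 + 1 ^+ 2 = 1 by rewrite expr0n expr1n add0r.
have [c1 i1] := main G 0 1 cG e1 (oner_neq0 _).
have [_ i2] := main _ 0 1 c1 e1 (oner_neq0 _).
rewrite -i1 -i2; congr int2; apply/funext => t1; apply/funext => t2.
by congr G; ring.
Qed.

End PlaneInvariance.

(** * Rotations in consecutive coordinate planes of an iterated integral *)

Section Rotations.
Variable R : realType.
Implicit Types s : seq R.

Definition rot2 (c d : R) s :=
  if s is t1 :: t2 :: s' then [:: c * t1 - d * t2, d * t1 + c * t2 & s'] else s.

Fixpoint rot_at (c d : R) (i : nat) s :=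
  if i is i'.+1 then (if s is t :: s' then t :: rot_at c d i' s' else s) else rot2 c d s.

Lemma uc_cc2 k (A M : R) F : 0 <= A -> uc k.+2 A M F ->
  cc2 (fun t1 t2 => iter_int k (fun s => F [:: t1, t2 & s])).
Proof.
move=> A0 uF; split.
  exists A => t1 t2 /orP[h|h].
    have [_ F0 _] := uF; apply/eqP; rewrite -normr_le0.
    rewrite -(mul0r ((2 * A) ^+ k)); apply: iter_int_bound => //; split => [s ss|s ss _|e e0].
    - by rewrite F0 ?normr0 //= ?ss // !negb_and -ltNge h.
    - by rewrite F0 //= ?ss // !negb_and -ltNge h.
    - exists 1 => // s s' ss ss' _.
      by rewrite !F0 /= ?subrr ?normr0 ?ss ?ss' // ?negb_and -?ltNge ?h // ltW.
  exact: (partial_int_supp A0 (uc_section t1 uF) h).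
move=> [t1 t2]; apply/cvgrPdist_le => e e0.
have c0 : 0 < (2 * A) ^+ k + 1 by rewrite ltr_wpDl // exprn_ge0 // mulr_ge0.
have [_ _ Fc] := uF.
have [d d0 Hd] := Fc (e / ((2 * A) ^+ k + 1)) ltac:(by rewrite divr_gt0).
near=> p.
have p1 : `|t1 - p.1| <= d.
  by near: p; apply: cvgr_dist_le => //; exact: cvg_fst.
have p2 : `|t2 - p.2| <= d.
  by near: p; apply: cvgr_dist_le => //; exact: cvg_snd.
have u1 := uc_section t2 (uc_section t1 uF).
have u2 := uc_section p.2 (uc_section p.1 uF).
have [_ h2 h3] := uc_lin (-1) u2 u1.
have u3 : uc k A (e / ((2 * A) ^+ k + 1))
    (fun s => (-1) * F [:: p.1, p.2 & s] + F [:: t1, t2 & s]).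
  split => // s ss; rewrite mulN1r addrC; apply: Hd; rewrite /= ?ss // p1 p2 /=.
  exact: all2_refl_dist.
have := iter_int_bound A0 u3; rewrite (iter_int_lin A0 _ u2 u1) mulN1r addrC => /le_trans; apply.
rewrite -mulrA ler_piMr ?(ltW e0) // mulrC ler_pdivrMr // mul1r.
by rewrite lerDl.
Unshelve. all: by end_near. Qed.

(** The [i] outer integrals do not see the rotation; the next two form an [int2] whose integrand,
    the remaining inner integral, is of class [cc2]. *)
Lemma iter_int_rot_at (c d A M : R) i k F : c ^+ 2 + d ^+ 2 = 1 -> 0 <= A ->
  uc (i + k.+2)%N A M F ->
  iter_int (i + k.+2)%N (fun s => F (rot_at c d i s)) = iter_int (i + k.+2)%N F.
Proof.
move=> cd A0; elim: i F => [|i IH] F uF /=.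
  exact: (int2_rot (uc_cc2 A0 uF) cd).
by apply: eq_Rintegral => t _; exact: (IH (fun s => F (t :: s)) (uc_section t uF)).
Qed.

Definition sqs s : R := \sum_(t <- s) t ^+ 2.

Fixpoint dots (a s : seq R) : R :=
  match a, s with x :: a', y :: s' => x * y + dots a' s' | _, _ => 0 end.

Lemma sqs_ge0 s : 0 <= sqs s.
Proof. by apply: sumr_ge0 => t _; exact: sqr_ge0. Qed.

Lemma sqs_cons t s : sqs (t :: s) = t ^+ 2 + sqs s.
Proof. by rewrite /sqs big_cons. Qed.

Lemma size_rot_at c d i s : size (rot_at c d i s) = size s.
Proof. by elim: i s => [|i IH] [|t1 [|t2 s]] //=; rewrite IH. Qed.

Lemma sqs_rot_at c d i s : c ^+ 2 + d ^+ 2 = 1 -> sqs (rot_at c d i s) = sqs s.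
Proof.
move=> cd; elim: i s => [|i IH] [|t1 s] //=; last by rewrite !sqs_cons IH.
case: s => [|t2 s] //=; rewrite !sqs_cons.
transitivity ((c ^+ 2 + d ^+ 2) * t1 ^+ 2 + ((c ^+ 2 + d ^+ 2) * t2 ^+ 2 + sqs s)); first by ring.
by rewrite cd !mul1r.
Qed.

Lemma dots_rot_at c d i a s : c ^+ 2 + d ^+ 2 = 1 -> size a = size s ->
  dots (rot_at c d i a) (rot_at c d i s) = dots a s.
Proof.
move=> cd; elim: i a s => [|i IH] [|a1 a] [|t1 s] //= [ss]; last by rewrite IH.
case: a s ss => [|a2 a] [|t2 s] //= _.
transitivity ((c ^+ 2 + d ^+ 2) * (a1 * t1) + ((c ^+ 2 + d ^+ 2) * (a2 * t2) + dots a s)); first by ring.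
by rewrite cd !mul1r.
Qed.

(* Rotations in consecutive coordinate planes move any vector to the first axis. *)
Lemma rot_invariant_radial (k : nat) (I : seq R -> R) :
  (forall c d i a, c ^+ 2 + d ^+ 2 = 1 -> (i < k)%N -> size a = k.+1 ->
     I (rot_at c d i a) = I a) ->
  forall a, size a = k.+1 -> (0 < k)%N -> I a = I (Num.sqrt (sqs a) :: nseq k 0).
Proof.
elim: k I => [//|k IH] I HI [|a0 a] //= [sa] _.
(* The tail is first collapsed onto its own first axis. Only the square of [a1] is prescribed,
   because a tail of length one stays as it is and may be negative. *)
have [a1 [a1E Ia]] : exists a1 : R, a1 ^+ 2 = sqs a /\ I (a0 :: a) = I [:: a0, a1 & nseq k 0].
  case: k IH HI sa => [|k] IH HI sa.
    case: a sa => [|a1 [|//]] // _; exists a1; split => //.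
    by rewrite /sqs big_seq1.
  exists (Num.sqrt (sqs a)); split; first by rewrite sqr_sqrtr // sqs_ge0.
  apply: (IH (fun a' => I (a0 :: a'))) => // c d i a' cd ik sa'.
  by apply: (HI c d i.+1 (a0 :: a')) => //=; rewrite sa'.
rewrite Ia sqs_cons -a1E.
set r := Num.sqrt _.
have [r0|r0] := eqVneq (a0 ^+ 2 + a1 ^+ 2) 0.
  have : a0 ^+ 2 == 0 /\ a1 ^+ 2 == 0.
    by move/eqP: r0; rewrite paddr_eq0 ?sqr_ge0 // => /andP[].
  rewrite !sqrf_eq0 => -[/eqP -> /eqP ->].
  by rewrite /r r0 sqrtr0.
have rp : 0 < a0 ^+ 2 + a1 ^+ 2 by rewrite lt0r r0 addr_ge0 ?sqr_ge0.
have r2 : r ^+ 2 = a0 ^+ 2 + a1 ^+ 2 by rewrite sqr_sqrtr // ltW.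
have rn0 : r != 0 by rewrite gt_eqF // sqrtr_gt0.
(* The rotation with cosine [a0 / r] and sine [- a1 / r] sends [(a0, a1)] to [(r, 0)]. *)
rewrite -(HI (a0 / r) (- (a1 / r)) 0%N [:: a0, a1 & nseq k 0]) //=.
- congr I; congr [:: _, _ & _].
    by rewrite -[LHS](mulfK rn0) -[RHS](mulfK rn0) -expr2 r2; field.
  by field.
- by rewrite sqrrN !expr_div_n r2 -mulrDl divff.
- by rewrite size_nseq.
Qed.

End Rotations.

(** * The Gamma function *)

Section GammaFunction.
Variable R : realType.
Local Notation mu := (@lebesgue_measure R).

Definition gint (x t : R) : R := t `^ (x - 1) * expR (- t).
(** Kept in the extended reals because [Gamma] turns an infinite integral into 0: the recursion is
    proved here first, and finiteness is deduced from it. *)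
Definition EGamma (x : R) : \bar R := (\int[mu]_(t in `]0%R, +oo[) (gint x t)%:E)%E.
(** Compact intervals exhausting the half-line, on which the integrand is continuous; with [N.+2]
    the interval is nondegenerate already for [N = 0]. *)
Definition Gitv (N : nat) : set R := `[N.+2%:R^-1, N.+2%:R]%classic.

Lemma gint_ge0 x t : 0 <= gint x t.
Proof. by rewrite mulr_ge0 ?powR_ge0 ?expR_ge0. Qed.

Lemma measurable_gint x D : measurable_fun D (gint x).
Proof.
apply: (measurable_funS (E := setT)) => //.
apply: measurable_funM => //.
by apply: measurableT_comp => //; exact: measurable_oppr.
Qed.

Lemma powRD_gt0 (x r t : R) : 0 < x -> x `^ (r + t) = x `^ r * x `^ t.
Proof. by move=> x0; rewrite powRD // (gt_eqF x0) implybT. Qed.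

Lemma powR_continuous (a x : R) : 0 < x -> {for x, continuous (fun y : R => y `^ a)}.
Proof.
move=> x0; apply: differentiable_continuous; apply/derivable1_diffP.
by have [] := is_derive1_powR a x0.
Qed.

Lemma gint_continuous x t : 0 < t -> {for t, continuous (gint x)}.
Proof.
move=> t0; apply: cvgM; first exact: powR_continuous.
apply: continuous_comp; first exact: opp_continuous.
exact: continuous_expR.
Qed.

Lemma Gitv_gt0 N t : Gitv N t -> 0 < t.
Proof. by rewrite /Gitv /= in_itv /= => /andP[h _]; apply: lt_le_trans h; rewrite invr_gt0. Qed.

Lemma Gitv_lt N : N.+2%:R^-1 < N.+2%:R :> R.
Proof. by apply: (@lt_trans _ _ 1); rewrite ?invf_lt1 // ltr1n. Qed.

Lemma bigcup_Gitv : \bigcup_N Gitv N = `]0, +oo[%classic.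
Proof.
apply/seteqP; split => [t [N _ /Gitv_gt0 t0]|t]; rewrite /= ?in_itv /= andbT //.
move=> t0; pose N := Num.Def.truncn (t + t^-1).
have hN : t + t^-1 < N.+2%:R.
  apply: (lt_trans (truncnS_gt _)).
  by rewrite ltr_nat.
have ti : 0 < t^-1 by rewrite invr_gt0.
exists N => //; rewrite /Gitv /= in_itv /=; apply/andP; split; last lra.
by rewrite invf_ple ?posrE //; lra.
Qed.

Lemma EGamma_lim x :
  (\int[mu]_(t in Gitv N) (gint x t)%:E)%E @[N --> \oo] --> EGamma x.
Proof.
rewrite /EGamma -bigcup_Gitv; apply: ge0_nondecreasing_set_cvg_integral.
- apply/nondecreasing_seqP => N; rewrite subsetEset => t; rewrite /Gitv /=.
  rewrite !in_itv /= => /andP[h1 h2]; apply/andP; split.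
    by apply: le_trans h1; rewrite lef_pV2 ?posrE // ler_nat.
  by apply: (le_trans h2); rewrite ler_nat.
- by move=> N; exact: measurable_itv.
- by move=> N; apply/measurable_EFinP; exact: measurable_gint.
- by move=> N t _; rewrite lee_fin gint_ge0.
Qed.

Lemma cvg_powR_expRN (x : R) : N.+2%:R `^ x * expR (- N.+2%:R) @[N --> \oo] --> (0 : R).
Proof.
pose m := (Num.Def.truncn x).+1.
have xm : x <= m%:R by apply/ltW/truncnS_gt.
apply: (@squeeze_cvgr _ _ _ _ (fun=> 0) (fun N => (m.+1)`!%:R * N.+2%:R^-1)).
- near=> N; rewrite mulr_ge0 ?powR_ge0 ?expR_ge0 //=.
  have N0 : (0 : R) <= N.+2%:R by [].
  apply: (@le_trans _ _ (N.+2%:R ^+ m * expR (- N.+2%:R))).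
    rewrite ler_wpM2r ?expR_ge0 // -powR_mulrn //.
    by apply: ler_powR => //; rewrite ler1n.
  have := @expR_ge1Dxn _ N.+2%:R m N0.
  rewrite expRN => he.
  have e0 : 0 < expR N.+2%:R :> R by exact: expR_gt0.
  rewrite ler_pdivrMr // mulrAC ler_pdivlMr //.
  apply: (@le_trans _ _ ((m.+1)`!%:R * (N.+2%:R ^+ m.+1 / (m.+1)`!%:R))).
    by rewrite mulrCA divff ?mulr1 ?exprSr // pnatr_eq0 -lt0n fact_gt0.
  by apply: ler_wpM2l => //; apply: le_trans he; rewrite lerDr.
- exact: cvg_cst.
- rewrite -[X in _ --> X](mulr0 ((m.+1)`!%:R)); apply: cvgMr.
  have := @cvg_harmonic R; rewrite -cvg_shiftS; apply: cvg_trans.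
  by apply: near_eq_cvg; near=> N.
Unshelve. all: by end_near. Qed.

Lemma cvg_invn2 : N.+2%:R^-1 @[N --> \oo] --> (0 : R).
Proof.
have := @cvg_harmonic R; rewrite -cvg_shiftS; apply: cvg_trans.
by apply: near_eq_cvg; near=> N.
Unshelve. all: by end_near. Qed.

Lemma cvg_powR_inv (x : R) : 0 < x -> N.+2%:R^-1 `^ x @[N --> \oo] --> (0 : R).
Proof.
move=> x0; have /cvg_at_rightP := powR_cvg0 x0; apply; split => [N|].
  by rewrite invr_gt0.
exact: cvg_invn2.
Qed.

Lemma cvg_expRN_inv : expR (- N.+2%:R^-1) @[N --> \oo] --> (1 : R).
Proof.
have h : - N.+2%:R^-1 @[N --> \oo] --> (0 : R).
  by rewrite -oppr0; apply: cvgN; exact: cvg_invn2.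
by have := cvg_comp _ _ h (@continuous_expR R 0); rewrite expR0.
Qed.

Lemma is_derive_expRN (t : R) : is_derive t 1 (fun t => - expR (- t)) (expR (- t)).
Proof.
have h : is_derive t 1 (fun t : R => expR (- t)) (- expR (- t)).
  apply: (is_derive_eq (is_derive1_comp (f := @expR R) (g := -%R) _ _)).
  by rewrite mulrN1.
by apply: (is_derive_eq (is_deriveN h)); rewrite opprK.
Qed.

(** Integration by parts on [Gitv N], whose boundary terms tend to 0. Monotone convergence gives the
    limit of both sides whether or not the integrals are finite. *)
Lemma EGamma_rec x : 0 < x -> EGamma (x + 1) = (x%:E * EGamma x)%E.
Proof.
move=> x0.
have parts N : (\int[mu]_(t in Gitv N) (gint (x + 1) t)%:E =
    (N.+2%:R^-1 `^ x * expR (- N.+2%:R^-1) - N.+2%:R `^ x * expR (- N.+2%:R))%:E +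
    x%:E * \int[mu]_(t in Gitv N) (gint x t)%:E)%E.
  have dF (t : R) : 0 < t -> is_derive t 1 (fun y : R => y `^ x) (x * t `^ (x - 1)) by exact: is_derive1_powR.
  have cG (t : R) : {for t, continuous (fun t : R => expR (- t))}.
    by apply: continuous_comp; [exact: opp_continuous|exact: continuous_expR].
  have := @integration_by_parts R (fun y : R => y `^ x) (fun t => - expR (- t))
    (fun t => x * t `^ (x - 1)) (fun t => expR (- t)) N.+2%:R^-1 N.+2%:R (Gitv_lt N).
  move=> ip; have {}ip := ip _ _ _ _ _ _.
  rewrite (_ : (\int[mu]_(t in Gitv N) (gint (x + 1) t)%:E)%E =
     (\int[mu]_(t in Gitv N) (t `^ x * expR (- t))%:E)%E); last first.
    by apply: eq_integral => t _; rewrite /gint addrK.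
  rewrite ip.
  - congr (_%:E + _)%E; first by ring.
    have iG : mu.-integrable (Gitv N) (EFin \o gint x).
      apply: continuous_compact_integrable; first exact: segment_compact.
      by apply: continuous_in_subspaceT => t; rewrite inE => /Gitv_gt0 t0; exact: gint_continuous.
    transitivity (- (\int[mu]_(t in Gitv N) ((- x)%:E * (EFin \o gint x) t)))%E.
      congr (- _)%E; apply: eq_integral => t _ /=; rewrite -EFinM; congr (_%:E).
      by rewrite /gint; ring.
    by rewrite integralZl // ?EFinN ?mulNe ?oppeK //; exact: measurable_itv.
  - apply: continuous_in_subspaceT => t; rewrite inE => /Gitv_gt0 t0.
    by apply: cvgM; [exact: cvg_cst|exact: powR_continuous].
  - split.
    + by move=> t ht; have [] := dF t; [apply: (@Gitv_gt0 N); apply: subset_itv_oo_cc|].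
    + by apply: cvg_at_right_filter; apply: powR_continuous; rewrite invr_gt0.
    + by apply: cvg_at_left_filter; apply: powR_continuous.
  - move=> t ht; have t0 : 0 < t by apply: (@Gitv_gt0 N); exact: subset_itv_oo_cc.
    by rewrite derive1E; have [_ ->] := dF t t0.
  - by apply: continuous_subspaceT => t; exact: cG.
  - split.
    + by move=> t _; have [] := is_derive_expRN t.
    + by apply: cvg_at_right_filter; apply: cvgN; exact: cG.
    + by apply: cvg_at_left_filter; apply: cvgN; exact: cG.
  - by move=> t _; rewrite derive1E; have [_ ->] := is_derive_expRN t.
have L := @EGamma_lim (x + 1).
have B : (N.+2%:R^-1 `^ x * expR (- N.+2%:R^-1) - N.+2%:R `^ x * expR (- N.+2%:R))%:E
     @[N --> \oo] --> (0 : R)%:E.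
  apply: cvg_EFin; first exact: nearW.
  rewrite -[X in _ --> X](subr0 0); apply: cvgB; last exact: cvg_powR_expRN.
  rewrite -[X in _ --> X](mul0r 1); apply: cvgM; [exact: cvg_powR_inv|exact: cvg_expRN_inv].
have Z : (x%:E * \int[mu]_(t in Gitv N) (gint x t)%:E)%E @[N --> \oo] --> (x%:E * EGamma x)%E.
  by apply: cvgeZl => //; exact: EGamma_lim.
have S := cvgeD (fin_num_adde_defr (x%:E * EGamma x)%E (erefl : (0 : R)%:E \is a fin_num)) B Z.
rewrite add0e in S.
apply: (cvg_unique (@ereal_hausdorff R) L).
by apply: cvg_trans (S _); apply: near_eq_cvg; near=> N; rewrite parts.
Unshelve. all: by end_near. Qed.

Lemma EGamma1 : EGamma 1 = 1%E.
Proof.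
have parts N : (\int[mu]_(t in Gitv N) (gint 1 t)%:E =
    (expR (- N.+2%:R^-1) - 1 * (N.+2%:R `^ 0 * expR (- N.+2%:R)))%:E)%E.
  have := @continuous_FTC2 R (fun t => expR (- t)) (fun t => - expR (- t)) _ _ (Gitv_lt N).
  move=> ip; have {}ip := ip _ _ _.
  have cG (t : R) : {for t, continuous (fun t : R => expR (- t))}.
    by apply: continuous_comp; [exact: opp_continuous|exact: continuous_expR].
  transitivity (\int[mu]_(t in Gitv N) (expR (- t))%:E)%E.
    by apply: eq_integral => t _; rewrite /gint subrr powRr0 mul1r.
  rewrite ip; first by rewrite -EFinB powRr0 mul1r; congr (_%:E); ring.
  - by apply: continuous_subspaceT => t; exact: cG.
  - split.
    + by move=> t _; have [] := is_derive_expRN t.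
    + by apply: cvg_at_right_filter; apply: cvgN; exact: cG.
    + by apply: cvg_at_left_filter; apply: cvgN; exact: cG.
  - by move=> t _; rewrite derive1E; have [_ ->] := is_derive_expRN t.
apply: (cvg_unique (@ereal_hausdorff R) (@EGamma_lim 1)).
have : (expR (- N.+2%:R^-1) - 1 * (N.+2%:R `^ 0 * expR (- N.+2%:R)))%:E @[N --> \oo] --> (1 - 1 * 0 : R)%:E.
  apply: cvg_EFin; first exact: nearW.
  apply: cvgB; first exact: cvg_expRN_inv.
  by apply: cvgM; [exact: cvg_cst|exact: cvg_powR_expRN].
rewrite mul1r subr0; apply: cvg_trans; apply: near_eq_cvg; near=> N.
by rewrite parts.
Unshelve. all: by end_near. Qed.

Lemma EGamma_nat m : EGamma m.+1%:R = (m`!%:R)%:E.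
Proof.
elim: m => [|m IH]; first exact: EGamma1.
by rewrite -natr1 EGamma_rec // IH -EFinM factS natrM.
Qed.

(** For [x >= 1] the power [t^(x - 1)] is at most [1 + t^m] with [m] an integer above [x], and the
    integer values are factorials. For smaller [x] the recursion pulls finiteness back from
    [x + 1]. *)
Lemma EGamma_fin x : 0 < x -> EGamma x \is a fin_num.
Proof.
have G0 y : (0 <= EGamma y)%E by apply: integral_ge0 => t _; rewrite lee_fin gint_ge0.
have ge1 y : 1 <= y -> EGamma y \is a fin_num.
  move=> y1; pose m := (Num.Def.truncn y).+1.
  have ym : y <= m.+1%:R.
    by apply: (le_trans (ltW (truncnS_gt y))); rewrite ler_nat.
  rewrite ge0_fin_numE //.
  apply: (@le_lt_trans _ _ (EGamma 1 + EGamma m.+1%:R)%E); last by rewrite EGamma1 EGamma_nat -EFinD ltry.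
  rewrite /EGamma -ge0_integralD //; last 4 first.
  - by move=> t _; rewrite lee_fin gint_ge0.
  - by apply/measurable_EFinP; exact: measurable_gint.
  - by move=> t _; rewrite lee_fin gint_ge0.
  - by apply/measurable_EFinP; exact: measurable_gint.
  apply: ge0_le_integral => //.
  - by move=> t _; rewrite lee_fin gint_ge0.
  - by apply/measurable_EFinP; exact: measurable_gint.
  - by apply: emeasurable_funD; apply/measurable_EFinP; exact: measurable_gint.
  move=> t /=; rewrite in_itv /= andbT => t0.
  rewrite -EFinD lee_fin /gint -mulrDl ler_wpM2r ?expR_ge0 // subrr powRr0.
  case: (leP t 1) => t1.
    apply: (@le_trans _ _ 1); last by rewrite lerDl powR_ge0.
    rewrite -[leRHS](powRr0 t); apply: ger_powR; [by rewrite t0|lra].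
  apply: (@le_trans _ _ (t `^ (m.+1%:R - 1))); last by rewrite lerDr.
  by apply: ler_powR; [exact: ltW|lra].
move=> x0; have /ge1 : 1 <= x + 1 by lra.
rewrite EGamma_rec // => h.
have := G0 x; rewrite ge0_fin_numE // => _; rewrite ltNge leye_eq; apply/negP => /eqP E.
by move: h; rewrite E gt0_muley.
Qed.

Lemma gint_integrable x : 0 < x -> mu.-integrable `]0, +oo[ (EFin \o gint x).
Proof.
move=> x0; apply/integrableP; split; first by apply/measurable_EFinP; exact: measurable_gint.
have := EGamma_fin x0; rewrite ge0_fin_numE; last by apply: integral_ge0 => t _; rewrite lee_fin gint_ge0.
by apply: le_lt_trans; rewrite le_eqVlt; apply/orP; left; apply/eqP; apply: eq_integral => t _;
  rewrite /= ger0_norm ?gint_ge0.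
Qed.

Lemma GammaE x : Gamma x = fine (EGamma x).
Proof. by []. Qed.

Lemma Gamma_rec (x : R) : 0 < x -> Gamma (x + 1) = x * Gamma x.
Proof. by move=> x0; rewrite !GammaE EGamma_rec // fineM // EGamma_fin. Qed.

Lemma Gamma_nat m : Gamma (m.+1%:R : R) = m`!%:R.
Proof. by rewrite GammaE EGamma_nat. Qed.

Lemma Gamma_ge0 (x : R) : 0 <= Gamma x.
Proof. by apply: Rintegral_ge0 => t _; exact: gint_ge0. Qed.

Lemma powR_le_chord (a x : R) : 0 < a -> 0 <= x <= 1 -> a `^ x <= 1 - x + x * a.
Proof.
move=> a0 /andP[x0 x1]; rewrite /powR gt_eqF //; set u := ln a.
have -> : a = expR u by rewrite lnK // posrE.
(* Two tangent-line bounds for the exponential; with weights [x] and [1 - x] their linear terms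
   cancel. *)
have h1 := expR_ge1Dx (u * (1 - x)); have h2 := expR_ge1Dx (- (x * u)).
have e0 := expR_gt0 (x * u).
have -> : expR u = expR (x * u) * expR (u * (1 - x)) by rewrite -expRD; congr expR; ring.
have e1 : expR (x * u) * expR (- (x * u)) = 1 by rewrite -expRD subrr expR0.
have k1 : x * (1 + u * (1 - x)) <= x * expR (u * (1 - x)) by rewrite ler_wpM2l.
have k2 : (1 - x) * (1 + - (x * u)) <= (1 - x) * expR (- (x * u)) by rewrite ler_wpM2l //; lra.
have k3 : 1 <= x * expR (u * (1 - x)) + (1 - x) * expR (- (x * u)).
  by apply: le_trans (lerD k1 k2); rewrite le_eqVlt; apply/orP; left; apply/eqP; ring.
have := ler_wpM2l (ltW e0) k3; rewrite mulr1 => /le_trans; apply.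
rewrite mulrDr mulrCA [X in _ + X]mulrCA e1; lra.
Qed.

(* Log-convexity of Gamma, from weighted AM-GM under the integral. *)
Lemma Gamma_le_powR (y x : R) : 0 < y -> 0 <= x <= 1 -> Gamma (y + x) <= y `^ x * Gamma y.
Proof.
move=> y0 /andP[x0 x1].
have iy := gint_integrable y0.
have iy1 : mu.-integrable `]0, +oo[ (EFin \o gint (y + 1)) by apply: gint_integrable; lra.
have iyx : mu.-integrable `]0, +oo[ (EFin \o gint (y + x)) by apply: gint_integrable; lra.
have Z c z : mu.-integrable `]0, +oo[ (EFin \o gint z) ->
    mu.-integrable `]0, +oo[ (EFin \o (fun t => c * gint z t)).
  move=> iz; rewrite (_ : EFin \o _ = (fun t => c%:E * (EFin \o gint z) t)%E).
    by apply: integrableZl => //; exact: measurable_itv.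
  by apply/funext => t /=; rewrite EFinM.
(* The chord inequality for [(t / y)^x], multiplied by [y^x]. Scaling by [y] makes the two integrals
   add up to exactly [y^x Gamma y], since [Gamma (y + 1) = y Gamma y]. *)
apply: (@le_trans _ _ (\int[mu]_(t in `]0, +oo[)
  (y `^ x * (1 - x) * gint y t + y `^ x * x / y * gint (y + 1) t))).
  apply: le_Rintegral => //.
    rewrite (_ : EFin \o _ = ((EFin \o (fun t => (y `^ x * (1 - x)) * gint y t)%R) \+
      (EFin \o (fun t => (y `^ x * x / y) * gint (y + 1) t)%R))%E) //.
    by apply: integrableD; [exact: measurable_itv|exact: Z|exact: Z].
  move=> t /=; rewrite in_itv /= andbT => t0.
  rewrite /gint !mulrA -mulrDl ler_wpM2r ?expR_ge0 //.
  have tn : t != 0 by rewrite gt_eqF.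
  have -> : t `^ (y + x - 1) = t `^ (y - 1) * t `^ x.
    by rewrite -powRD_gt0 //; congr powR; ring.
  have -> : t `^ (y + 1 - 1) = t `^ (y - 1) * t.
    by have := powRD_gt0 (y - 1) 1 t0; rewrite (powRr1 (ltW t0)) => <-; congr powR; ring.
  have -> : t `^ x = y `^ x * (t / y) `^ x.
    by rewrite -powRM ?ltW ?divr_gt0 // mulrCA divff ?mulr1 // gt_eqF.
  have := @powR_le_chord (t / y) x; rewrite divr_gt0 // x0 x1 => /(_ isT isT) hc.
  have P0 : 0 <= t `^ (y - 1) * y `^ x by rewrite mulr_ge0 ?powR_ge0.
  have := ler_wpM2l P0 hc; rewrite !mulrA => /le_trans; apply.
  rewrite le_eqVlt; apply/orP; left; apply/eqP; rewrite /=; field; by rewrite gt_eqF.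
rewrite RintegralD //; [|exact: Z|exact: Z].
rewrite !RintegralZl // -/(Gamma y) -/(Gamma (y + 1)) Gamma_rec //.
rewrite le_eqVlt; apply/orP; left; apply/eqP; rewrite /=; field; by rewrite gt_eqF.
Qed.

(** If [Gamma] vanished at [x], log-convexity would make it vanish at the next integer, where it is
    a factorial. *)
Lemma Gamma_gt0 (x : R) : 0 < x -> 0 < Gamma x.
Proof.
move=> x0; rewrite lt0r Gamma_ge0 andbT; apply/eqP => G0.
pose m := Num.Def.truncn x.
have /andP[h1 h2] := truncn_itv (ltW x0).
have := @Gamma_le_powR x (m.+1%:R - x) x0.
rewrite [x + (_ - x)]addrC subrK G0 mulr0 Gamma_nat => h.
have : m`!%:R <= 0 :> R by apply: h; rewrite -natr1 in h2 *; apply/andP; split; lra.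
by rewrite leNgt ltr0n fact_gt0.
Qed.

Local Opaque Gamma powR.

(** Log-convexity used twice: from [M] up to [M + y] for the upper bound, and from [M + y] up to
    [M + 1], where [Gamma] is [M Gamma M], for the lower one. *)
Lemma Gamma_ratio_bounds (y M : R) : 0 <= y <= 1 -> 0 < M ->
  (1 + y / M)^-1 <= Gamma (y + M) / (Gamma M * M `^ y) <= 1.
Proof.
move=> /andP[y0 y1] M0.
have My : 0 < M + y by lra.
have y1' : 0 <= 1 - y <= 1 by apply/andP; split; lra.
have Mw : M + y = M * ((M + y) / M) by rewrite mulrCA divff ?mulr1 // gt_eqF.
have w1 : 1 <= (M + y) / M by rewrite ler_pdivlMr // mul1r; lra.
have e1 : (M + y) `^ (1 - y) <= M `^ (1 - y) * ((M + y) / M).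
  rewrite {1}Mw powRM; [|exact: ltW|by apply: le_trans w1].
  by rewrite ler_wpM2l ?powR_ge0 //; apply: ler1_powR => //; lra.
have e2 : M `^ (1 - y) * M `^ y = M by rewrite -powRD_gt0 // subrK powRr1 // ltW.
have yM : 0 < 1 + y / M by rewrite ltr_wpDr // divr_ge0 // ltW.
have E1 : M + y + (1 - y) = M + 1 by ring.
have E2 : (M + y) / M = 1 + y / M by rewrite mulrDl divff ?gt_eqF.
have := Gamma_le_powR My y1'; rewrite E1 (Gamma_rec M0).
have := @Gamma_le_powR M y M0; rewrite y0 y1 => /(_ isT).
rewrite [y + M]addrC E2 in e1 *.
move: (Gamma_gt0 M0) (Gamma_gt0 My) (powR_gt0 y M0) e1 e2.
move: (Gamma M) (Gamma (M + y)) (M `^ y) (M `^ (1 - y)) ((M + y) `^ (1 - y)).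
move=> g gy p r rr g0 gy0 p0 e1 e2 h1 h2; apply/andP; split; last first.
  by rewrite ler_pdivrMr ?mulr_gt0 // mul1r mulrC.
rewrite ler_pdivlMr ?mulr_gt0 // ler_pdivrMl //.
have h3 : M * g <= r * (1 + y / M) * gy by apply: (le_trans h2); rewrite ler_wpM2r // ltW.
have := ler_wpM2r (ltW p0) h3.
have -> : M * g * p = M * (g * p) by ring.
have -> : r * (1 + y / M) * gy * p = (r * p) * ((1 + y / M) * gy) by ring.
rewrite e2.
by rewrite ler_pM2l.
Qed.

(** Wendel's limit: [Gamma (x + M)] grows like [Gamma M * M^x]. The bounds give it for [x] in
    [[0, 1]], and each unit shift multiplies the ratio by a factor tending to 1. *)
Lemma Gamma_ratio (x : R) : 0 <= x ->
  Gamma (x + m.+1%:R) / (Gamma (m.+1%:R : R) * m.+1%:R `^ x) @[m --> \oo] --> (1 : R).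
Proof.
have base y : 0 <= y <= 1 ->
    Gamma (y + m.+1%:R) / (Gamma (m.+1%:R : R) * m.+1%:R `^ y) @[m --> \oo] --> (1 : R).
  move=> /andP[y0 y1].
  apply: (@squeeze_cvgr _ _ _ _ (fun m => (1 + y * m.+1%:R^-1)^-1) (fun=> 1)).
  - by near=> m; apply: Gamma_ratio_bounds; rewrite ?y0.
  - rewrite -[X in _ --> X]invr1; apply: cvgV; first exact: oner_neq0.
    rewrite -[X in _ --> X]addr0; apply: cvgD; first exact: cvg_cst.
    rewrite -[X in _ --> X](mulr0 y); apply: cvgMr; exact: cvg_harmonic.
  - exact: cvg_cst.
move=> x0.
suff H k : forall y, 0 <= y <= 1 -> Gamma (y + k%:R + m.+1%:R) /
    (Gamma (m.+1%:R : R) * m.+1%:R `^ (y + k%:R)) @[m --> \oo] --> (1 : R).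
  pose k := Num.Def.truncn x.
  have /andP[h1 h2] := truncn_itv x0.
  have := H k (x - k%:R); rewrite subrK; apply.
  by rewrite -natr1 in h2; apply/andP; split; lra.
elim: k => [|k IH] y y01; first by rewrite addr0; exact: base.
have := IH y y01.
have c1 : (y + k%:R) * m.+1%:R^-1 + 1 @[m --> \oo] --> (1 : R).
  rewrite -[X in _ --> X]add0r; apply: cvgD; last exact: cvg_cst.
  rewrite -[X in _ --> X](mulr0 (y + k%:R)); apply: cvgMr; exact: cvg_harmonic.
move=> /cvgM /(_ c1); rewrite mul1r; apply: cvg_trans; apply: near_eq_cvg; near=> m; rewrite /=.
move: (m.+1%:R : R) (ltr0Sn R m) => M M0.
have GM : 0 < Gamma M by exact: Gamma_gt0.
have yk : 0 <= y + k%:R by case/andP: y01 => ? _; rewrite addr_ge0.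
rewrite (_ : y + k.+1%:R + M = (y + k%:R + M) + 1); last by rewrite -natr1; ring.
rewrite Gamma_rec; last by rewrite ltr_wpDl.
rewrite (_ : y + k.+1%:R = y + k%:R + 1); last by rewrite -natr1 addrA.
rewrite (powRD_gt0 (y + k%:R) 1 M0) (powRr1 (ltW M0)).
have pM : 0 < M `^ (y + k%:R) by rewrite powR_gt0.
by rewrite /=; field; rewrite !gt_eqF.
Unshelve. all: by end_near. Qed.

Lemma poch_Gamma (x : R) m : 0 < x -> poch x m = Gamma (x + m%:R) / Gamma x.
Proof.
move=> x0; have Gx : Gamma x != 0 by rewrite gt_eqF // Gamma_gt0.
elim: m => [|m IH]; first by rewrite /poch big_ord0 addr0 divff.
rewrite /poch big_ord_recr /= -/(poch x m) IH -natr1 addrA Gamma_rec; last by rewrite ltr_wpDr.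
by ring.
Qed.

(** Image of [Gitv N] under squaring, the substitution that turns the integrand of [Gamma (1/2)]
    into twice the Gaussian. *)
Definition Gsq (N : nat) : set R := `[(N.+2%:R^-1) ^+ 2, N.+2%:R ^+ 2]%classic.

Local Transparent Gamma powR.

Lemma EGamma_half : EGamma (2^-1) = (Num.sqrt pi)%:E.
Proof.
have sub N : (\int[mu]_(t in Gsq N) (gint 2^-1 t)%:E =
   \int[mu]_(t in Gitv N) (2 * gauss_fun t)%:E)%E.
  have D (t : R) : is_derive t 1 (fun t => t ^+ 2) (2 * t).
    apply: is_derive_eq => /=.
    by rewrite ?expr1 /GRing.scale /=; ring.
  have D1 : derive1 (fun t : R => t ^+ 2) = fun t => 2 * t.
    by apply/funext => t; rewrite derive1E; have [_ ->] := D t.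
  have c2 : continuous (fun t : R => 2 * t).
    by move=> t; apply: cvgMr; exact: cvg_id.
  have csq : continuous (fun t : R => t ^+ 2) by exact: exprn_continuous.
  rewrite (@integration_by_substitution_increasing R (fun t => t ^+ 2) (gint 2^-1)).
  - apply: eq_integral => t; rewrite inE => /Gitv_gt0 t0; congr (_%:E).
    transitivity (gint 2^-1 (t ^+ 2) * (2 * t)); first by rewrite D1.
    rewrite /gint /gauss_fun.
    have -> : (t ^+ 2) `^ (2^-1 - 1) = t^-1.
      rewrite -powR_mulrn ?ltW // -powRrM (_ : 2%:R * (2^-1 - 1) = -1); last by field.
      by rewrite powR_inv1 // ltW.
    by field; rewrite gt_eqF.
  - exact: ltW (Gitv_lt N).
  - move=> a b /Gitv_gt0 a0 /Gitv_gt0 b0 ab.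
    by rewrite ltr_pXn2r // nnegrE ltW.
  - by rewrite D1 => t _; exact: c2.
  - by rewrite D1; apply/cvg_ex; exists (2 * N.+2%:R^-1); apply: cvg_at_right_filter; exact: c2.
  - by rewrite D1; apply/cvg_ex; exists (2 * N.+2%:R); apply: cvg_at_left_filter; exact: c2.
  - split.
    + by move=> t _; have [] := D t.
    + by apply: cvg_at_right_filter; exact: csq.
    + by apply: cvg_at_left_filter; exact: csq.
  - apply: continuous_in_subspaceT => t; rewrite inE /Gsq /= in_itv /= => /andP[h _].
    by apply: gint_continuous; apply: lt_le_trans h; rewrite exprn_gt0 // invr_gt0.
have L1 : (\int[mu]_(t in Gsq N) (gint 2^-1 t)%:E)%E @[N --> \oo]
    --> EGamma 2^-1.
  have -> : EGamma 2^-1 = (\int[mu]_(t in \bigcup_N Gsq N) (gint 2^-1 t)%:E)%E.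
    rewrite /EGamma; congr (integral _ _ _); apply/seteqP; split => [t|t [N _]]; rewrite /Gsq /=; last first.
      rewrite !in_itv /= andbT => /andP[h _].
      by apply: lt_le_trans h; rewrite exprn_gt0 // invr_gt0.
    move=> t0; have : (\bigcup_N Gitv N) t by rewrite bigcup_Gitv.
    move=> [N _]; rewrite /Gitv /= in_itv /= => /andP[h1 h2]; exists N => //=; rewrite in_itv /=.
    apply/andP; split.
      apply: le_trans h1; rewrite expr2 ger_pMr ?invr_gt0 // invf_le1 // ler1n //.
    by apply: (le_trans h2); rewrite expr2 ler_pMr // ler1n.
  apply: ge0_nondecreasing_set_cvg_integral.
  - apply/nondecreasing_seqP => N; rewrite subsetEset => t; rewrite /Gsq /Gitv /=.
    rewrite !in_itv /= => /andP[h1 h2]; apply/andP; split.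
      by apply: le_trans h1; rewrite lerXn2r ?nnegrE ?invr_ge0 // lef_pV2 ?posrE // ler_nat.
    by apply: (le_trans h2); rewrite lerXn2r ?nnegrE // ler_nat.
  - by move=> N; exact: measurable_itv.
  - by move=> N; apply/measurable_EFinP; exact: measurable_gint.
  - by move=> N t _; rewrite lee_fin gint_ge0.
have mg D : measurable_fun D (fun t : R => (2 * gauss_fun t)%:E).
  apply: (measurable_funS (E := setT)) => //.
  by apply/measurable_EFinP; apply: measurable_funM => //; exact: measurable_gauss_fun.
have L2 : (\int[mu]_(t in Gitv N) (2 * gauss_fun t)%:E)%E @[N --> \oo]
    --> (\int[mu]_(t in `]0%R, +oo[) (2 * gauss_fun t)%:E)%E.
  rewrite -bigcup_Gitv; apply: ge0_nondecreasing_set_cvg_integral.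
  - apply/nondecreasing_seqP => N; rewrite subsetEset => t; rewrite /Gsq /Gitv /=.
    rewrite !in_itv /= => /andP[h1 h2]; apply/andP; split.
      by apply: le_trans h1; rewrite lef_pV2 ?posrE // ler_nat.
    by apply: (le_trans h2); rewrite ler_nat.
  - by move=> N; exact: measurable_itv.
  - by move=> N; exact: mg.
  - by move=> N t _; rewrite lee_fin mulr_ge0 // gauss_fun_ge0.
have -> : EGamma 2^-1 = (\int[mu]_(t in `]0%R, +oo[) (2 * gauss_fun t)%:E)%E.
  apply: (cvg_unique (@ereal_hausdorff R) L1); apply: cvg_trans L2; apply: near_eq_cvg; near=> N.
  by rewrite sub.
rewrite integral_itv_obnd_cbnd; last first.
  exact: mg.
under eq_integral do rewrite EFinM.
rewrite ge0_integralZl //; last 2 first.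
- by apply: (measurable_funS (E := setT)) => //; apply/measurable_EFinP; exact: measurable_gauss_fun.
- by move=> t _; rewrite lee_fin gauss_fun_ge0.
by rewrite integral0y_gauss -EFinM mulrC divfK.
Unshelve. all: by end_near. Qed.

Lemma Gamma_half : Gamma (2^-1 : R) = Num.sqrt pi.
Proof. by rewrite GammaE EGamma_half. Qed.

End GammaFunction.

Section GammaDuplication.
Variable R : realType.

Local Opaque Gamma powR.

(* [Gamma x Gamma (x + 1/2) 4^x / Gamma (2 x)] is 1-periodic, and its ratio at two points
   tends to 1 at infinity. *)
Lemma Gamma_duplication (x : R) : 0 < x ->
  Gamma x * Gamma (x + 2^-1) * 4 `^ x = 2 * Num.sqrt pi * Gamma (2 * x).
Proof.
pose q (y : R) := Gamma y * Gamma (y + 2^-1) * 4 `^ y / Gamma (2 * y).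
have p4 (y : R) : 0 < 4 `^ y :> R by exact: powR_gt0.
have q1 y : 0 < y -> q (y + 1) = q y.
  move=> y0; rewrite /q (Gamma_rec y0).
  have y1 : 0 < y + 2^-1 by lra.
  have y2 : 0 < 2 * y by lra.
  have y3 : 0 < 2 * y + 1 by lra.
  have -> : y + 1 + 2^-1 = (y + 2^-1) + 1 by ring.
  have -> : 2 * (y + 1) = (2 * y + 1) + 1 by ring.
  rewrite (Gamma_rec y1) (Gamma_rec y3) (Gamma_rec y2).
  rewrite (powRD_gt0 y 1 (ltr0n R 4)) (powRr1 (ler0n R 4)).
  move: (Gamma y) (Gamma (y + 2^-1)) (4 `^ y) (Gamma (2 * y)) (Gamma_gt0 y2) => A B C D D0.
  by field; rewrite !gt_eqF.
have qm m y : 0 < y -> q (y + m%:R) = q y.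
  move=> y0; elim: m => [|m IH]; first by rewrite addr0.
  have ym : 0 < y + m%:R by rewrite ltr_wpDr.
  by rewrite -natr1 addrA (q1 _ ym).
pose r (y : R) (m : nat) := Gamma (y + m.+1%:R) / (Gamma (m.+1%:R : R) * m.+1%:R `^ y).
have rc (y : R) : 0 <= y -> r y @ \oo --> (1 : R) by exact: Gamma_ratio.
(* Index [m] of [r] stands for the point [m + 1], so [m.*2.+1] stands for [2 (m + 1)], the shift
   that [2 y] undergoes. *)
pose a y m := r y m * r (y + 2^-1) m / r (2 * y) (m.*2.+1).
have ac y : 0 < y -> a y @ \oo --> (1 : R).
  move=> y0; rewrite -[X in _ --> X](_ : 1 * 1 / 1 = 1 :> R); last by rewrite !mul1r invr1.
  apply: cvgM; first by apply: cvgM; apply: rc; lra.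
  apply: cvgV; first exact: oner_neq0.
  apply: (cvg_comp (fun m : nat => m.*2.+1) (r (2 * y)) (G := \oo)); last by apply: rc; lra.
  apply/cvgnyPge => M; near=> m.
  have : (M <= m)%N by near: m; exact: nbhs_infty_ge.
  by move=> h; apply: (leq_trans h); rewrite -addnn leqW // leq_addr.
(* The factor multiplying [a y m] does not depend on [y], hence cancels in the quotient of two
   values of [q]. *)
have aq y m : 0 < y -> a y m * (Gamma (m.+1%:R : R) ^+ 2 * m.+1%:R `^ 2^-1 * 4 `^ m.+1%:R
     / Gamma (2 * m.+1%:R : R)) = q y.
  move=> y0; rewrite -(qm m.+1 y y0) /a /r /q.
  have -> : (m.*2.+2)%:R = 2 * m.+1%:R :> R by rewrite -natrM mul2n doubleS.
  move: (m.+1%:R : R) (ltr0Sn R m) => M M0.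
  rewrite (_ : 2 * (y + M) = 2 * y + 2 * M); last by ring.
  rewrite (_ : y + M + 2^-1 = y + 2^-1 + M); last by ring.
  have -> : 4 `^ (y + M) = 4 `^ y * 4 `^ M by rewrite powRD_gt0.
  have -> : M `^ (y + 2^-1) = M `^ y * M `^ 2^-1 by rewrite powRD_gt0.
  have -> : (2 * M) `^ (2 * y) = 4 `^ y * (M `^ y * M `^ y).
    rewrite powRM ?ltW // -powRD_gt0 //.
    congr (_ * _); last by congr powR; ring.
    by rewrite powRrM (powR_mulrn 2 (ler0n R 2)) -natrX.
  have M2 : 0 < 2 * M by lra.
  have M3 : 0 < 2 * y + 2 * M by lra.
  move: (Gamma (y + M)) (Gamma (y + 2^-1 + M)) (Gamma (2 * y + 2 * M)) (Gamma_gt0 M3)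
    (Gamma M) (Gamma_gt0 M0) (Gamma (2 * M)) (Gamma_gt0 M2)
    (M `^ y) (powR_gt0 y M0) (M `^ 2^-1) (powR_gt0 2^-1 M0) (4 `^ y) (p4 y) (4 `^ M) (p4 M).
  move=> A B C C0 D D0 E E0 F F0 G G0 H H0 I I0.
  by field; rewrite !gt_eqF.
have qq y : 0 < y -> q y = q (2^-1).
  move=> y0; have h0 : 0 < 2^-1 :> R by rewrite invr_gt0.
  have q0 : 0 < q 2^-1.
    by rewrite /q divr_gt0 ?mulr_gt0 ?Gamma_gt0 ?mulr_gt0 // addr_gt0.
  have c1 : a y m / a 2^-1 m @[m --> \oo] --> (1 : R).
    rewrite -[X in _ --> X](_ : 1 / 1 = 1 :> R); last by rewrite mul1r invr1.
    by apply: cvgM; [exact: ac|apply: cvgV; [exact: oner_neq0|exact: ac]].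
  have c2 : a y m / a 2^-1 m @[m --> \oo] --> q y / q 2^-1.
    apply: (@cvg_trans _ ((fun=> q y / q 2^-1) @ \oo)); last exact: cvg_cst.
    apply: near_eq_cvg; near=> m; rewrite /= -(aq y m y0) -(aq 2^-1 m h0).
    rewrite -mulf_div divff ?mulr1 //.
    have : a 2^-1 m * (Gamma (m.+1%:R : R) ^+ 2 * m.+1%:R `^ 2^-1 * 4 `^ m.+1%:R / Gamma (2 * m.+1%:R : R)) != 0 by rewrite aq // gt_eqF.
    by rewrite mulf_eq0 negb_or => /andP[].
  have := cvg_unique _ c1 c2 => /(_ _) h.
  have E : 1 = q y / q 2^-1 by apply: h.
  by rewrite -[LHS](divfK (lt0r_neq0 q0)) -E mul1r.
move=> x0; have := qq x x0.
have -> : q 2^-1 = 2 * Num.sqrt pi.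
  rewrite /q Gamma_half divff // (_ : 2^-1 + 2^-1 = 1 :> R); last by field.
  rewrite (Gamma_nat R 0) divr1 mulr1 powR12_sqrt // (_ : 4 = 2 ^+ 2 :> R); last by rewrite -natrX.
  by rewrite sqrtr_sqr ger0_norm // mulrC.
have G0 : 0 < Gamma (2 * x) by apply: Gamma_gt0; lra.
by rewrite /q => /(congr1 (fun z => z * Gamma (2 * x))); rewrite divfK // gt_eqF.
Unshelve. all: by end_near. Qed.

End GammaDuplication.

(** * The hypergeometric function *)

Section Hypergeometric.
Variable R : realType.
Implicit Types a b c t : R.

Definition hcoef a b c k : R := poch a k * poch b k / poch c k / (k`!)%:R.

Lemma pochS a k : poch a k.+1 = poch a k * (a + k%:R).
Proof. by rewrite /poch big_ord_recr. Qed.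

Lemma poch_gt0 c k : 0 < c -> 0 < poch c k.
Proof. by move=> c0; apply: prodr_gt0 => i _; rewrite ltr_wpDr. Qed.

Lemma hcoef0 a b c : hcoef a b c 0 = 1.
Proof. by rewrite /hcoef /poch !big_ord0 fact0; field. Qed.

Lemma hcoefS a b c k : 0 < c ->
  hcoef a b c k.+1 * ((c + k%:R) * (k%:R + 1)) = hcoef a b c k * ((a + k%:R) * (b + k%:R)).
Proof.
move=> c0; rewrite /hcoef !pochS factS natrM -natr1.
have p0 : poch c k != 0 by rewrite gt_eqF // poch_gt0.
have ck : c + k%:R != 0 by rewrite gt_eqF // ltr_wpDr.
have k1 : (k%:R + 1 : R) != 0 by rewrite natr1 pnatr_eq0.
have f0 : ((k`!)%:R : R) != 0 by rewrite pnatr_eq0 -lt0n fact_gt0.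
by field; rewrite k1 f0 ck p0.
Qed.

Lemma hyp2F1E a b c t : hyp2F1 a b c t = limn (pseries (hcoef a b c) t).
Proof.
rewrite /hyp2F1 /pseries; congr (limn (series _)); apply/funext => k.
by rewrite /= /hcoef; ring.
Qed.

Section Summable.
Variables a b c : R.
Hypothesis c0 : 0 < c.
Hypothesis d0 : 0 < c - a - b.
Local Notation h := (hcoef a b c).
Local Notation d := (c - a - b).

(** Raabe's test. With [d = c - a - b] the right side equals [|h k| (k d - a b) / (c + k)]; [K] is
    chosen so that [a + k] and [b + k] are positive and [k d >= 2 |a b| + c d]. *)
Lemma hcoef_telescope : exists K, forall k, (K <= k)%N ->
  d / 2 * `|h k| <= k%:R * `|h k| - k.+1%:R * `|h k.+1|.
Proof.
have [q q0 qd] : exists2 q : R, 0 <= q & q * d = 2 * `|a * b|.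
  exists (2 * `|a * b| / d); first by rewrite divr_ge0 ?mulr_ge0 // ltW.
  by rewrite divfK // gt_eqF.
exists (Num.Def.truncn (`|a| + `|b| + c + q)).+1 => k Kk.
have Xk : `|a| + `|b| + c + q < k%:R :> R.
  by apply: (lt_le_trans (truncnS_gt _)); rewrite ler_nat.
have nb := normr_ge0 b; have na := normr_ge0 a.
have ka : 0 < a + k%:R.
  by have := ler_norm (- a); rewrite normrN => h1; move: Xk c0 q0 nb h1; clear; lra.
have kb : 0 < b + k%:R.
  by have := ler_norm (- b); rewrite normrN => h1; move: Xk c0 q0 na h1; clear; lra.
have kd : 2 * `|a * b| + c * d <= k%:R * d.
  have h1 : q + c <= k%:R by lra.
  by have := ler_wpM2r (ltW d0) h1; rewrite mulrDl qd.
have ck : 0 < c + k%:R by rewrite ltr_wpDr.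
move: (h k.+1) (h k) (hcoefS a b k c0) => x y /(congr1 Num.norm); rewrite !normrM.
rewrite (gtr0_norm ck) (gtr0_norm ka) (gtr0_norm kb) natr1 (ger0_norm (ler0n R k.+1)) => hS.
have -> : k.+1%:R * `|x| = `|y| * ((a + k%:R) * (b + k%:R) / (c + k%:R)).
  by rewrite mulrA -hS; field; rewrite gt_eqF.
have -> : k%:R * `|y| - `|y| * ((a + k%:R) * (b + k%:R) / (c + k%:R)) =
   `|y| * ((k%:R * d - a * b) / (c + k%:R)) by field; rewrite gt_eqF.
rewrite mulrC ler_wpM2l //.
rewrite ler_pdivlMr //.
have := ler_norm (a * b); lra.
Qed.

Lemma hcoef_abs_cvg : cvgn (series (fun k => `|h k|)).
Proof.
have [K HK] := hcoef_telescope.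
have sS N : series (fun k => `|h k|) N.+1 = series (fun k => `|h k|) N + `|h N| by rewrite seriesSr.
(* By the telescoping bound this corrected partial sum is nonincreasing from [K] on, hence bounds
   all partial sums. *)
pose T N := series (fun k => `|h k|) N + 2 / d * (N%:R * `|h N|).
have TN N : T (K + N)%N <= T K.
  elim: N => [|N IH]; first by rewrite addn0.
  apply: le_trans IH; rewrite addnS /T sS.
  have := HK (K + N)%N (leq_addr _ _); rewrite -subr_ge0 => hk.
  have d2 : 0 <= 2 / d by rewrite divr_ge0 // ltW.
  have := mulr_ge0 d2 hk; rewrite -subr_ge0.
  have -> : 2 / d * ((K + N)%:R * `|h (K + N)%N| - (K + N).+1%:R * `|h (K + N).+1| - d / 2 * `|h (K + N)%N|) =
    2 / d * ((K + N)%:R * `|h (K + N)%N|) - 2 / d * ((K + N).+1%:R * `|h (K + N).+1|) - `|h (K + N)%N|.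
    by field; rewrite gt_eqF.
  by lra.
have nd : nondecreasing_seq (series (fun k => `|h k|)).
  by apply/nondecreasing_seqP => N; rewrite sS lerDl.
apply: nondecreasing_is_cvgn => //.
exists (T K) => _ [N _ <-].
apply: (@le_trans _ _ (series (fun k => `|h k|) (K + N)%N)); first by apply: nd; exact: leq_addl.
apply: le_trans (TN N); rewrite lerDl mulr_ge0 ?divr_ge0 ?mulr_ge0 // ltW //.
Qed.

(** The sequence [k |h k|] is eventually nonincreasing. Were it to stay above some [e > 0], the
    summable [|h k|] would dominate [e / k], against the divergence of the harmonic series. *)
Lemma nat_mul_hcoef_cvg0 : (fun k => k%:R * h k) @ \oo --> (0 : R).
Proof.
have [K HK] := hcoef_telescope.
have habs := hcoef_abs_cvg.
pose D k := k%:R * `|h k|.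
have D0 k : 0 <= D k by rewrite mulr_ge0.
have Ddec k l : (K <= k)%N -> D (k + l)%N <= D k.
  move=> Kk; elim: l => [|l IH]; first by rewrite addn0.
  apply: le_trans IH; rewrite addnS -subr_ge0; apply: le_trans (HK (k + l)%N _).
    by rewrite mulr_ge0 ?divr_ge0 // ltW.
  by rewrite (leq_trans Kk) // leq_addr.
suff Dlim e : 0 < e -> exists2 N, (K <= N)%N & D N <= e.
  apply/cvgrPdist_le => e e0; have [N KN DN] := Dlim e e0.
  near=> k; rewrite sub0r normrN normrM ger0_norm //.
  have Nk : (N <= k)%N by near: k; exact: nbhs_infty_ge.
  by rewrite -(subnKC Nk); apply: le_trans DN; exact: Ddec.
move=> e0; apply: contrapT => H.
have De k : (K <= k)%N -> e < D k.
  by move=> Kk; rewrite ltNge; apply/negP => h1; apply: H; exists k.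
apply: (@dvg_harmonic R); rewrite -(is_cvg_series_restrict K).
(* The shift by one is that of [harmonic k], which is [1 / (k + 1)]. *)
have sR : cvgn (series (fun k => e^-1 * `|h k.+1|)).
  have : cvgn (series (fun k => `|h k.+1|)).
    move: habs; rewrite -(is_cvg_series_restrict 1).
    move/cvg_ex => [L HL]; apply/cvg_ex; exists L.
    move: HL; rewrite -cvg_shiftS; apply: cvg_trans; apply: near_eq_cvg; near=> N.
    by rewrite /series /= big_add1.
  by move=> h1; exact: (is_cvg_seriesZ (k := e^-1) h1).
move: sR; rewrite -(is_cvg_series_restrict K) => sR.
apply: nondecreasing_is_cvgn.
  apply/nondecreasing_seqP => N; case: (leqP K N) => KN.
    by rewrite /= big_nat_recr //= lerDl invr_ge0.
  by rewrite /= !big_geq // ltnW.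
have [B HB] := cvg_has_ub (cvgP _ sR).
exists B => _ [N _ <-]; apply: le_trans (HB _ (imageT _ N)).
apply: le_trans (ler_norm _); rewrite /=.
apply: ler_sum_nat => k /andP[Kk _].
rewrite /harmonic /= mulrC ler_pdivlMr // mulrC ler_pdivrMr //.
rewrite mulrC; apply: ltW; apply: De; exact: leqW.
Unshelve. all: by end_near. Qed.

Lemma hyp_cvg t : `|t| <= 1 -> cvgn (pseries h t).
Proof.
move=> t1; apply: normed_cvg.
apply: (series_le_cvg _ _ _ hcoef_abs_cvg) => k //=.
by rewrite normrM ler_piMr // normrX exprn_ile1.
Qed.

Lemma hcoef_le_sum k : `|h k| <= limn (series (fun k => `|h k|)).
Proof.
have nd : nondecreasing_seq (series (fun k => `|h k|)).
  by apply/nondecreasing_seqP => N; rewrite seriesSr lerDl.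
apply: le_trans (nondecreasing_cvgn_le nd hcoef_abs_cvg k.+1).
by rewrite seriesSr lerDr /series; apply: sumr_ge0.
Qed.

(** The coefficients are absolutely summable, so the tail past [N] is small uniformly in [t]; the
    head is controlled by [1 - t^k <= N (1 - t)] for [k <= N]. *)
Lemma hyp_cont1 e : 0 < e -> exists2 del, 0 < del & forall t, 1 - del <= t <= 1 -> 0 <= t ->
  `|hyp2F1 a b c t - hyp2F1 a b c 1| <= e.
Proof.
move=> e0; pose s N := series (fun k => `|h k|) N; pose A := limn s.
have cA : s @ \oo --> A := hcoef_abs_cvg.
have nd : nondecreasing_seq s.
  by apply/nondecreasing_seqP => N; rewrite /s seriesSr lerDl.
have sA N : s N <= A by exact: nondecreasing_cvgn_le nd hcoef_abs_cvg N.
have A0 : 0 <= A by apply: le_trans (sA 0%N); rewrite /s /series /= big_geq.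
have /cvgrPdist_le /(_ (e / 2)) := cA; rewrite divr_gt0 // => /(_ isT)[N _ HN].
have {}HN : A - s N <= e / 2 by have := HN N (leqnn N); rewrite ger0_norm // subr_ge0.
pose P := A * N%:R + 1.
have P0 : 0 < P by rewrite ltr_wpDl // mulr_ge0.
exists (e / 2 / P); first by rewrite !divr_gt0.
move=> t /andP[t1 t2] t0.
have key M : `|pseries h t (N + M)%N - pseries h 1 (N + M)%N| <= e.
  have tk k : 0 <= 1 - t ^+ k <= 1.
    by rewrite subr_ge0 exprn_ile1 // lerBlDr lerDl exprn_ge0.
  have tkN k : (k <= N)%N -> 1 - t ^+ k <= N%:R * (1 - t).
    move=> kN; apply: (@le_trans _ _ (k%:R * (1 - t))); last by rewrite ler_wpM2r ?ler_nat // subr_ge0.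
    elim: k {kN} => [|k IH]; first by rewrite expr0 subrr mul0r.
    rewrite exprS -natr1 mulrDl mul1r.
    have h1 : 1 - t * t ^+ k = (1 - t ^+ k) + (1 - t) * t ^+ k by ring.
    rewrite h1 lerD // -[leRHS]mulr1 ler_wpM2l ?subr_ge0 // exprn_ile1 //.
  have -> : pseries h t (N + M)%N - pseries h 1 (N + M)%N = \sum_(0 <= k < N + M) h k * (t ^+ k - 1).
    by rewrite /pseries /series /= -sumrB; apply: eq_bigr => k _; rewrite expr1n mulr1 mulrBr mulr1.
  apply: (le_trans (ler_norm_sum _ _ _)).
  rewrite (big_cat_nat (n := N)) ?leq_addr //=.
  have -> : e = e / 2 + e / 2 by field.
  apply: lerD.
    apply: (@le_trans _ _ (\sum_(0 <= k < N) `|h k| * (N%:R * (1 - t)))).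
      apply: ler_sum_nat => k /andP[_ kN]; rewrite normrM ler_wpM2l //.
      by rewrite -normrN opprB ger0_norm ?(andP (tk k)).1 //; apply: tkN; exact: ltnW.
    rewrite -mulr_suml -/(s N).
    apply: (@le_trans _ _ (A * N%:R * (1 - t))).
      by rewrite mulrA ler_wpM2r ?subr_ge0 // ler_wpM2r //; exact: (sA N).
    apply: (@le_trans _ _ (P * (1 - t))); first by rewrite ler_wpM2r ?subr_ge0 // lerDl.
    by rewrite mulrC -ler_pdivlMr //; lra.
  apply: (@le_trans _ _ (s (N + M)%N - s N)).
    have -> : s (N + M)%N - s N = \sum_(N <= k < N + M) `|h k|.
      by rewrite /s /series /= (big_cat_nat (n := N)) ?leq_addr //= addrAC subrr add0r.
    apply: ler_sum_nat => k _; rewrite normrM -[leRHS]mulr1 ler_wpM2l //.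
    by have /andP[u1 u2] := tk k; rewrite -normrN opprB ger0_norm.
  by have := sA (N + M)%N; lra.
have c1 : pseries h t @ \oo --> hyp2F1 a b c t.
  by rewrite hyp2F1E; apply: hyp_cvg; rewrite ger0_norm.
have c2 : pseries h 1 @ \oo --> hyp2F1 a b c 1.
  by rewrite hyp2F1E; apply: hyp_cvg; rewrite normr1.
have c3 : `|pseries h t n - pseries h 1 n| @[n --> \oo] --> `|hyp2F1 a b c t - hyp2F1 a b c 1|.
  by apply: cvg_norm; exact: cvgB.
rewrite -(cvg_lim _ c3) //; apply: limr_le; first by apply/cvg_ex; eexists; exact: c3.
near=> n; have Nn : (N <= n)%N by near: n; exact: nbhs_infty_ge.
by rewrite -(subnKC Nn); exact: key.
Unshelve. all: by end_near. Qed.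

End Summable.

Lemma pseriesS (f : nat -> R) t N : pseries f t N.+1 = pseries f t N + f N * t ^+ N.
Proof. by rewrite /pseries seriesSr. Qed.

(** The identity holds coefficient by coefficient up to the telescoping term
    [c (k h_k - (k + 1) h_(k + 1))], whose boundary value [c N h_N] tends to 0. *)
Lemma hyp_contiguous a b c : 0 < c -> 0 < c - a - b ->
  c * (c - a - b) * hyp2F1 a b c 1 = (c - a) * (c - b) * hyp2F1 a b (c + 1) 1.
Proof.
move=> c0 d0; pose h := hcoef a b c; pose d := c - a - b; pose h1 := hcoef a b (c + 1).
have pc k : poch (c + 1) k * c = poch c k * (c + k%:R).
  elim: k => [|k IH]; first by rewrite /poch !big_ord0 addr0.
  by rewrite !pochS mulrAC IH -natr1; ring.
have h1E k : h1 k * (c + k%:R) = h k * c.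
  rewrite /h1 /h /hcoef.
  have p0 : poch c k != 0 by rewrite gt_eqF // poch_gt0.
  have p1 : poch (c + 1) k != 0 by rewrite gt_eqF // poch_gt0 // addr_gt0.
  have f0 : ((k`!)%:R : R) != 0 by rewrite pnatr_eq0 -lt0n fact_gt0.
  have ck : c + k%:R != 0 by rewrite gt_eqF // ltr_wpDr.
  have -> : poch (c + 1) k = poch c k * (c + k%:R) / c by rewrite -pc mulfK // gt_eqF.
  by field; rewrite f0 p0 ck gt_eqF.
have tel k : c * d * h k = (c - a) * (c - b) * h1 k + c * (k%:R * h k) - c * (k.+1%:R * h k.+1).
  have ck : c + k%:R != 0 by rewrite gt_eqF // ltr_wpDr.
  have hk := h1E k; have hs := hcoefS a b k c0.
  have -> : h1 k = h k * c / (c + k%:R) by rewrite -hk mulfK.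
  have -> : k.+1%:R * h k.+1 = h k * ((a + k%:R) * (b + k%:R)) / (c + k%:R).
    by rewrite /h -hs -natr1; field.
  by rewrite /d; field.
have sums N : c * d * pseries h 1 N = (c - a) * (c - b) * pseries h1 1 N - c * (N%:R * h N).
  elim: N => [|N IH]; first by rewrite /pseries /series /= !big_geq // mul0r !mulr0 subr0.
  rewrite !pseriesS !expr1n !mulr1 [LHS]mulrDr IH tel; ring.
have c1 : pseries h 1 @ \oo --> hyp2F1 a b c 1.
  by rewrite hyp2F1E; apply: (hyp_cvg c0 d0); rewrite normr1.
have c1' : pseries h1 1 @ \oo --> hyp2F1 a b (c + 1) 1.
  have c10 : 0 < c + 1 by lra.
  have d10 : 0 < c + 1 - a - b by lra.
  by rewrite hyp2F1E; apply: (hyp_cvg c10 d10); rewrite normr1.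
have c2 : c * d * pseries h 1 N + c * (N%:R * h N) @[N --> \oo] --> c * d * hyp2F1 a b c 1 + c * 0.
  apply: cvgD; first exact: cvgMr.
  by apply: cvgMr; exact: nat_mul_hcoef_cvg0.
rewrite mulr0 addr0 in c2.
have c3 : (c - a) * (c - b) * pseries h1 1 N @[N --> \oo] --> (c - a) * (c - b) * hyp2F1 a b (c + 1) 1.
  exact: cvgMr.
apply: (cvg_unique (@Rhausdorff R) c2); apply: cvg_trans c3; apply: near_eq_cvg; near=> N.
by rewrite sums; ring.
Unshelve. all: by end_near. Qed.

(** The constant term is 1, and raising [c] to [c + m] multiplies the absolute value of every later
    coefficient by at most [c / (c + m)]. *)
Lemma hyp_shift_cvg a b c : 0 < c -> 0 < c - a - b ->
  hyp2F1 a b (c + m%:R) 1 @[m --> \oo] --> (1 : R).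
Proof.
move=> c0 d0; pose A := limn (series (fun k => `|hcoef a b c k|)).
have cA : series (fun k => `|hcoef a b c k|) @ \oo --> A := hcoef_abs_cvg c0 d0.
have A0 : 0 <= A by apply: le_trans (hcoef_le_sum c0 d0 0); exact: normr_ge0.
have pm m k : poch c k.+1 * (c + m%:R) <= poch (c + m%:R) k.+1 * c.
  elim: k => [|k IH].
    by rewrite !pochS /poch !big_ord0 !mul1r !addr0 mulrC.
  rewrite pochS [poch (_ + _) k.+2]pochS -mulrA [X in _ * X]mulrC mulrA.
  rewrite -[leRHS]mulrA [X in _ <= _ * X]mulrC mulrA.
  have p0 := poch_gt0 k.+1 c0.
  apply: ler_pM => //.
  - by rewrite mulr_ge0 ?addr_ge0 // ltW.
  - by rewrite addr_ge0 // ltW.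
  - by rewrite lerD2r lerDl.
have hm m k : `|hcoef a b (c + m%:R) k.+1| <= c / (c + m%:R) * `|hcoef a b c k.+1|.
  have cm : 0 < c + m%:R by rewrite ltr_wpDr.
  have p0 := poch_gt0 k.+1 c0; have p1 := poch_gt0 k.+1 cm.
  have f0 : (0 : R) < (k.+1`!)%:R by rewrite ltr0n fact_gt0.
  rewrite /hcoef !normrM !normfV (gtr0_norm p0) (gtr0_norm p1).
  rewrite mulrA ler_wpM2r ?invr_ge0 // mulrCA ler_wpM2l ?mulr_ge0 //.
  rewrite -(ler_pM2r p1) mulVf ?gt_eqF // -(ler_pM2r (mulr_gt0 p0 cm)) mul1r.
  have -> : c / (c + m%:R) / poch c k.+1 * poch (c + m%:R) k.+1 * (poch c k.+1 * (c + m%:R)) =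
    poch (c + m%:R) k.+1 * c by field; rewrite !gt_eqF.
  exact: pm.
have bd m : `|hyp2F1 a b (c + m%:R) 1 - 1| <= c / (c + m%:R) * A.
  have cm : 0 < c + m%:R by rewrite ltr_wpDr.
  have dm : 0 < c + m%:R - a - b by have := ler0n R m; lra.
  have c1 : pseries (hcoef a b (c + m%:R)) 1 @ \oo --> hyp2F1 a b (c + m%:R) 1.
    by rewrite hyp2F1E; apply: (hyp_cvg cm dm); rewrite normr1.
  have c2 : `|pseries (hcoef a b (c + m%:R)) 1 N.+1 - 1| @[N --> \oo] --> `|hyp2F1 a b (c + m%:R) 1 - 1|.
    by apply: cvg_norm; apply: cvgB; [rewrite cvg_shiftS|exact: cvg_cst].
  rewrite -(cvg_lim _ c2) //; apply: limr_le; first by apply/cvg_ex; eexists; exact: c2.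
  near=> N.
  have -> : pseries (hcoef a b (c + m%:R)) 1 N.+1 - 1 = \sum_(0 <= k < N) hcoef a b (c + m%:R) k.+1.
    rewrite /pseries /series /= big_nat_recl //= hcoef0 expr0 mulr1 addrAC subrr add0r.
    by apply: eq_bigr => k _; rewrite expr1n mulr1.
  apply: (le_trans (ler_norm_sum _ _ _)).
  apply: (@le_trans _ _ (\sum_(0 <= k < N) c / (c + m%:R) * `|hcoef a b c k.+1|)).
    by apply: ler_sum => k _.
  rewrite -mulr_sumr; apply: ler_wpM2l; first by rewrite divr_ge0 // ltW.
  have nd : nondecreasing_seq (series (fun k => `|hcoef a b c k|)).
    by apply/nondecreasing_seqP => M; rewrite seriesSr lerDl.
  apply: le_trans (nondecreasing_cvgn_le nd (hcoef_abs_cvg c0 d0) N.+1).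
  by rewrite /series /= big_nat_recl //= lerDr.
apply/cvgrPdist_le => e e0.
have c3 : c / (c + m%:R) * A @[m --> \oo] --> (0 : R).
  have AC : 0 <= c * A by rewrite mulr_ge0 // ltW.
  apply/cvgrPdist_le => e' e'0; near=> m.
  have cm : 0 < c + m%:R by rewrite ltr_wpDr.
  rewrite sub0r normrN ger0_norm; last by rewrite mulr_ge0 // divr_ge0 // ltW.
  rewrite mulrAC ler_pdivrMr //.
  have : c * A / e' <= m%:R by near: m; exact: nbhs_infty_ger.
  rewrite ler_pdivrMr // => /le_trans; apply.
  by rewrite [e' * _]mulrC ler_wpM2r ?(ltW e'0) // lerDr ltW.
have /cvgrPdist_le /(_ e e0) := c3; apply: filterS => m /=.
rewrite sub0r normrN => h; rewrite distrC; apply: (le_trans (bd m)).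
by apply: le_trans h; exact: ler_norm.
Unshelve. all: by end_near. Qed.

Local Opaque Gamma powR.

(** The contiguous relation is iterated [m] times and the Pochhammer products are read as Gamma
    ratios. In the limit the powers of [m] cancel, because [(c - a) + (c - b) = c + (c - a - b)]. *)
Lemma hyp_Gauss a b c : 0 < c -> 0 < c - a - b -> 0 < c - a -> 0 < c - b ->
  hyp2F1 a b c 1 = Gamma c * Gamma (c - a - b) / (Gamma (c - a) * Gamma (c - b)).
Proof.
move=> c0 d0 ca cb.
have prod m : hyp2F1 a b c 1 = poch (c - a) m * poch (c - b) m / (poch c m * poch (c - a - b) m)
    * hyp2F1 a b (c + m%:R) 1.
  elim: m => [|m IH]; first by rewrite /poch !big_ord0 addr0 !mul1r invr1 mul1r.
  rewrite IH !pochS.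
  have cm : 0 < c + m%:R by rewrite ltr_wpDr.
  have dm : 0 < c - a - b + m%:R by rewrite ltr_wpDr.
  have dm' : 0 < c + m%:R - a - b by have := ler0n R m; lra.
  have := hyp_contiguous cm dm'.
  rewrite -natr1 addrA.
  have p0 := poch_gt0 m c0; have p1 := poch_gt0 m d0.
  move: (hyp2F1 a b (c + m%:R) 1) (hyp2F1 a b (c + m%:R + 1) 1) => F F1 E.
  have -> : F = (c + m%:R - a) * (c + m%:R - b) * F1 / ((c + m%:R) * (c + m%:R - a - b)).
    by rewrite -E; field; rewrite !gt_eqF.
  have e1 : c + m%:R - a - b = c - a - b + m%:R by ring.
  by rewrite e1; field; rewrite !gt_eqF.
pose r (x : R) (m : nat) := Gamma (x + m.+1%:R) / (Gamma (m.+1%:R : R) * m.+1%:R `^ x).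
have rc (x : R) : 0 < x -> r x @ \oo --> (1 : R) by move=> x0; apply: Gamma_ratio; exact: ltW.
have lim1 : r (c - a) m * r (c - b) m / (r c m * r (c - a - b) m)
    * (Gamma c * Gamma (c - a - b) / (Gamma (c - a) * Gamma (c - b)))
    * hyp2F1 a b (c + m.+1%:R) 1 @[m --> \oo] -->
    1 * 1 / (1 * 1) * (Gamma c * Gamma (c - a - b) / (Gamma (c - a) * Gamma (c - b))) * 1.
  apply: cvgM; last by have := hyp_shift_cvg c0 d0; rewrite -cvg_shiftS.
  apply: cvgM; last exact: cvg_cst.
  apply: cvgM; first by apply: cvgM; exact: rc.
  by apply: cvgV; [rewrite mulr1 oner_neq0|apply: cvgM; exact: rc].
rewrite !mul1r invr1 !mul1r mulr1 in lim1.
apply: (cvg_unique (@Rhausdorff R) _ lim1).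
apply: (@cvg_trans _ ((fun=> hyp2F1 a b c 1) @ \oo)); last exact: cvg_cst.
apply: near_eq_cvg; near=> m; rewrite /= (prod m.+1) /r !poch_Gamma //.
have ex : m.+1%:R `^ (c - a) * m.+1%:R `^ (c - b) = m.+1%:R `^ c * m.+1%:R `^ (c - a - b) :> R.
  by rewrite -!powRD_gt0 //; congr powR; ring.
move: (m.+1%:R : R) (ltr0Sn R m) ex => M M0 ex.
congr (_ * _).
have g1 := Gamma_gt0 c0; have g2 := Gamma_gt0 d0; have g3 := Gamma_gt0 ca; have g4 := Gamma_gt0 cb.
have g5 := Gamma_gt0 (addr_gt0 c0 M0); have g6 := Gamma_gt0 (addr_gt0 d0 M0).
have g7 := Gamma_gt0 M0.
have k1 := powR_gt0 c M0; have k2 := powR_gt0 (c - a - b) M0.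
have k3 := powR_gt0 (c - a) M0; have k4 := powR_gt0 (c - b) M0.
move: (Gamma (c - a + M)) (Gamma (c - b + M)) (Gamma c) (Gamma (c - a - b)) (Gamma (c - a)) (Gamma (c - b))
  (Gamma (c + M)) (Gamma (c - a - b + M)) (Gamma M) (M `^ c) (M `^ (c - a - b)) (M `^ (c - a)) (M `^ (c - b))
  g1 g2 g3 g4 g5 g6 g7 k1 k2 k3 k4 ex.
move=> x1 x2 y1 y2 y3 y4 y5 y6 y7 z1 z2 z3 z4 g1 g2 g3 g4 g5 g6 g7 k1 k2 k3 k4 ex.
have -> : z1 = z3 * z4 / z2 by rewrite ex mulfK // gt_eqF.
by field; rewrite !gt_eqF.
Unshelve. all: by end_near. Qed.

End Hypergeometric.

(** * Power series of radius at least 1, and the hypergeometric equation *)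

Section PowerSeries.
Variable R : realType.
Implicit Types (u : nat -> R) (t : R).

(** Says that the radius of convergence is at least 1, in a form that passes to the differentiated
    series. *)
Definition subexp u := forall r : R, 0 < r < 1 -> exists B, forall k, `|u k| * r ^+ k <= B.

Lemma subexp_bounded u B : (forall k, `|u k| <= B) -> subexp u.
Proof.
move=> uB r /andP[r0 r1]; exists B => k; apply: le_trans (uB k).
by rewrite ler_piMr // exprn_ile1 // ltW.
Qed.

Lemma subexp_diffs u : subexp u -> subexp (pseries_diffs u).
Proof.
move=> su r /andP[r0 r1].
(* The bound is taken at a larger radius [r' < 1]; the factor [k + 1] brought by differentiation is
   absorbed by [tau^k], through a geometric sum. *)
pose r' := (1 + r) / 2; pose tau := r / r'.
have r'0 : 0 < r' by rewrite /r'; lra.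
have r'1 : r' < 1 by rewrite /r'; lra.
have rr' : r < r' by rewrite /r'; lra.
have tau0 : 0 < tau by rewrite divr_gt0.
have tau1 : tau < 1 by rewrite ltr_pdivrMr // mul1r.
have [B HB] := su r' ltac:(by rewrite r'0).
have B0 : 0 <= B by apply: le_trans (HB 0%N); rewrite mulr_ge0 // exprn_ge0 // ltW.
have kt k : k.+1%:R * tau ^+ k <= (1 - tau)^-1.
  have t1 : 0 < 1 - tau by rewrite subr_gt0.
  rewrite -[leRHS]mul1r ler_pdivlMr //.
  have := subrX1 tau k.+1; rewrite -opprB => /eqP; rewrite eqr_oppLR -mulNr opprB => /eqP E.
  apply: (@le_trans _ _ (1 - tau ^+ k.+1)); last by rewrite lerBlDr lerDl exprn_ge0 // ltW.
  rewrite E mulrC ler_wpM2l ?(ltW t1) //.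
  rewrite mulr_natl -[X in _ *+ X]card_ord -sumr_const; apply: ler_sum => i _.
  by apply: ler_wiXn2l; rewrite ?ltW // -ltnS.
exists (B / r' * (1 - tau)^-1) => k; rewrite /pseries_diffs normrM ger0_norm //.
have -> : k.+1%:R * `|u k.+1| * r ^+ k = (`|u k.+1| * r' ^+ k.+1) / r' * (k.+1%:R * tau ^+ k).
  have -> : r ^+ k = r' ^+ k * tau ^+ k by rewrite -exprMn /tau mulrCA divff ?mulr1 // gt_eqF.
  by rewrite exprS; field; rewrite gt_eqF.
apply: ler_pM => //.
- by rewrite !mulr_ge0 ?invr_ge0 ?exprn_ge0 // ltW.
- by rewrite mulr_ge0 // exprn_ge0 // ltW.
- by rewrite ler_wpM2r ?invr_ge0 // ltW.
Qed.

Lemma subexp_cvg u t : subexp u -> `|t| < 1 -> cvgn (pseries u t).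
Proof.
move=> su t1.
pose r := (1 + `|t|) / 2.
have t0 := normr_ge0 t.
have r0 : 0 < r by rewrite /r; lra.
have r1 : r < 1 by rewrite /r; lra.
have tr : `|t| < r by rewrite /r; lra.
have [B HB] := su r ltac:(by rewrite r0).
have B0 : 0 <= B by apply: le_trans (HB 0%N); rewrite mulr_ge0 // exprn_ge0 // ltW.
have tau0 : 0 <= `|t| / r by rewrite divr_ge0 // ltW.
apply: normed_cvg.
have g : cvgn (series (geometric B (`|t| / r))).
  by apply: is_cvg_geometric_series; rewrite ger0_norm // ltr_pdivrMr // mul1r.
apply: (series_le_cvg _ _ _ g) => k //=.
  by rewrite mulr_ge0 // exprn_ge0.
rewrite normrM normrX.
have -> : `|t| ^+ k = r ^+ k * (`|t| / r) ^+ k by rewrite -exprMn mulrCA divff ?mulr1 // gt_eqF.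
by rewrite mulrA ler_wpM2r ?exprn_ge0.
Qed.

Lemma subexp_derive u t : subexp u -> `|t| < 1 ->
  is_derive t 1 (fun t => limn (pseries u t)) (limn (pseries (pseries_diffs u) t)).
Proof.
move=> su t1; pose K := (1 + `|t|) / 2.
have t0 := normr_ge0 t.
have K0 : 0 < K by rewrite /K; lra.
have K1 : `|K| < 1 by rewrite gtr0_norm // /K; lra.
have tK : `|t| < `|K| by rewrite (gtr0_norm K0) /K; lra.
apply: (pseries_snd_diffs _ _ _ tK); apply: subexp_cvg => //.
- exact: subexp_diffs.
- by apply: subexp_diffs; exact: subexp_diffs.
Qed.

Lemma cvg_series_shift1 (v w : nat -> R) (L : R) : v 0%N = 0 -> (forall k, v k.+1 = w k) ->
  series w @ \oo --> L -> series v @ \oo --> L.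
Proof.
move=> v0 vw wL; rewrite -cvg_shiftS; apply: cvg_trans wL; apply: near_eq_cvg; near=> N.
rewrite /series /= big_nat_recl // v0 add0r.
by apply: eq_bigr => k _.
Unshelve. all: by end_near. Qed.

End PowerSeries.

Section HypergeometricODE.
Variable R : realType.
Variables a b c : R.
Hypothesis c0 : 0 < c.
Hypothesis d0 : 0 < c - a - b.
Local Notation h := (hcoef a b c).

Definition hyp1 (t : R) := limn (pseries (pseries_diffs h) t).
Definition hyp2 (t : R) := limn (pseries (pseries_diffs (pseries_diffs h)) t).

Lemma subexp_hcoef : subexp h.
Proof. by apply: subexp_bounded => k; exact: hcoef_le_sum. Qed.

Lemma hyp_derive (t : R) : `|t| < 1 -> is_derive t (1 : R) (hyp2F1 a b c) (hyp1 t).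
Proof.
move=> t1; rewrite (_ : hyp2F1 a b c = fun t => limn (pseries h t)); last first.
  by apply/funext => x; rewrite hyp2F1E.
by apply: subexp_derive => //; exact: subexp_hcoef.
Qed.

Lemma hyp1_derive (t : R) : `|t| < 1 -> is_derive t (1 : R) hyp1 (hyp2 t).
Proof. by move=> t1; apply: subexp_derive => //; apply: subexp_diffs; exact: subexp_hcoef. Qed.

Lemma hyp2_continuous (t : R) : `|t| < 1 -> {for t, continuous hyp2}.
Proof.
move=> t1; apply: differentiable_continuous; apply/derivable1_diffP.
have [] // := @subexp_derive R (pseries_diffs (pseries_diffs h)) t _ t1.
by apply: subexp_diffs; apply: subexp_diffs; exact: subexp_hcoef.
Qed.

Lemma hyp2F1_0 : hyp2F1 a b c 0 = 1.
Proof.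
rewrite hyp2F1E; apply/cvg_lim => //; rewrite -cvg_shiftS.
apply: (@cvg_trans _ ((fun=> 1 : R) @ \oo)); last exact: cvg_cst.
apply: near_eq_cvg; near=> N; rewrite /pseries /series /= big_nat_recl //= hcoef0 mulr1.
by rewrite big1 ?addr0 // => k _; rewrite expr0n mulr0.
Unshelve. all: by end_near. Qed.

(** The series [g], [v], [w] represent [t F'], [t F''] and [t^2 F''] with matching powers of [t].
    The recurrence of the coefficients then kills every partial sum exactly, without remainder. *)
Lemma hyp_ode (t : R) : `|t| < 1 ->
  t * (1 - t) * hyp2 t + (c - (a + b + 1) * t) * hyp1 t - a * b * hyp2F1 a b c t = 0.
Proof.
move=> t1; have su := subexp_hcoef.
have C0 : pseries h t @ \oo --> hyp2F1 a b c t by rewrite hyp2F1E; exact: subexp_cvg.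
have C1 : pseries (pseries_diffs h) t @ \oo --> hyp1 t.
  by apply: subexp_cvg => //; exact: subexp_diffs.
have C2 : pseries (pseries_diffs (pseries_diffs h)) t @ \oo --> hyp2 t.
  by apply: subexp_cvg => //; apply: subexp_diffs; exact: subexp_diffs.
have Z (w : nat -> R) (x L : R) : series w @ \oo --> L -> series (fun k => x * w k) @ \oo --> x * L.
  move=> wL; have -> : series (fun k => x * w k) = fun N => x * series w N.
    by apply/funext => N; rewrite /series /= mulr_sumr.
  exact: cvgMr.
pose g k := k%:R * h k * t ^+ k.
pose v k := k%:R * (k.+1%:R * h k.+1) * t ^+ k.
pose w k := k%:R * (k%:R - 1) * h k * t ^+ k.
have Cg : series g @ \oo --> t * hyp1 t.
  apply: cvg_series_shift1 (Z _ t _ C1); first by rewrite /g !mul0r.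
  by move=> k; rewrite /g /= /pseries_diffs exprS; ring.
have Cv : series v @ \oo --> t * hyp2 t.
  apply: cvg_series_shift1 (Z _ t _ C2); first by rewrite /v !mul0r.
  by move=> k; rewrite /v /= /pseries_diffs exprS; ring.
have Cw : series w @ \oo --> t * (t * hyp2 t).
  apply: cvg_series_shift1 (Z _ t _ Cv); first by rewrite /w !mul0r.
  by move=> k; rewrite /w /v exprS -natr1; ring.
have C : series v N - series w N + c * pseries (pseries_diffs h) t N - (a + b + 1) * series g N
    - a * b * pseries h t N @[N --> \oo] -->
    t * hyp2 t - t * (t * hyp2 t) + c * hyp1 t - (a + b + 1) * (t * hyp1 t) - a * b * hyp2F1 a b c t.
  apply: cvgB; last exact: cvgMr.
  apply: cvgB; last exact: cvgMr.
  apply: cvgD; last exact: cvgMr.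
  exact: cvgB.
have E0 N : series v N - series w N + c * pseries (pseries_diffs h) t N - (a + b + 1) * series g N
    - a * b * pseries h t N = 0.
  elim: N => [|N IH]; first by rewrite /pseries /series /= !big_geq //; ring.
  rewrite !seriesSr !pseriesS -[RHS](addr0 0) -{1}IH.
  have := hcoefS a b N c0; rewrite /v /w /g /pseries_diffs -[N.+1%:R]natr1.
  move: (h N.+1) (h N) => x y /eqP; rewrite -subr_eq0 => /eqP E.
  rewrite -[X in _ = _ + X](mul0r (t ^+ N)) -E.
  by ring.
suff E : t * hyp2 t - t * (t * hyp2 t) + c * hyp1 t - (a + b + 1) * (t * hyp1 t)
    - a * b * hyp2F1 a b c t = 0 by rewrite -[RHS]E; ring.
apply: (cvg_unique (@Rhausdorff R) C).
apply: (@cvg_trans _ ((fun=> 0 : R) @ \oo)); last exact: cvg_cst.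
by apply: near_eq_cvg; near=> N; rewrite E0.
Unshelve. all: by end_near. Qed.

End HypergeometricODE.

(** * Directional derivatives and pointwise continuity of real-valued functions *)

Section Derivatives.
Variables (R : realType) (V : normedModType R).
Implicit Types (f g : V -> R) (x v : V).

Lemma derivD f g x v df dg : is_derive x v f df -> is_derive x v g dg ->
  is_derive x v (fun t => f t + g t) (df + dg).
Proof. by move=> h1 h2; exact: is_deriveD. Qed.

Lemma derivM f g x v df dg : is_derive x v f df -> is_derive x v g dg ->
  is_derive x v (fun t => f t * g t) (f x * dg + g x * df).
Proof. by move=> h1 h2; exact: is_deriveM. Qed.

Lemma deriv_cst (c : R) x v : is_derive x v (fun _ : V => c) 0.
Proof. exact: is_derive_cst. Qed.

Lemma derivX f n x v df : is_derive x v f df ->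
  is_derive x v (fun t => f t ^+ n.+1) (n.+1%:R * f x ^+ n * df).
Proof.
move=> h; elim: n => [|n IH].
  by rewrite (_ : (fun t => f t ^+ 1) = f) ?expr0 ?mul1r //; apply/funext => t; rewrite expr1.
rewrite (_ : (fun t => f t ^+ n.+2) = fun t => f t * f t ^+ n.+1); last by apply/funext => t; rewrite exprS.
apply: (is_derive_eq (derivM h IH)).
by rewrite -[n.+2%:R]natr1 exprS; ring.
Qed.

Lemma deriv_sum (I : Type) (r : seq I) (f : I -> V -> R) x v (df : I -> R) :
  (forall i, is_derive x v (f i) (df i)) ->
  is_derive x v (fun t => \sum_(i <- r) f i t) (\sum_(i <- r) df i).
Proof.
move=> h; elim: r => [|i r IH].
  rewrite big_nil (_ : (fun t => _) = fun=> 0); first exact: deriv_cst.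
  by apply/funext => t; rewrite big_nil.
rewrite big_cons (_ : (fun t => _) = fun t => f i t + \sum_(j <- r) f j t).
  by apply: derivD.
by apply/funext => t; rewrite big_cons.
Qed.

(** Reduces a directional derivative to a one-variable one, for which the chain rule is
    available. *)
Lemma deriv_line f x v df :
  is_derive x v f df <-> is_derive (0 : R) (1 : R) (fun h => f (h *: v + x)) df.
Proof.
have E : (fun h : R => h^-1 *: ((f \o shift x) (h *: v) - f x)) =
  (fun h : R => h^-1 *: (((fun h => f (h *: v + x)) \o shift (0 : R)) (h *: (1 : R)) - f (0 *: v + x))).
  apply/funext => h /=; rewrite scale0r add0r addr0.
  by rewrite [h *: 1]mulr1.
split => -[d1 d2]; split.
- by rewrite /derivable -E.
- by rewrite /derive -E.
- by rewrite /derivable E.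
- by rewrite /derive E.
Qed.

Lemma deriv_comp f (h : R -> R) x v df dh : is_derive x v f df -> is_derive (f x) 1 h dh ->
  is_derive x v (fun t => h (f t)) (dh * df).
Proof.
move=> /deriv_line hf hh; apply/deriv_line.
have e : f (0 *: v + x) = f x by rewrite scale0r add0r.
rewrite -e in hh.
exact: (is_derive_eq (is_derive1_comp (f := h) (g := fun t => f (t *: v + x)) hh hf)).
Qed.

End Derivatives.

Section PointwiseContinuity.
Variables (R : realType) (T : topologicalType).
Implicit Types (f g : T -> R) (x : T).

Lemma contD f g x : {for x, continuous f} -> {for x, continuous g} ->
  {for x, continuous (fun t => f t + g t)}.
Proof. by move=> cf cg; exact: cvgD. Qed.

Lemma contM f g x : {for x, continuous f} -> {for x, continuous g} ->
  {for x, continuous (fun t => f t * g t)}.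
Proof. by move=> cf cg; exact: cvgM. Qed.

Lemma cont_cst (c : R) x : {for x, continuous (fun _ : T => c)}.
Proof. exact: cst_continuous. Qed.

Lemma cont_comp f (h : R -> R) x : {for x, continuous f} -> {for f x, continuous h} ->
  {for x, continuous (fun t => h (f t))}.
Proof. by move=> cf ch; exact: continuous_comp. Qed.

Lemma contX f k x : {for x, continuous f} -> {for x, continuous (fun t => f t ^+ k)}.
Proof. by move=> cf; apply: (@cont_comp f (fun t => t ^+ k)) => //; exact: exprn_continuous. Qed.

Lemma contV f x : f x != 0 -> {for x, continuous f} -> {for x, continuous (fun t => (f t)^-1)}.
Proof. by move=> f0 cf; exact: cvgV. Qed.

Lemma cont_sum (I : Type) (r : seq I) (f : I -> T -> R) x :
  (forall i, {for x, continuous (f i)}) ->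
  {for x, continuous (fun t => \sum_(i <- r) f i t)}.
Proof.
move=> cf; elim: r => [|i r IH].
  rewrite (_ : (fun t => _) = fun=> 0); first exact: cont_cst.
  by apply/funext => t; rewrite big_nil.
rewrite (_ : (fun t => _) = fun t => f i t + \sum_(j <- r) f j t).
  by apply: contD; [exact: cf|exact: IH].
by apply/funext => t; rewrite big_cons.
Qed.

Lemma cont_near_eq (U : topologicalType) (f g : T -> U) x :
  (\forall y \near x, f y = g y) -> {for x, continuous f} -> {for x, continuous g}.
Proof.
move=> fg cf; rewrite /prop_for /continuous_at -(nbhs_singleton fg).
apply: cvg_trans cf; apply: near_eq_cvg.
by apply: filterS fg => y ->.
Qed.

End PointwiseContinuity.

(** * From row vectors to lists of coordinates *)

Section RowLists.
Variable R : realType.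

Definition rowl m (s : seq R) : 'rV[R]_m := \row_i nth 0 s i.

Lemma all2_nth (r : R -> R -> bool) s t i : all2 r s t -> (i < size s)%N ->
  r (nth 0 s i) (nth 0 t i).
Proof.
elim: s t i => [|x s IH] [|y t] [|i] //= /andP[xy st]; first by [].
by move=> si; exact: IH.
Qed.

Lemma rV_ballP m (x y : 'rV[R]_m) (e : R) : 0 < e ->
  ball x e y <-> forall i, `|x ord0 i - y ord0 i| < e.
Proof.
move=> e0; split => [h i|h].
  have [_ h'] : 0 < e /\ forall i j, ball (x i j) e (y i j) := h.
  exact: (h' ord0 i).
suff h' : 0 < e /\ forall i j, ball (x i j) e (y i j) by exact: h'.
by split => // k i; rewrite (ord1 k); exact: h.
Qed.

(** Compactness of the cube of half-side [A + 1] gives a common modulus [d]. The margin 1 together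
    with [d <= 1] ensures that, when the first point is outside that cube, both points are outside
    the support. *)
Lemma rV_uc m (Psi : 'rV[R]_m -> R) (A M : R) : continuous Psi ->
  (forall x, `|Psi x| <= M) -> (forall (x : 'rV[R]_m) (i : 'I_m), A < `|x ord0 i| -> Psi x = 0) ->
  uc m A M (fun s => Psi (rowl m s)).
Proof.
move=> cP PM PA; split.
- by move=> s _; exact: PM.
- move=> s ss; rewrite -has_predC => /hasP[t /(nthP 0)[i si <-]] /=; rewrite -ltNge => tA.
  rewrite ss in si; apply: (PA _ (Ordinal si)); by rewrite mxE.
move=> e e0.
pose K : set 'rV[R]_m := [set v | forall i, v ord0 i \in `[(- (A + 1)), (A + 1)]].
have cK : compact K.
  apply: (@rV_compact _ _ (fun=> `[(- (A + 1)), (A + 1)]%classic)).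
  by move=> _; exact: segment_compact.
pose P (d : R) (x : 'rV[R]_m) := forall y : 'rV[R]_m,
  (forall i, `|x ord0 i - y ord0 i| <= d) -> `|Psi x - Psi y| <= e.
have /compact_near_coveringP nc := cK.
have : \forall d \near (0 : R)^'+, K `<=` P d.
  apply: nc => x Kx.
  have /cvgrPdist_le /(_ (e / 2)) := cP x; rewrite divr_gt0 // => /(_ isT).
  move=> /nbhs_ballP[r /= r0 hr].
  exists (ball x (r / 2), [set d : R | d < r / 2]).
    split => /=; first by apply: nbhsx_ballx; rewrite divr_gt0.
    by apply: nbhs_right_lt; rewrite divr_gt0.
  move=> [x' d] [/= xx' dr] y x'y.
  have xx'i := (rV_ballP _ _ (divr_gt0 r0 (ltr0n R 2))).1 xx'.
  have h1 : `|Psi x - Psi x'| <= e / 2.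
    by apply: hr; apply/rV_ballP => // i; apply: lt_trans (xx'i i) _; lra.
  have h2 : `|Psi x - Psi y| <= e / 2.
    apply: hr; apply/rV_ballP => // i.
    have -> : x ord0 i - y ord0 i = (x ord0 i - x' ord0 i) + (x' ord0 i - y ord0 i) by ring.
    apply: (le_lt_trans (ler_normD _ _)); have := xx'i i; have := x'y i; lra.
  have -> : Psi x' - Psi y = (Psi x - Psi y) - (Psi x - Psi x') by ring.
  by apply: (le_trans (ler_normB _ _)); lra.
move=> Kd.
have F1 : \forall d \near (0 : R)^'+, 0 < d by exact: nbhs_right_gt.
have F2 : \forall d \near (0 : R)^'+, d <= 1 by exact: nbhs_right_le.
have := @filter_ex _ _ (at_right_proper_filter (0 : R)) _ (filterI (filterI Kd F1) F2).
move=> [d [[hd d0] d1]].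
exists d => // s t ss st std.
have dist i : `|rowl m s ord0 i - rowl m t ord0 i| <= d.
  by rewrite !mxE; apply: (all2_nth std); rewrite ss.
case: (pselect (K (rowl m s))) => [Ks|nKs]; first exact: hd.
have [i] : exists i, ~ (rowl m s ord0 i \in `[(- (A + 1)), (A + 1)]) by apply/existsNP.
rewrite in_itv /= -ler_norml => /negP; rewrite -ltNge => h.
have h1 : A < `|rowl m s ord0 i| by lra.
have h2 : A < `|rowl m t ord0 i|.
  have := ler_normD (rowl m s ord0 i - rowl m t ord0 i) (rowl m t ord0 i); rewrite subrK.
  by have := dist i; lra.
by rewrite (PA _ _ h1) (PA _ _ h2) subrr normr0 ltW.
Qed.

(** The outermost integrand lives on the single point 0, which is negligible. This disposes of the
    origin, where [theta] is discontinuous. *)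
Lemma iter_int_supp0 k (F : seq R -> R) :
  (forall s, size s = k.+1 -> head 0 s != 0 -> F s = 0) -> iter_int k.+1 F = 0.
Proof.
move=> F0 /=.
pose J := fun t : R => iter_int k (fun s => F (t :: s)).
transitivity (\int[lebesgue_measure]_(t in [set (0 : R)]) J 0); last exact: Rintegral_set1.
rewrite [RHS]Rintegral_mkcond; apply: eq_Rintegral => t _.
rewrite patchE; case: ifPn => [|/negP]; rewrite inE /=; first by move=> ->.
move=> /eqP t0; rewrite -(@iter_int_ext _ k (fun=> 0)).
  elim: k {F F0 J} => //= k IH.
  transitivity (\int[lebesgue_measure]_(t in set0) (0 : R)); last exact: Rintegral_set0.
  by rewrite [RHS]Rintegral_mkcond; apply: eq_Rintegral => u _; rewrite IH patchE; case: ifP.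
by move=> s ss; rewrite F0 //= ss.
Qed.

End RowLists.

(** * Integration over the sphere *)

Section SphereGeometry.
Variables (R : realType) (n : nat).
Local Notation V := 'rV[R]_(n.+1).
Implicit Types x y xi : V.

(** The squared norm is a polynomial, hence smooth at the origin too; radial functions are written
    as functions of it. *)
Definition qn x : R := \sum_(i < n.+1) x ord0 i ^+ 2.
Definition dot x y : R := \sum_(i < n.+1) x ord0 i * y ord0 i.

Lemma qn_ge0 x : 0 <= qn x.
Proof. by apply: sumr_ge0 => i _; exact: sqr_ge0. Qed.

Lemma enorm_sqr x : enorm x ^+ 2 = qn x.
Proof. by rewrite /enorm sqr_sqrtr // qn_ge0. Qed.

Lemma enorm_ge0 x : 0 <= enorm x.
Proof. exact: sqrtr_ge0. Qed.

Lemma enormE x : enorm x = Num.sqrt (qn x).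
Proof. by []. Qed.

Lemma sphereE xi : sphere xi <-> qn xi = 1.
Proof.
rewrite /sphere /= enormE; split => [h|->]; last by rewrite sqrtr1.
by rewrite -enorm_sqr enormE h expr1n.
Qed.

Lemma unit_ballE x : unit_ball x <-> qn x < 1.
Proof.
rewrite /unit_ball /= -[in X in _ <-> X]enorm_sqr; split => h.
  by rewrite expr_lt1 // enorm_ge0.
by rewrite -(@expr_lt1 _ 2) // enorm_ge0.
Qed.

Lemma coord_sqr_le x i : x ord0 i ^+ 2 <= qn x.
Proof. by rewrite /qn (bigD1 i) //= lerDl; apply: sumr_ge0 => j _; exact: sqr_ge0. Qed.

Lemma qn_eq0 x : qn x = 0 -> x = 0.
Proof.
move=> h; apply/rowP => i; rewrite mxE; apply/eqP; rewrite -sqrf_eq0 eq_le sqr_ge0 andbT.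
by rewrite -h coord_sqr_le.
Qed.

Lemma qn0 : qn 0 = 0.
Proof. by rewrite /qn big1 // => i _; rewrite mxE expr0n. Qed.

Lemma qn_gt0 x : x != 0 -> 0 < qn x.
Proof. by move=> x0; rewrite lt0r qn_ge0 andbT; apply: contra x0 => /eqP /qn_eq0 ->. Qed.

Lemma qnB x y : qn (x - y) = qn x + qn y - 2 * dot x y.
Proof.
rewrite /qn /dot mulr_sumr -big_split -sumrB /=; apply: eq_bigr => i _.
by rewrite !mxE; ring.
Qed.

Lemma qnZ a x : qn (a *: x) = a ^+ 2 * qn x.
Proof. by rewrite /qn mulr_sumr; apply: eq_bigr => i _; rewrite mxE exprMn. Qed.

Lemma dotZr a x y : dot x (a *: y) = a * dot x y.
Proof. by rewrite /dot mulr_sumr; apply: eq_bigr => i _; rewrite mxE; ring. Qed.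

Lemma dot_sphere x xi : sphere xi -> `|dot x xi| <= enorm x.
Proof.
move=> /sphereE xi1; rewrite -ler_sqr ?nnegrE ?enorm_ge0 // enorm_sqr real_normK ?num_real //.
have := qn_ge0 (x - dot x xi *: xi); rewrite qnB qnZ dotZr xi1.
by move: (dot x xi) (qn x) => d q; rewrite mulr1 -expr2; lra.
Qed.

Lemma theta_sphere x : sphere (theta x).
Proof.
apply/sphereE; rewrite /theta; case: eqP => [_|/eqP x0].
  rewrite /qn (bigD1 ord0) //= big1 ?addr0.
    by rewrite /ecoord mxE !eqxx expr1n.
  by move=> i i0; rewrite /ecoord mxE eqxx /= (negbTE i0) expr0n.
rewrite qnZ exprVn enorm_sqr mulVf // gt_eqF // qn_gt0 //.
Qed.

Lemma coord_cont i : continuous (fun x : V => x ord0 i).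
Proof. exact: coord_continuous. Qed.

Lemma qn_continuous : continuous qn.
Proof.
by move=> x; apply: cont_sum => i; apply: contX; exact: coord_cont.
Qed.

Lemma enorm_continuous : continuous (@enorm R n).
Proof.
move=> x; apply: (@continuous_comp _ _ _ qn (@Num.sqrt R)); first exact: qn_continuous.
exact: sqrt_continuous.
Qed.

Lemma theta_continuous x : x != 0 -> {for x, continuous (@theta R n)}.
Proof.
move=> x0.
have e0 : enorm x != 0 by rewrite enormE gt_eqF // sqrtr_gt0 qn_gt0.
apply: (@cont_near_eq _ _ (fun y : V => (enorm y)^-1 *: y)).
  near=> y; rewrite /theta ifF //; apply/negbTE.
  have : 0 < qn y by near: y; apply: (cvgr_gt (qn x)); [exact: qn_continuous|exact: qn_gt0].
  by apply: contraTN => /eqP ->; rewrite qn0 ltxx.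
have ce : {for x, continuous (fun y : V => (enorm y)^-1)}.
  by apply: contV => //; exact: enorm_continuous.
exact: (cvgZ ce cvg_id).
Unshelve. all: by end_near. Qed.

Lemma sphere_compact : compact (sphere : set V).
Proof.
apply: bounded_closed_compact.
  exists 1; split; first exact: num_real.
  move=> M M1 x /sphereE x1; rewrite /= [leLHS]/Num.norm /= mx_normrE; apply/bigmax_leP; split; first lra.
  move=> [k i] _ /=; rewrite (ord1 k); apply: le_trans (ltW M1).
  by rewrite -ler_sqr ?nnegrE // real_normK ?num_real // expr1n -x1 coord_sqr_le.
have -> : sphere = qn @^-1` [set 1] by apply/seteqP; split => x /= /sphereE.
by apply: preimage_closed; [move=> x _; exact: qn_continuous|exact: closed_eq].
Qed.

Lemma sphere_nonempty : (sphere : set V) !=set0.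
Proof. by exists (theta 0); exact: theta_sphere. Qed.

Definition CS (g : V -> R) := {within (sphere : set V), continuous g}.

Lemma CSP (g : V -> R) : CS g <->
  forall xi, sphere xi -> g @ within sphere (nbhs xi) --> g xi.
Proof. exact: subspace_continuousP. Qed.

Lemma CS_bounded g : CS g -> exists2 M, 0 <= M & forall xi, sphere xi -> `|g xi| <= M.
Proof.
move=> cg; have cn : CS (fun x => `|g x|).
  by apply/CSP => xi Sxi; apply: cvg_norm; move/CSP: cg; apply.
have [c _ Hc] := compact_EVT_max sphere_nonempty sphere_compact cn.
by exists `|g c| => // xi Sxi; apply: Hc; rewrite inE.
Qed.

Lemma CS_comp_theta g x : CS g -> x != 0 -> {for x, continuous (fun y => g (theta y))}.
Proof.
move=> /CSP cg x0; apply: (@cvg_comp _ _ _ (@theta R n) g _ (within sphere (nbhs (theta x)))).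
  move=> P; rewrite /within /= => HP.
  have h : \forall y \near x, sphere (theta y) -> P (theta y) := theta_continuous x0 HP.
  by apply: filterS h => y; apply; exact: theta_sphere.
by apply: cg; exact: theta_sphere.
Qed.

Lemma CS_of_continuous g : continuous g -> CS g.
Proof. exact: continuous_subspaceT. Qed.

Lemma CS_lin a g1 g2 : CS g1 -> CS g2 -> CS (fun xi => a * g1 xi + g2 xi).
Proof.
move=> /CSP c1 /CSP c2; apply/CSP => xi Sxi; apply: cvgD; last exact: c2.
by apply: cvgMr; exact: c1.
Qed.

Lemma CS_mul g1 g2 : CS g1 -> CS g2 -> CS (fun xi => g1 xi * g2 xi).
Proof. by move=> /CSP c1 /CSP c2; apply/CSP => xi Sxi; apply: cvgM; [exact: c1|exact: c2]. Qed.

End SphereGeometry.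

Section SphereFunctional.
Variables (R : realType) (n : nat).
Local Notation V := 'rV[R]_(n.+1).
Local Notation row := (@rowl R n.+1).

(** To be evaluated at the squared norm. [chi j] tends to the indicator of the open interval from 0
    to 1 and vanishes for [t <= 1 / j], which hides the discontinuity of [theta]; the bump [eta j]
    below supplies the value at the origin, where [chi j] is 0 but the indicator of the ball is
    1. *)
Definition chi (j : nat) (t : R) : R :=
  Num.min 1 (Num.max 0 (j%:R * t - 1)) * Num.min 1 (Num.max 0 (j%:R * (1 - t))).
Definition eta (j : nat) (t : R) : R := Num.max 0 (1 - j.+1%:R * t).

Lemma clamp01 (t : R) : 0 <= Num.min 1 (Num.max 0 t) <= 1.
Proof. by rewrite le_min ler01 le_max lexx /= ge_min lexx. Qed.

Lemma continuous_clamp (f : R -> R) : continuous f -> continuous (fun t => Num.min 1 (Num.max 0 (f t))).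
Proof.
move=> cf t; apply: (@continuous_min _ _ (fun=> 1) (fun t => Num.max 0 (f t))); first exact: cst_continuous.
by apply: (@continuous_max _ _ (fun=> 0) f); [exact: cst_continuous|exact: cf].
Qed.

Lemma affine_continuous (a b : R) : continuous (fun t : R => a * t + b).
Proof.
move=> t; apply: cvgD; last exact: cvg_cst.
by apply: cvgMr; exact: cvg_id.
Qed.

Lemma chi_continuous j : continuous (chi j).
Proof.
move=> t; apply: (@contM R R (fun t => Num.min 1 (Num.max 0 (j%:R * t - 1)))
  (fun t => Num.min 1 (Num.max 0 (j%:R * (1 - t)))) t); first by apply: continuous_clamp; exact: affine_continuous.
apply: continuous_clamp => u; rewrite (_ : (fun t : R => j%:R * (1 - t)) = fun t => - j%:R * t + j%:R).
  exact: affine_continuous.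
by apply/funext => w; ring.
Qed.

Lemma eta_continuous j : continuous (eta j).
Proof.
move=> t; apply: (@continuous_max _ _ (fun=> 0) (fun t : R => 1 - j.+1%:R * t)); first exact: cst_continuous.
rewrite (_ : (fun t : R => 1 - j.+1%:R * t) = fun t => - j.+1%:R * t + 1).
  exact: affine_continuous.
by apply/funext => w; ring.
Qed.

Lemma chi_itv j t : 0 <= chi j t <= 1.
Proof.
have /andP[a0 a1] := clamp01 (j%:R * t - 1); have /andP[b0 b1] := clamp01 (j%:R * (1 - t)).
by rewrite /chi mulr_ge0 //= mulr_ile1.
Qed.

Lemma chi_small j t : j%:R * t <= 1 -> chi j t = 0.
Proof. by move=> h; rewrite /chi (max_idPl _) ?subr_le0 // (min_idPr _) ?ler01 // mul0r. Qed.

Lemma chi_le0 j t : t <= 0 -> chi j t = 0.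
Proof. by move=> h; apply: chi_small; apply: le_trans ler01; rewrite mulr_ge0_le0. Qed.

Lemma chi_ge1 j t : 1 <= t -> chi j t = 0.
Proof.
move=> h; have h0 : Num.max 0 (j%:R * (1 - t)) = 0.
  by apply/max_idPl; rewrite mulr_ge0_le0 // subr_le0.
by rewrite /chi h0 (_ : Num.min 1 0 = 0) ?mulr0 //; apply/min_idPr.
Qed.

Lemma chi_cvg t : 0 < t < 1 -> chi j t @[j --> \oo] --> (1 : R).
Proof.
move=> /andP[t0 t1]; apply: (@cvg_trans _ ((fun=> 1 : R) @ \oo)); last exact: cvg_cst.
apply: near_eq_cvg; near=> j.
have h1 : 2 / t <= j%:R by near: j; exact: nbhs_infty_ger.
have h2 : 1 / (1 - t) <= j%:R by near: j; exact: nbhs_infty_ger.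
rewrite ler_pdivrMr // in h1; rewrite ler_pdivrMr ?subr_gt0 // in h2.
rewrite /chi (max_idPr _); last lra.
rewrite (max_idPr _); last lra.
by rewrite !(min_idPl _) ?mulr1 //; lra.
Unshelve. all: by end_near. Qed.

Lemma eta_itv j t : 0 <= t -> 0 <= eta j t <= 1.
Proof. by move=> t0; rewrite /eta le_max lexx /= ge_max ler01 lerBlDr lerDl mulr_ge0. Qed.

Lemma eta_ge1 j t : 1 <= t -> eta j t = 0.
Proof.
move=> t1; apply/max_idPl; rewrite subr_le0 -[leLHS]mulr1 ler_pM // ler1n //.
Qed.

Lemma eta0 j : eta j 0 = 1.
Proof. by rewrite /eta mulr0 subr0; apply/max_idPr. Qed.

Lemma eta_cvg t : 0 < t -> eta j t @[j --> \oo] --> (0 : R).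
Proof.
move=> t0; apply: (@cvg_trans _ ((fun=> 0 : R) @ \oo)); last exact: cvg_cst.
apply: near_eq_cvg; near=> j.
have h1 : 1 / t <= j%:R by near: j; exact: nbhs_infty_ger.
rewrite ler_pdivrMr // in h1; rewrite /eta (max_idPl _) // subr_le0.
by apply: (le_trans h1); rewrite ler_wpM2r ?ltW // ltr_nat.
Unshelve. all: by end_near. Qed.

Lemma cutoff_continuous (g : V -> R) j : CS g -> continuous (fun x : V => chi j (qn x) * g (theta x)).
Proof.
move=> cg x.
have cc : continuous (fun x : V => chi j (qn x)).
  by move=> y; apply: cont_comp; [exact: qn_continuous|exact: chi_continuous].
have [->|x0] := eqVneq x 0; last first.
  by apply: (@contM R V (fun x => chi j (qn x)) (fun x => g (theta x)) x); [exact: cc|exact: CS_comp_theta].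
apply: (@cont_near_eq _ _ (fun=> 0 : R)); last exact: cont_cst.
near=> y.
rewrite chi_small ?mul0r // ltW //.
near: y; apply: (cvgr_lt (j%:R * qn (0 : V))); last by rewrite qn0 mulr0 ltr01.
by apply: (@contM R V (fun=> j%:R) (@qn R n) 0); [exact: cont_cst|exact: qn_continuous].
Unshelve. all: by end_near. Qed.

Lemma qn_coord_gt1 (x : V) i : 1 < `|x ord0 i| -> 1 <= qn x.
Proof.
move=> h; apply: le_trans (coord_sqr_le x i).
by rewrite -[x ord0 i ^+ 2]real_normK ?num_real // -(@expr1n R 2) lerXn2r ?nnegrE // ltW.
Qed.

Lemma cutoff_uc (g : V -> R) M j : CS g -> 0 <= M -> (forall xi, sphere xi -> `|g xi| <= M) ->
  uc n.+1 1 M (fun s => chi j (qn (row s)) * g (theta (row s))).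
Proof.
move=> cg M0 gM; apply: (@rV_uc _ _ (fun x : V => chi j (qn x) * g (theta x))).
- exact: cutoff_continuous.
- move=> x; rewrite normrM -[leRHS]mul1r; apply: ler_pM => //; last by apply: gM; exact: theta_sphere.
  by have /andP[c0 c1] := chi_itv j (qn x); rewrite ger0_norm.
- by move=> x i h; rewrite chi_ge1 ?mul0r //; exact: qn_coord_gt1 h.
Qed.

Definition Scut (j : nat) (g : V -> R) :=
  iter_int n.+1 (fun s => chi j (qn (row s)) * g (theta (row s))).

(** Bounded convergence wants a pointwise limit everywhere, so it is applied to the sum of the [chi]
    and [eta] terms; the [eta] part alone tends to a function carried by the origin, of integral 0.
    Every property of the sphere integral that needs linearity or invariance is transferred through
    this limit. *)
Lemma Scut_cvg g : CS g -> n.+1%:R * Scut j g @[j --> \oo] --> sphere_integral g.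
Proof.
move=> cg; apply: cvgMr.
have [M M0 gM] := CS_bounded cg.
pose g0 := g (theta 0).
have uchi j := cutoff_uc j cg M0 gM.
have ueta j : uc n.+1 1 M (fun s => eta j (qn (row s)) * g0).
  apply: (@rV_uc _ _ (fun x : V => eta j (qn x) * g0)).
  - move=> x; apply: (@contM R V (fun x => eta j (qn x)) (fun=> g0) x); last exact: cont_cst.
    by apply: cont_comp; [exact: qn_continuous|exact: eta_continuous].
  - move=> x; rewrite normrM -[leRHS]mul1r; apply: ler_pM => //; last by apply: gM; exact: theta_sphere.
    by have /andP[c0 c1] := eta_itv j (qn_ge0 x); rewrite ger0_norm.
  - by move=> x i h; rewrite eta_ge1 ?mul0r //; exact: qn_coord_gt1 h.
have Z : iter_int n.+1 (fun s => eta j (qn (row s)) * g0) @[j --> \oo] --> (0 : R).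
  rewrite -(@iter_int_supp0 R n (fun s => if qn (row s) == 0 then g0 else 0)).
    apply: (iter_int_bounded_cvg ler01 ueta) => s ss.
    case: eqP => [->|/eqP q0].
      apply: (@cvg_trans _ ((fun=> g0) @ \oo)); last exact: cvg_cst.
      by apply: near_eq_cvg; near=> j; rewrite eta0 mul1r.
    rewrite -(mul0r g0); apply: cvgMl; apply: eta_cvg.
    by rewrite lt0r q0 qn_ge0.
  move=> [//|t s] /= ss t0; rewrite ifF //; apply/eqP => /qn_eq0 /rowP /(_ ord0).
  by rewrite !mxE /= => /eqP; rewrite (negbTE t0).
have T : iter_int n.+1 (fun s => 1 * (chi j (qn (row s)) * g (theta (row s))) + eta j (qn (row s)) * g0) @[j --> \oo]
    --> ball_integral (fun x => g (theta x)).
  rewrite /ball_integral.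
  apply: (@iter_int_bounded_cvg _ _ 1 (`|1| * M + M)) => //.
    by move=> j; apply: uc_lin.
  move=> s ss /=; rewrite -/(rowl n.+1 s).
  have [q0|q0] := eqVneq (qn (row s)) 0.
    have r0 := qn_eq0 q0.
    have -> : \1_unit_ball (row s) = 1 :> R.
      by rewrite indicE mem_set //; apply/unit_ballE; rewrite q0.
    apply: (@cvg_trans _ ((fun=> 1 * g (theta (row s))) @ \oo)); last exact: cvg_cst.
    apply: near_eq_cvg; near=> j; rewrite q0 chi_le0 // eta0 mul0r mulr0 add0r mul1r mul1r.
    by rewrite /g0 r0.
  have qp : 0 < qn (row s) by rewrite lt0r q0 qn_ge0.
  rewrite -[X in _ --> X](addr0); apply: cvgD; last first.
    by rewrite -(mul0r g0); apply: cvgMl; exact: eta_cvg.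
  rewrite -[X in _ --> X]mul1r; apply: cvgMr; apply: cvgMl.
  rewrite indicE; case: (pselect (unit_ball (row s))) => hb.
    by rewrite mem_set //; apply: chi_cvg; rewrite qp /=; apply/unit_ballE.
  rewrite memNset //; apply: (@cvg_trans _ ((fun=> 0 : R) @ \oo)); last exact: cvg_cst.
  apply: near_eq_cvg; near=> j; rewrite chi_ge1 // leNgt; apply/negP => h.
  by apply: hb; apply/unit_ballE.
have -> : (fun j => Scut j g) = (fun j => iter_int n.+1 (fun s =>
    1 * (chi j (qn (row s)) * g (theta (row s))) + eta j (qn (row s)) * g0) -
    iter_int n.+1 (fun s => eta j (qn (row s)) * g0)).
  by apply/funext => j; rewrite (iter_int_lin ler01 1 (uchi j) (ueta j)) mul1r addrK.
by rewrite -[X in _ --> X]subr0; exact: cvgB.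
Unshelve. all: by end_near. Qed.

Lemma sphere_int_ext g1 g2 : (forall xi : V, sphere xi -> g1 xi = g2 xi) ->
  sphere_integral g1 = sphere_integral g2.
Proof.
move=> g12; rewrite /sphere_integral /ball_integral; congr (_ * _).
by apply: iter_int_ext => s _ /=; rewrite g12 //; exact: theta_sphere.
Qed.

Lemma sphere_int_lin a g1 g2 : CS g1 -> CS g2 ->
  sphere_integral (fun xi : V => a * g1 xi + g2 xi) = a * sphere_integral g1 + sphere_integral g2.
Proof.
move=> c1 c2.
have [M1 M10 h1] := CS_bounded c1; have [M2 M20 h2] := CS_bounded c2.
have L := Scut_cvg (CS_lin (a := a) c1 c2).
apply: (cvg_unique (@Rhausdorff R) L).
have : a * (n.+1%:R * Scut j g1) + n.+1%:R * Scut j g2 @[j --> \oo] -->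
    a * sphere_integral g1 + sphere_integral g2.
  by apply: cvgD; [apply: cvgMr|]; exact: Scut_cvg.
apply: cvg_trans; apply: near_eq_cvg; near=> j.
rewrite /Scut mulrCA -mulrDr; congr (_ * _).
rewrite -(iter_int_lin ler01 a (cutoff_uc j c1 M10 h1) (cutoff_uc j c2 M20 h2)).
by apply: iter_int_ext => s _; ring.
Unshelve. all: by end_near. Qed.

Lemma sphere_int_ge0 g : (forall xi : V, sphere xi -> 0 <= g xi) -> 0 <= sphere_integral g.
Proof.
move=> g0; rewrite mulr_ge0 //; apply: iter_int_ge0 => s _ /=.
by rewrite mulr_ge0 ?indicE //; apply: g0; exact: theta_sphere.
Qed.

Lemma CS_cst (c : R) : CS (fun _ : V => c).
Proof. by apply: CS_of_continuous => x; exact: cont_cst. Qed.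

Lemma sphere_intZ a g : CS g -> sphere_integral (fun xi : V => a * g xi) = a * sphere_integral g.
Proof.
move=> cg; have := @sphere_int_lin (-1) _ _ (@CS_cst 0) (@CS_cst 0).
rewrite (@sphere_int_ext _ (fun _ : V => 0)) => [Z0|xi _]; last by rewrite mulr0 addr0.
have {}Z0 : sphere_integral (fun _ : V => 0 : R) = 0 :> R by move: Z0; rewrite mulN1r addNr.
rewrite -[RHS]addr0 -Z0 -sphere_int_lin //; last exact: CS_cst.
by apply: sphere_int_ext => xi _; rewrite addr0.
Qed.

Lemma sphere_intB g1 g2 : CS g1 -> CS g2 ->
  sphere_integral (fun xi : V => g1 xi - g2 xi) = sphere_integral g1 - sphere_integral g2.
Proof.
move=> c1 c2; rewrite -[X in _ - X]mul1r -mulNr addrC -sphere_int_lin //.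
by apply: sphere_int_ext => xi _; rewrite mulN1r addrC.
Qed.

Lemma sphere_int_le g1 g2 : CS g1 -> CS g2 -> (forall xi : V, sphere xi -> g1 xi <= g2 xi) ->
  sphere_integral g1 <= sphere_integral g2.
Proof.
move=> c1 c2 h; rewrite -subr_ge0 -sphere_intB //; apply: sphere_int_ge0 => xi /h.
by rewrite subr_ge0.
Qed.

Lemma CS_norm g : CS g -> CS (fun xi : V => `|g xi|).
Proof. by move=> /CSP cg; apply/CSP => xi Sxi; apply: cvg_norm; exact: cg. Qed.

Lemma sphere_int_norm_le g : CS g -> `|sphere_integral g| <= sphere_integral (fun xi : V => `|g xi|).
Proof.
move=> cg; have cn := CS_norm cg; rewrite ler_norml; apply/andP; split; last first.
  by apply: sphere_int_le => // xi _; exact: ler_norm.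
rewrite lerNl -mulN1r -sphere_intZ //; apply: sphere_int_le => //.
  have := CS_lin (a := -1) cg (@CS_cst 0); congr (CS _); apply/funext => xi; exact: addr0.
by move=> xi _; rewrite mulN1r -normrN ler_norm.
Qed.

Lemma sphere_int_bound g M : CS g -> (forall xi : V, sphere xi -> `|g xi| <= M) ->
  `|sphere_integral g| <= M * sphere_integral (fun _ : V => 1 : R).
Proof.
move=> cg gM; apply: (le_trans (sphere_int_norm_le cg)).
rewrite -sphere_intZ; last exact: CS_cst.
apply: sphere_int_le => [||xi /gM]; rewrite ?mulr1 //; first exact: CS_norm.
exact: CS_cst.
Qed.

Definition row_seq (a : V) : seq R := [seq a ord0 i | i <- enum 'I_n.+1].

Lemma size_row_seq a : size (row_seq a) = n.+1.
Proof. by rewrite size_map size_enum_ord. Qed.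

Lemma rowl_row_seq a : row (row_seq a) = a.
Proof.
apply/rowP => i; rewrite mxE (nth_map ord0) ?size_enum_ord //.
by rewrite nth_ord_enum.
Qed.

Lemma qn_rowl s : size s = n.+1 -> qn (row s) = sqs s.
Proof.
move=> ss; rewrite /sqs (big_nth 0) ss big_mkord /qn.
by apply: eq_bigr => i _; rewrite mxE.
Qed.

Lemma dotsE a s : size a = size s -> dots a s = \sum_(0 <= i < size s) nth 0 a i * nth (0 : R) s i.
Proof.
elim: a s => [|x a IH] [|y s] //=; first by rewrite big_geq.
by move=> [ss]; rewrite big_nat_recl //= IH.
Qed.

Lemma dot_rowl a s : size a = n.+1 -> size s = n.+1 -> dot (row a) (row s) = dots a s.
Proof.
move=> sa ss; rewrite dotsE ?sa // ss big_mkord /dot.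
by apply: eq_bigr => i _; rewrite !mxE.
Qed.

(** Rotating [a] amounts to rotating the integration variable, as the dot product and the cut-off in
    the norm are invariant. The integral is thus a rotation-invariant function of [a], so it depends
    on the norm of [a] only. *)
Lemma sphere_int_radial (phi : R -> R) (a b : V) : (0 < n)%N -> continuous phi -> qn a = qn b ->
  sphere_integral (fun xi => phi (dot a xi)) = sphere_integral (fun xi => phi (dot b xi)).
Proof.
move=> n0 cphi qab.
have cdot c : continuous (fun xi : V => phi (dot c xi)).
  move=> x; apply: (@cont_comp _ _ (dot c) phi); last exact: cphi.
  by apply: cont_sum => i; apply: contM; [exact: cont_cst|exact: coord_cont].
pose I j (c : seq R) := Scut j (fun xi => phi (dot (row c) xi)).
have HI j c d i s : c ^+ 2 + d ^+ 2 = 1 -> (i < n)%N -> size s = n.+1 ->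
    I j (rot_at c d i s) = I j s.
  move=> cd ni ss.
  (* Coordinates [i] and [i + 1] both exist because [i < n]. *)
  have [k nk] : exists k, n.+1 = (i + k.+2)%N.
    by exists (n - i.+1)%N; rewrite !addnS -addSn subnKC.
  have cg := CS_of_continuous (cdot (row (rot_at c d i s))).
  have [M M0 gM] := CS_bounded cg.
  have := cutoff_uc j cg M0 gM; rewrite /I /Scut => u.
  transitivity (iter_int n.+1 (fun s' => (fun s' => chi j (qn (row s')) *
     phi (dot (row (rot_at c d i s)) (theta (row s')))) (rot_at c d i s'))).
    have rot F M' : uc n.+1 1 M' F ->
        iter_int n.+1 (fun s => F (rot_at c d i s)) = iter_int n.+1 F.
      by rewrite nk => u'; exact: (iter_int_rot_at cd ler01 u').
    by rewrite (rot _ _ u).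
  apply: iter_int_ext => t st /=.
  have st' : size (rot_at c d i t) = n.+1 by rewrite size_rot_at.
  have ss' : size (rot_at c d i s) = n.+1 by rewrite size_rot_at.
  have qE : qn (row (rot_at c d i t)) = qn (row t) by rewrite !qn_rowl // sqs_rot_at.
  have [q0|q0] := eqVneq (qn (row t)) 0; first by rewrite qE q0 chi_le0 // !mul0r.
  have t0 : row t != 0 by apply: contra q0 => /eqP ->; rewrite qn0.
  have t0' : row (rot_at c d i t) != 0 by apply: contra q0 => /eqP E; rewrite -qE E qn0.
  rewrite qE /theta (negbTE t0) (negbTE t0') !dotZr !enormE qE.
  by rewrite !dot_rowl // dots_rot_at // ss st.
have rad j c : size c = n.+1 -> I j c = I j (Num.sqrt (sqs c) :: nseq n 0).
  move=> sc; apply: (@rot_invariant_radial R n (I j)) => // *; exact: HI.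
have La := Scut_cvg (CS_of_continuous (cdot a)).
have Lb := Scut_cvg (CS_of_continuous (cdot b)).
apply: (cvg_unique (@Rhausdorff R) La); apply: cvg_trans Lb; apply: near_eq_cvg; near=> j.
congr (_ * _).
have := rad j _ (size_row_seq a); have := rad j _ (size_row_seq b).
rewrite -!qn_rowl ?size_row_seq // !rowl_row_seq qab /I !rowl_row_seq => -> ->.
by [].
Unshelve. all: by end_near. Qed.

End SphereFunctional.

(** * Volume of the unit ball and area of the sphere *)

Section BallVolume.
Variable R : realType.
Local Notation mu := (@lebesgue_measure R).

(** Wallis integral: the quotient of the volumes of the unit balls of dimensions [m + 1] and [m]. *)
Definition wint (m : nat) : R := \int[mu]_(t in `[-1, 1]) ((1 - t ^+ 2) `^ (m%:R / 2)).

Lemma oneMsqr_ge0 (t : R) : -1 <= t <= 1 -> 0 <= 1 - t ^+ 2.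
Proof.
move=> /andP[t1 t2]; have -> : 1 - t ^+ 2 = (1 - t) * (1 + t) by ring.
by rewrite mulr_ge0 //; lra.
Qed.

Lemma oneMsqr_gt0 (t : R) : -1 < t < 1 -> 0 < 1 - t ^+ 2.
Proof.
move=> /andP[t1 t2]; have -> : 1 - t ^+ 2 = (1 - t) * (1 + t) by ring.
by rewrite mulr_gt0 //; lra.
Qed.

Lemma oneMsqr_powE m (t : R) : -1 <= t <= 1 -> (1 - t ^+ 2) `^ (m%:R / 2) = Num.sqrt (1 - t ^+ 2) ^+ m.
Proof.
move=> /oneMsqr_ge0 h.
by rewrite [m%:R / 2]mulrC powRrM powR12_sqrt // powR_mulrn // sqrtr_ge0.
Qed.

Lemma sqrt1_continuous : continuous (fun t : R => Num.sqrt (1 - t ^+ 2)).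
Proof.
move=> t; apply: (@cont_comp R R (fun t => 1 - t ^+ 2) (@Num.sqrt R)); last exact: sqrt_continuous.
apply: cvgB; first exact: cvg_cst.
exact: exprn_continuous.
Qed.

Lemma wintE m : wint m = \int[mu]_(t in `[-1, 1]) (Num.sqrt (1 - t ^+ 2) ^+ m).
Proof.
by apply: eq_Rintegral => t; rewrite inE /= in_itv /= => h; exact: oneMsqr_powE.
Qed.

Lemma sqrt1_integrable m : mu.-integrable `[-1, 1] (EFin \o (fun t : R => Num.sqrt (1 - t ^+ 2) ^+ m)).
Proof.
apply: continuous_compact_integrable; first exact: segment_compact.
apply: continuous_subspaceT => t; apply: (@contX R R (fun t => Num.sqrt (1 - t ^+ 2)) m t).
exact: sqrt1_continuous.
Qed.

Lemma is_derive_oneMsqr (t : R) : is_derive t 1 (fun t : R => 1 - t ^+ 2) (- (2 * t)).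
Proof.
apply: is_derive_eq => /=.
by rewrite ?expr1 /GRing.scale /=; ring.
Qed.

Lemma is_derive_sqrt1 (t : R) : -1 < t < 1 ->
  is_derive t 1 (fun t : R => Num.sqrt (1 - t ^+ 2)) (- t / Num.sqrt (1 - t ^+ 2)).
Proof.
move=> t1; have p := oneMsqr_gt0 t1.
have d := is_derive_oneMsqr t.
have ds := is_derive1_sqrt p.
apply: (is_derive_eq (is_derive1_comp (f := @Num.sqrt R) (g := fun t : R => 1 - t ^+ 2) ds d)).
rewrite /GRing.scale /=; field.
by rewrite gt_eqF // sqrtr_gt0.
Qed.

(* [d/dt (t w^(m+2)) = w^(m+2) - (m+2) t^2 w^m = (m+3) w^(m+2) - (m+2) w^m] for [w = sqrt (1 - t^2)]. *)
Lemma wint_rec m : m.+3%:R * wint m.+2 = m.+2%:R * wint m.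
Proof.
pose w (t : R) : R := Num.sqrt (1 - t ^+ 2).
have cw : continuous w by exact: sqrt1_continuous.
pose F (t : R) := t * w t ^+ m.+2.
pose f (t : R) : R := m.+3%:R * w t ^+ m.+2 - m.+2%:R * w t ^+ m.
have cwX k : continuous (fun t => w t ^+ k) by move=> t; exact: (@contX R R w k t (cw t)).
have cF : continuous F by move=> t; apply: (@contM R R id (fun t => w t ^+ m.+2) t); [exact: cvg_id|exact: cwX].
have dF (t : R) : -1 < t < 1 -> is_derive t 1 F (f t).
  move=> t1; have p := oneMsqr_gt0 t1.
  have dw : is_derive t 1 w (- t / w t) by exact: is_derive_sqrt1.
  have wp : 0 < w t by rewrite sqrtr_gt0.
  have w2 : w t ^+ 2 = 1 - t ^+ 2 by rewrite sqr_sqrtr // ltW.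
  have dX := derivX m.+1 dw.
  apply: (is_derive_eq (derivM (is_derive_id t 1) dX)).
  rewrite /f /GRing.scale /=.
  have -> : m.+3%:R = m.+2%:R + 1 :> R by rewrite natr1.
  move: (w t) wp w2 => u u0 u2.
  have e1 : u ^+ m.+1 / u = u ^+ m by rewrite exprSr mulfK // gt_eqF.
  have e2 : u ^+ m.+2 = (1 - t ^+ 2) * u ^+ m by rewrite -u2 -exprD.
  transitivity (- m.+2%:R * t ^+ 2 * (u ^+ m.+1 / u) + u ^+ m.+2).
    by field; rewrite gt_eqF.
  by rewrite e1 e2; ring.
have := @continuous_FTC2 R f F (-1) 1 ltac:(lra).
move=> ftc; have {}ftc : (\int[mu]_(t in `[(-1)%R, 1%R]) (f t)%:E = (F 1)%:E - (F (-1))%:E)%E.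
  apply: ftc.
  - apply: continuous_subspaceT => t.
    apply: (@contD R R (fun t => m.+3%:R * w t ^+ m.+2) (fun t => - (m.+2%:R * w t ^+ m)) t).
      by apply: (@contM R R (fun=> m.+3%:R)); [exact: cont_cst|exact: cwX].
    apply: (@cont_comp R R (fun t => m.+2%:R * w t ^+ m) (fun t => - t) t).
      by apply: (@contM R R (fun=> m.+2%:R) (fun t => w t ^+ m) t); [exact: cont_cst|exact: cwX].
    exact: opp_continuous.
  - split.
    + by move=> t; rewrite in_itv /= => /dF[].
    + by apply: cvg_at_right_filter; exact: cF.
    + by apply: cvg_at_left_filter; exact: cF.
  - by move=> t; rewrite in_itv /= derive1E => /dF[].
have Fe : F 1 = 0 /\ F (-1) = 0.
  by rewrite /F /w sqrrN !expr1n subrr sqrtr0 !expr0n /= !mulr0.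
rewrite Fe.1 Fe.2 in ftc.
have : \int[mu]_(t in `[-1, 1]) f t = 0 by rewrite /Rintegral ftc -EFinB subrr.
rewrite /f RintegralB //; last 2 first.
- rewrite (_ : EFin \o _ = (fun t => (m.+3%:R)%:E * (EFin \o (fun t : R => (w t ^+ m.+2)%R)) t)%E).
    by apply: integrableZl => //; exact: sqrt1_integrable.
  by apply/funext => t /=; rewrite EFinM.
- rewrite (_ : EFin \o _ = (fun t => (m.+2%:R)%:E * (EFin \o (fun t : R => (w t ^+ m)%R)) t)%E).
    by apply: integrableZl => //; exact: sqrt1_integrable.
  by apply/funext => t /=; rewrite EFinM.
rewrite !RintegralZl //; try exact: sqrt1_integrable.
by rewrite -!wintE => /eqP; rewrite subr_eq0 => /eqP.
Qed.

Lemma wint0 : wint 0 = 2.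
Proof.
rewrite wintE; transitivity (\int[mu]_(t in `[-1, 1]) (1 : R)).
  by apply: eq_Rintegral => t _; rewrite expr0.
rewrite Rintegral_cst; last exact: measurable_itv.
rewrite [X in fine X](lebesgue_measure_itv `[-1, 1]) /= lte_fin ifT /=; first by ring.
lra.
Qed.

Lemma wint1 : wint 1 = pi / 2.
Proof.
pose G (t : R) : R := Num.sqrt (1 - t ^+ 2).
have cG : continuous G by exact: sqrt1_continuous.
have p0 : 0 < pi / 2 :> R by rewrite divr_gt0 // pi_gt0.
have ds : derive1 (@sin R) = @cos R.
  by apply/funext => u; rewrite derive1E; have [_ ->] := is_derive_sin u.
have cc : continuous (@cos R) by exact: continuous_cos.
have sub := @integration_by_substitution_increasing R (@sin R) G (- (pi / 2)) (pi / 2).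
rewrite sinN sin_pihalf ds in sub.
have {}sub : (\int[mu]_(t in `[(-1)%R, 1%R]) (G t)%:E =
    \int[mu]_(u in `[(- (pi / 2))%R, (pi / 2)%R]) ((cos u) ^+ 2)%:E)%E.
  rewrite sub.
  - apply: eq_integral => u; rewrite inE /= in_itv /= => /andP[u1 u2]; congr (_%:E).
    have -> : ((G \o (@sin R)) * (@cos R)) u = G (sin u) * cos u by [].
    rewrite /G -cos2sin2 sqrtr_sqr ger0_norm ?expr2 //.
    by apply: cos_ge0_pihalf; rewrite u1.
  - lra.
  - by move=> x y xI yI xy; rewrite ltr_sin.
  - by move=> u _; exact: cc.
  - by apply/cvg_ex; exists (cos (- (pi / 2))); apply: cvg_at_right_filter; exact: cc.
  - by apply/cvg_ex; exists (cos (pi / 2)); apply: cvg_at_left_filter; exact: cc.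
  - split.
    + by move=> u _; have [] := is_derive_sin u.
    + by apply: cvg_at_right_filter; exact: continuous_sin.
    + by apply: cvg_at_left_filter; exact: continuous_sin.
  - exact: continuous_subspaceT.
pose F (u : R) : R := 2^-1 *: (u + sin u * cos u).
have dF (u : R) : is_derive u 1 F (cos u ^+ 2).
  have d1 := is_deriveD (is_derive_id u (1 : R)) (is_deriveM (is_derive_sin u) (is_derive_cos u)).
  apply: (is_derive_eq (is_deriveZ 2^-1 d1)).
  rewrite /GRing.scale /=.
  have e : sin u * sin u = 1 - cos u ^+ 2 by rewrite -expr2 sin2cos2.
  transitivity (2^-1 * (1 - sin u * sin u + cos u ^+ 2)); first by ring.
  by rewrite e; field.
have cF : continuous F.
  by move=> u; apply: differentiable_continuous; apply/derivable1_diffP; have [] := dF u.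
have ftc : (\int[mu]_(u in `[(- (pi / 2))%R, (pi / 2)%R]) ((cos u) ^+ 2)%:E = (F (pi / 2))%:E - (F (- (pi / 2)))%:E)%E.
  apply: continuous_FTC2.
  - lra.
  - by apply: continuous_subspaceT => u; exact: (@contX R R (@cos R) 2 u (cc u)).
  - split.
    + by move=> u _; have [] := dF u.
    + by apply: cvg_at_right_filter; exact: cF.
    + by apply: cvg_at_left_filter; exact: cF.
  - by move=> u _; rewrite derive1E; have [_ ->] := dF u.
rewrite wintE /Rintegral.
under eq_integral do rewrite expr1.
rewrite [X in fine X]sub ftc -EFinB /= /F cosN cos_pihalf !mulr0 !addr0 /GRing.scale /=.
by field.
Qed.

Fixpoint vol (m : nat) : R := if m is m'.+1 then vol m' * wint m' else 1.

Lemma Rintegral_ball_slice m (r : R) : 0 < r ->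
  \int[mu]_t (if t ^+ 2 < r ^+ 2 then Num.sqrt (1 - (t / r) ^+ 2) ^+ m else 0) = r * wint m.
Proof.
move=> r0; pose G (t : R) : R := Num.sqrt (1 - (t / r) ^+ 2) ^+ m.
have cG : continuous G.
  move=> t; apply: (@contX R R (fun t => Num.sqrt (1 - (t / r) ^+ 2)) m t).
  apply: (@cont_comp R R (fun t => t / r) (fun u => Num.sqrt (1 - u ^+ 2))); last exact: sqrt1_continuous.
  by apply: (@contM R R id (fun=> r^-1)); [exact: cvg_id|exact: cont_cst].
have iG : mu.-integrable `[-r, r] (EFin \o G).
  apply: continuous_compact_integrable; first exact: segment_compact.
  exact: continuous_subspaceT.
transitivity (\int[mu]_(t in `]-r, r[) G t).
  rewrite [RHS]Rintegral_mkcond; apply: eq_Rintegral => t _; rewrite patchE.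
  have -> : (t \in `]-r, r[%classic) = (t ^+ 2 < r ^+ 2); last by [].
  apply/idP/idP; rewrite inE /= in_itv /= -ltr_norml => h.
    by rewrite -[t ^+ 2]real_normK ?num_real // ltr_pXn2r // nnegrE // ltW.
  by rewrite -(@ltr_pXn2r _ 2) ?nnegrE ?(ltW r0) // real_normK ?num_real.
rewrite Rintegral_itv_obnd_cbnd; last first.
  by apply: integrableS iG => //; exact: subset_itv_oo_cc.
rewrite Rintegral_itv_bndo_bndc; last first.
  by apply: integrableS iG => //; exact: subset_itv_co_cc.
have D (t : R) : is_derive t (1 : R) (fun t => r * t) r.
  by apply: is_derive_eq; rewrite [r *: 1]mulr1.
have D1 : derive1 (fun t : R => r * t) = fun=> r.
  by apply/funext => t; rewrite derive1E; have [_ ->] := D t.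
have cr : continuous (fun t : R => r * t).
  by move=> t; apply: (@contM R R (fun=> r) id); [exact: cont_cst|exact: cvg_id].
have sub := @integration_by_substitution_increasing R (fun t => r * t) G (-1) 1.
rewrite mulrN1 mulr1 D1 in sub.
rewrite /Rintegral sub.
- rewrite wintE -RintegralZl //; last exact: sqrt1_integrable.
  rewrite /Rintegral; congr fine; apply: eq_integral => t _; congr (_%:E).
  have -> : ((G \o (fun t => r * t)) * (fun=> r)) t = G (r * t) * r by [].
  by rewrite /G [r * t]mulrC mulfK ?gt_eqF // mulrC.
- lra.
- by move=> x y _ _ xy; rewrite ltr_pM2l.
- by move=> x _; exact: cst_continuous.
- exact: is_cvg_cst.
- exact: is_cvg_cst.
- split.
  + by move=> x _; have [] := D x.
  + by apply: cvg_at_right_filter; exact: cr.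
  + by apply: cvg_at_left_filter; exact: cr.
- exact: continuous_subspaceT.
Qed.

(** The slice at height [t] is the ball of squared radius [c - t^2], which may be nonpositive; hence
    the statement for all real [c]. *)
Lemma iter_int_ball m (c : R) :
  iter_int m (fun s : seq R => (sqs s < c)%R%:R) = if 0 < c then vol m * Num.sqrt c ^+ m else 0.
Proof.
elim: m c => [|m IH] c /=.
  by rewrite /sqs big_nil mul1r expr0; case: ifP.
transitivity (\int[mu]_t (if t ^+ 2 < c then vol m * Num.sqrt (c - t ^+ 2) ^+ m else 0)).
  apply: eq_Rintegral => t _; rewrite -subr_gt0 -IH.
  by apply: iter_int_ext => s _; rewrite sqs_cons -ltrBrDl.
case: ifPn => [c0|]; last first.
  rewrite -leNgt => c0; transitivity (\int[mu]_(t in set0) (0 : R)); last exact: Rintegral_set0.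
  rewrite [RHS]Rintegral_mkcond; apply: eq_Rintegral => t _; rewrite patchE.
  rewrite ifF; first by case: ifP.
  by apply/negbTE; rewrite -leNgt (le_trans c0) // sqr_ge0.
set r := Num.sqrt c.
have r0 : 0 < r by rewrite sqrtr_gt0.
have rc : r ^+ 2 = c by rewrite sqr_sqrtr // ltW.
transitivity (\int[mu]_t (vol m * r ^+ m * (if t ^+ 2 < r ^+ 2 then Num.sqrt (1 - (t / r) ^+ 2) ^+ m else 0))).
  apply: eq_Rintegral => t _; rewrite rc; case: ifP => [tc|_]; last by rewrite mulr0.
  rewrite -mulrA -exprMn; congr (_ * _ ^+ _).
  rewrite -{1}(ger0_norm (ltW r0)) -sqrtr_sqr -sqrtrM ?sqr_ge0 //; congr Num.sqrt.
  rewrite -rc; field; by rewrite gt_eqF.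
have W0 : 0 <= wint m by apply: Rintegral_ge0 => t _; exact: powR_ge0.
rewrite RintegralZl //.
  by rewrite Rintegral_ball_slice // exprS; ring.
pose G (t : R) : R := Num.sqrt (1 - (t / r) ^+ 2) ^+ m.
have cG : continuous G.
  move=> t; apply: (@contX R R (fun t => Num.sqrt (1 - (t / r) ^+ 2)) m t).
  apply: (@cont_comp R R (fun t => t / r) (fun u => Num.sqrt (1 - u ^+ 2))); last exact: sqrt1_continuous.
  by apply: (@contM R R id (fun=> r^-1)); [exact: cvg_id|exact: cont_cst].
rewrite (_ : EFin \o _ = (EFin \o G) \_ `]-r, r[%classic); last first.
  apply/funext => t; rewrite patchE /=.
  have -> : (t \in `]-r, r[%classic) = (t ^+ 2 < r ^+ 2); last by case: ifP.
  apply/idP/idP; rewrite inE /= in_itv /= -ltr_norml => h.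
    by rewrite -[t ^+ 2]real_normK ?num_real // ltr_pXn2r // nnegrE // ltW.
  by rewrite -(@ltr_pXn2r _ 2) ?nnegrE ?(ltW r0) // real_normK ?num_real.
have [hi _] := integrable_mkcond (mu := mu) (EFin \o G) (measurable_itv `]-r, r[).
have iG : mu.-integrable `[-r, r] (EFin \o G).
  apply: continuous_compact_integrable; first exact: segment_compact.
  exact: continuous_subspaceT.
by apply: hi; apply: integrableS iG => //; exact: subset_itv_oo_cc.
Qed.

(** By [wint_rec] the left side does not change with [m]; the constant is read off at [m = 0]. *)
Lemma wint_prod m : m.+2%:R * (wint m * wint m.+1) = 2 * pi.
Proof.
elim: m => [|m IH]; first by rewrite wint0 wint1; field.
by rewrite mulrCA wint_rec mulrCA -IH; ring.
Qed.

(** Two dimensions at once multiply the volume by [2 pi / (m + 2)], so the recursion has step two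
    and the claim is proved for [m] and [m + 1] together. *)
Lemma vol_Gamma m : vol m * Gamma (m%:R / 2 + 1 : R) = pi `^ (m%:R / 2).
Proof.
have pp : 0 < pi :> R by exact: pi_gt0.
suff [] : vol m * Gamma (m%:R / 2 + 1 : R) = pi `^ (m%:R / 2) /\
          vol m.+1 * Gamma (m.+1%:R / 2 + 1 : R) = pi `^ (m.+1%:R / 2) by [].
elim: m => [|m [IH1 IH2]].
  rewrite /= wint0 !mul1r mul0r add0r (Gamma_nat R 0) powRr0; split => //.
  rewrite Gamma_rec ?invr_gt0 // Gamma_half mulrA divff // mul1r -powR12_sqrt ?ltW //.
split => //=.
have e : m.+2%:R / 2 = m%:R / 2 + 1 :> R by rewrite -!natr1; field.
have m0 : 0 < m%:R / 2 + 1 :> R by rewrite ltr_wpDl // divr_ge0.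
rewrite e (Gamma_rec m0) (powRD_gt0 _ _ pp) (powRr1 (ltW pp)) -IH1.
have := wint_prod m; have -> : m.+2%:R = 2 * (m%:R / 2 + 1) :> R by rewrite -e; field.
move: (Gamma _) (wint m) (wint m.+1) => g x y h.
have h' : (m%:R / 2 + 1) * (x * y) = pi.
  by apply: (@mulfI _ 2) => //; rewrite mulrA.
by rewrite -[in RHS]h'; ring.
Qed.

Lemma sphere_int_one n :
  sphere_integral (fun _ : 'rV[R]_n.+1 => 1) * Gamma (n.+1%:R / 2 : R) = 2 * pi `^ (n.+1%:R / 2) :> R.
Proof.
have -> : sphere_integral (fun _ : 'rV[R]_n.+1 => 1) = n.+1%:R * vol n.+1 :> R.
  congr (_ * _); have := iter_int_ball n.+1 1; rewrite ltr01 sqrtr1 expr1n mulr1 => <-.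
  apply: iter_int_ext => s ss /=; rewrite mulr1 indicE -(qn_rowl ss).
  suff -> : ((\row_i s`_i : 'rV[R]_n.+1) \in unit_ball) = (qn (rowl n.+1 s : 'rV[R]_n.+1) < 1) by [].
  by apply/idP/idP; rewrite inE => /unit_ballE.
have n0 : 0 < n.+1%:R / 2 :> R by rewrite divr_gt0.
have := vol_Gamma n.+1; rewrite (Gamma_rec n0) => <-.
by field.
Qed.

End BallVolume.

(** * Twice differentiable functions and solutions *)

Section C2Data.
Variables (R : realType) (n : nat).
Local Notation V := 'rV[R]_(n.+1).
Implicit Types (x xi : V) (u v : V -> V -> R) (g : 'I_n.+1 -> V -> V -> R)
  (H : 'I_n.+1 -> 'I_n.+1 -> V -> V -> R).

Definition jc u x xi := {for (x, xi), continuous (fun p : V * V => u p.1 p.2)}.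

(* [u x xi] is C^2 in [x] over [U], jointly continuously in the parameter [xi] of [X];
   [g i] and [H i j] are the derivatives [d_i u] and [d_j (d_i u)]. *)
Definition c2 (U X : set V) u g H := forall x xi, U x -> X xi ->
  [/\ jc u x xi,
      forall i, is_derive x (ecoord R i) (u ^~ xi) (g i x xi),
      forall i, jc (g i) x xi,
      forall i j, is_derive x (ecoord R j) (g i ^~ xi) (H i j x xi) &
      forall i j, jc (H i j) x xi].

Lemma jcD u v x xi : jc u x xi -> jc v x xi -> jc (fun x xi => u x xi + v x xi) x xi.
Proof. exact: contD. Qed.

Lemma jcM u v x xi : jc u x xi -> jc v x xi -> jc (fun x xi => u x xi * v x xi) x xi.
Proof. exact: contM. Qed.

Lemma jc_cst (c : R) x xi : jc (fun _ _ => c) x xi.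
Proof. exact: cont_cst. Qed.

Lemma jc_comp (h : R -> R) u x xi : jc u x xi -> {for u x xi, continuous h} ->
  jc (fun x xi => h (u x xi)) x xi.
Proof. by move=> cu ch; apply: (@cont_comp R _ (fun p : V * V => u p.1 p.2) h). Qed.

Lemma jc_fst (w : V -> R) x xi : {for x, continuous w} -> jc (fun x _ => w x) x xi.
Proof.
move=> cw; apply: (@continuous_comp (V * V)%type V R fst w); [exact: cvg_fst|exact: cw].
Qed.

Lemma jc_snd (w : V -> R) x xi : {for xi, continuous w} -> jc (fun _ xi => w xi) x xi.
Proof.
move=> cw; apply: (@continuous_comp (V * V)%type V R snd w); [exact: cvg_snd|exact: cw].
Qed.

Lemma jc_left u x xi : jc u x xi -> {for x, continuous (u ^~ xi)}.
Proof.
move=> cu; apply: (@continuous_comp V (V * V)%type R (fun y => (y, xi)) (fun p => u p.1 p.2)) => //.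
by apply: continuous_pair; [move=> A|exact: cst_continuous].
Qed.

Lemma jc_right u x xi : jc u x xi -> {for xi, continuous (u x)}.
Proof.
move=> cu; apply: (@continuous_comp V (V * V)%type R (fun y => (x, y)) (fun p => u p.1 p.2)) => //.
by apply: continuous_pair; [exact: cst_continuous|move=> A].
Qed.

Lemma deriv_cont (A : R -> R) (t a : R) : is_derive t 1 A a -> {for t, continuous A}.
Proof. by case=> d _; apply: differentiable_continuous; apply/derivable1_diffP. Qed.

Lemma ecoord_neq0 (i : 'I_n.+1) : ecoord R i != 0.
Proof.
by apply/eqP => /rowP /(_ i); rewrite !mxE !eqxx => /eqP; rewrite oner_eq0.
Qed.

Lemma deriv_coord i j x : is_derive x (ecoord R j) (fun y : V => y ord0 i) (i == j)%:R.
Proof.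
apply/deriv_line.
have -> : (fun h : R => (h *: ecoord R j + x) ord0 i) = fun h => h * (i == j)%:R + x ord0 i.
  by apply/funext => h; rewrite !mxE eqxx.
have d0 := @derivM R R id (fun=> (i == j)%:R) 0 1 _ _ (is_derive_id (0 : R) (1 : R)) (deriv_cst _ _ _).
apply: (is_derive_eq (derivD d0 (deriv_cst (x ord0 i) (0 : R) 1))).
by rewrite mulr0 add0r mulr1 addr0.
Qed.

Section Closure.
Variables U X : set V.

Lemma c2_cst (c : R) : c2 U X (fun _ _ => c) (fun _ _ _ => 0) (fun _ _ _ _ => 0).
Proof.
by move=> x xi _ _; split=> *; try exact: jc_cst; exact: deriv_cst.
Qed.

Lemma c2_coord k : c2 U X (fun x _ => x ord0 k) (fun i _ _ => (k == i)%:R) (fun _ _ _ _ => 0).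
Proof.
move=> x xi _ _; split=> *; try exact: jc_cst; try exact: deriv_cst.
  by apply: jc_fst; exact: coord_cont.
exact: deriv_coord.
Qed.

Lemma c2_param (w : V -> R) : (forall xi, X xi -> {for xi, continuous w}) ->
  c2 U X (fun _ xi => w xi) (fun _ _ _ => 0) (fun _ _ _ _ => 0).
Proof.
move=> cw x xi _ Xxi; split=> *; try exact: jc_cst; try exact: deriv_cst.
by apply: jc_snd; exact: cw.
Qed.

Lemma c2D u1 g1 H1 u2 g2 H2 : c2 U X u1 g1 H1 -> c2 U X u2 g2 H2 ->
  c2 U X (fun x xi => u1 x xi + u2 x xi) (fun i x xi => g1 i x xi + g2 i x xi)
    (fun i j x xi => H1 i j x xi + H2 i j x xi).
Proof.
move=> c1 c2 x xi Ux Xxi; have [p1 p2 p3 p4 p5] := c1 x xi Ux Xxi.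
have [q1 q2 q3 q4 q5] := c2 x xi Ux Xxi.
by split=> *; try exact: jcD; exact: derivD.
Qed.

Lemma c2M u1 g1 H1 u2 g2 H2 : c2 U X u1 g1 H1 -> c2 U X u2 g2 H2 ->
  c2 U X (fun x xi => u1 x xi * u2 x xi)
    (fun i x xi => u1 x xi * g2 i x xi + u2 x xi * g1 i x xi)
    (fun i j x xi => (u1 x xi * H2 i j x xi + g2 i x xi * g1 j x xi) +
                     (u2 x xi * H1 i j x xi + g1 i x xi * g2 j x xi)).
Proof.
move=> c1 c2 x xi Ux Xxi; have [p1 p2 p3 p4 p5] := c1 x xi Ux Xxi.
have [q1 q2 q3 q4 q5] := c2 x xi Ux Xxi.
split=> *; try (by do ?[apply: jcD|apply: jcM]).
  exact: derivM.
by apply: derivD; exact: derivM.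
Qed.

Lemma c2_comp (A A1 A2 : R -> R) u g H : c2 U X u g H ->
  (forall x xi, U x -> X xi -> [/\ is_derive (u x xi) 1 A (A1 (u x xi)),
     is_derive (u x xi) 1 A1 (A2 (u x xi)) & {for u x xi, continuous A2}]) ->
  c2 U X (fun x xi => A (u x xi)) (fun i x xi => A1 (u x xi) * g i x xi)
    (fun i j x xi => A1 (u x xi) * H i j x xi + g i x xi * (A2 (u x xi) * g j x xi)).
Proof.
move=> c hA x xi Ux Xxi; have [p1 p2 p3 p4 p5] := c x xi Ux Xxi.
have [d1 d2 cA2] := hA x xi Ux Xxi.
have j1 : jc (fun x xi => A1 (u x xi)) x xi by apply: jc_comp => //; exact: deriv_cont d2.
have j2 : jc (fun x xi => A2 (u x xi)) x xi by exact: jc_comp.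
split=> *; try (by do ?[apply: jcD|apply: jcM]).
- by apply: jc_comp => //; exact: deriv_cont d1.
- by apply: deriv_comp.
- by apply: derivM => //; exact: deriv_comp.
Qed.

Lemma c2_sum (I : Type) (r : seq I) (u : I -> V -> V -> R)
    (g : I -> 'I_n.+1 -> V -> V -> R) (H : I -> 'I_n.+1 -> 'I_n.+1 -> V -> V -> R) :
  (forall k, c2 U X (u k) (g k) (H k)) ->
  c2 U X (fun x xi => \sum_(k <- r) u k x xi) (fun i x xi => \sum_(k <- r) g k i x xi)
    (fun i j x xi => \sum_(k <- r) H k i j x xi).
Proof.
move=> c x xi Ux Xxi; split=> [|i|i|i j|i j].
- by apply: (@cont_sum R (V * V)%type I r (fun k p => u k p.1 p.2)) => k; have [] := c k x xi Ux Xxi.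
- by apply: deriv_sum => k; have [] := c k x xi Ux Xxi.
- by apply: (@cont_sum R (V * V)%type I r (fun k p => g k i p.1 p.2)) => k; have [_ _ h _ _] := c k x xi Ux Xxi; exact: h.
- by apply: deriv_sum => k; have [] := c k x xi Ux Xxi.
- by apply: (@cont_sum R (V * V)%type I r (fun k p => H k i j p.1 p.2)) => k; have [_ _ _ _ h] := c k x xi Ux Xxi; exact: h.
Qed.

Lemma c2_ext u g H u' g' H' : (forall x xi, u x xi = u' x xi) ->
  (forall i x xi, g i x xi = g' i x xi) -> (forall i j x xi, H i j x xi = H' i j x xi) ->
  c2 U X u g H -> c2 U X u' g' H'.
Proof.
move=> e1 e2 e3.
have -> : u = u' by apply/funext => x; apply/funext => xi; exact: e1.
have -> : g = g' by apply/funext => i; apply/funext => x; apply/funext => xi; exact: e2.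
have -> // : H = H'.
by apply/funext => i; apply/funext => j; apply/funext => x; apply/funext => xi; exact: e3.
Qed.

Lemma c2_dist :
  c2 U X (fun x xi => qn (x - xi)) (fun i x xi => 2 * (x ord0 i - xi ord0 i))
    (fun i j _ _ => 2 * (i == j)%:R).
Proof.
have c' : forall k, c2 U X (fun x xi => x ord0 k + - xi ord0 k) (fun i _ _ => (k == i)%:R + 0) (fun i j _ _ => 0 + 0).
  move=> k; apply: c2D (c2_coord k) (c2_param _) => xi _.
  by apply: (@cont_comp R V (fun y : V => y ord0 k) (fun t => - t) xi); [exact: coord_cont|exact: opp_continuous].
have c'' := c2_sum (index_enum 'I_n.+1) (fun k => c2M (c' k) (c' k)).
apply: c2_ext c'' => [x xi|i x xi|i j x xi].
- by rewrite /qn; apply: eq_bigr => k _; rewrite !mxE expr2.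
- rewrite (bigD1 i) //= big1 ?eqxx => [|k /negbTE ->]; first by rewrite ?mulr1n; ring.
  by rewrite ?mulr0n; ring.
- rewrite (bigD1 i) //= big1 ?eqxx => [|k /negbTE ->]; first by rewrite ?mulr1n; ring.
  by rewrite ?mulr0n; ring.
Qed.

Lemma c2_qn : c2 U X (fun x xi => qn x) (fun i x xi => 2 * x ord0 i)
    (fun i j _ _ => 2 * (i == j)%:R).
Proof.
have c'' := c2_sum (index_enum 'I_n.+1) (fun k => c2M (c2_coord k) (c2_coord k)).
apply: c2_ext c'' => [x xi|i x xi|i j x xi].
- by rewrite /qn; apply: eq_bigr => k _; rewrite expr2.
- rewrite (bigD1 i) //= big1 ?eqxx => [|k /negbTE ->]; first by rewrite ?mulr1n; ring.
  by rewrite ?mulr0n; ring.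
- rewrite (bigD1 i) //= big1 ?eqxx => [|k /negbTE ->]; first by rewrite ?mulr1n; ring.
  by rewrite ?mulr0n; ring.
Qed.

End Closure.

Lemma c2_sub U X U' X' u g H : U' `<=` U -> X' `<=` X -> c2 U X u g H -> c2 U' X' u g H.
Proof. by move=> sU sX c x xi /sU Ux /sX Xxi; exact: c. Qed.

Lemma c2_congr (U X : set V) u v g H : open U -> (forall x xi, U x -> u x xi = v x xi) ->
  c2 U X u g H -> c2 U X v g H.
Proof.
move=> oU uv c x xi Ux Xxi; have [c0 d1 c1 d2 cH] := c x xi Ux Xxi; split => //.
  apply: (@cont_near_eq _ _ (fun p : V * V => u p.1 p.2)) c0.
  have : \forall p \near (x, xi), U p.1 by exact: cvg_fst (open_nbhs_nbhs (conj oU Ux)).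
  by apply: filterS => -[y z] /= Uy; exact: uv.
move=> i; have e0 := ecoord_neq0 i; apply: near_eq_is_derive (d1 i) => //.
by have := open_nbhs_nbhs (conj oU Ux); apply: filterS => y Uy; rewrite uv.
Qed.

Lemma c2_of_C2_on (U X : set V) (w : V -> R) : C2_on U w ->
  c2 U X (fun x _ => w x) (fun i x _ => partial i w x) (fun i j x _ => partial j (partial i w) x).
Proof.
move=> C x xi Ux _; have [c0 C1] := C x Ux.
split.
- exact: jc_fst.
- by move=> i; have [d _] := C1 i i; split.
- by move=> i; apply: jc_fst; have [_ []] := C1 i i.
- by move=> i j; have [_ [_ [d _]]] := C1 i j; split.
- by move=> i j; apply: jc_fst; have [_ [_ []]] := C1 i j.
Qed.

Section FromData.
Variables (U X : set V) (u : V -> V -> R) (g : 'I_n.+1 -> V -> V -> R)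
  (H : 'I_n.+1 -> 'I_n.+1 -> V -> V -> R) (xi : V).
Hypotheses (oU : open U) (Xxi : X xi) (c : c2 U X u g H).

Lemma c2_partial i x : U x -> partial i (u ^~ xi) x = g i x xi.
Proof. by move=> Ux; have [_ d _ _ _] := c Ux Xxi; rewrite /partial; have [_ ->] := d i. Qed.

Lemma near_partial i x : U x -> \forall y \near x, partial i (u ^~ xi) y = g i y xi.
Proof.
move=> Ux; have := open_nbhs_nbhs (conj oU Ux).
by apply: filterS => y Uy; exact: c2_partial.
Qed.

Lemma c2_partial2 i j x : U x -> is_derive x (ecoord R j) (partial i (u ^~ xi)) (H i j x xi).
Proof.
move=> Ux; have [_ _ _ d _] := c Ux Xxi.
have e0 := ecoord_neq0 j; apply: near_eq_is_derive (d i j) => //.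
by apply: filterS (near_partial i Ux) => y ->.
Qed.

Lemma c2_C2_on : C2_on U (u ^~ xi).
Proof.
move=> x Ux; have [c0 d1 c1 d2 cH] := c Ux Xxi; split; first exact: jc_left.
move=> i j; split; first by have [] := d1 i.
split.
  apply: (@cont_near_eq _ _ (g i ^~ xi)); last exact: jc_left.
  by apply: filterS (near_partial i Ux) => y ->.
split; first by have [] := c2_partial2 i j Ux.
apply: (@cont_near_eq _ _ (H i j ^~ xi)); last exact: jc_left.
have := open_nbhs_nbhs (conj oU Ux).
by apply: filterS => y Uy; have [_] := c2_partial2 i j Uy; rewrite /partial => ->.
Qed.

Lemma c2_laplacian x : U x -> laplacian (u ^~ xi) x = \sum_i H i i x xi.
Proof.
by move=> Ux; apply: eq_bigr => i _; have [_] := c2_partial2 i i Ux; move=> e; exact: e.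
Qed.

Lemma c2_hyp_laplacian x : U x -> hyp_laplacian (u ^~ xi) x =
  (1 - qn x) / 4 * ((1 - qn x) * \sum_i H i i x xi
     + 2 * (n%:R - 1) * \sum_i x ord0 i * g i x xi).
Proof.
move=> Ux; rewrite /hyp_laplacian c2_laplacian // enorm_sqr.
congr (_ * (_ + _ * _)); apply: eq_bigr => i _; by rewrite c2_partial.
Qed.

End FromData.

End C2Data.

(** * One-variable profiles with two derivatives *)

Section ScalarC2.
Variable R : realType.
Implicit Types (A B : R -> R) (D : R -> Prop).

Definition d2 D A A1 A2 := forall t : R, D t ->
  [/\ is_derive t (1 : R) A (A1 t), is_derive t (1 : R) A1 (A2 t) & {for t, continuous A2}].

Lemma d2M D A A1 A2 B B1 B2 : d2 D A A1 A2 -> d2 D B B1 B2 ->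
  d2 D (fun t => A t * B t) (fun t => A t * B1 t + B t * A1 t)
    (fun t => (A t * B2 t + B1 t * A1 t) + (B t * A2 t + A1 t * B1 t)).
Proof.
move=> dA dB t Dt; have [p1 p2 p3] := dA t Dt; have [q1 q2 q3] := dB t Dt.
have cA := deriv_cont p1; have cA1 := deriv_cont p2.
have cB := deriv_cont q1; have cB1 := deriv_cont q2.
split; first exact: derivM.
  by apply: derivD; exact: derivM.
apply: (@contD R R (fun t => A t * B2 t + B1 t * A1 t) (fun t => B t * A2 t + A1 t * B1 t) t).
  by apply: (@contD R R (fun t => A t * B2 t) (fun t => B1 t * A1 t) t); exact: contM.
by apply: (@contD R R (fun t => B t * A2 t) (fun t => A1 t * B1 t) t); exact: contM.
Qed.

Lemma deriv_powR (a t : R) : 0 < t -> is_derive t (1 : R) (fun y : R => y `^ a) (a * t `^ (a - 1)).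
Proof. exact: is_derive1_powR. Qed.

Lemma deriv_powR_scaled (a k t : R) : 0 < t ->
  is_derive t (1 : R) (fun y : R => k * y `^ a) (k * (a * t `^ (a - 1))).
Proof.
move=> t0.
apply: (is_derive_eq (@derivM R R (fun=> k) (fun y : R => y `^ a) t 1 _ _ (deriv_cst k t 1) (deriv_powR a t0))).
by rewrite mulr0 addr0.
Qed.

Lemma d2_powR a : d2 (fun t => 0 < t) (fun t => t `^ a) (fun t => a * t `^ (a - 1))
  (fun t => a * ((a - 1) * t `^ (a - 1 - 1))).
Proof.
move=> t t0; split; [exact: deriv_powR|exact: deriv_powR_scaled|].
apply: (@contM R R (fun=> a)); first exact: cont_cst.
apply: (@contM R R (fun=> a - 1)); first exact: cont_cst.
exact: powR_continuous.
Qed.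

Lemma d2_affine D A A1 A2 (m k : R) : d2 D A A1 A2 ->
  d2 (fun t => D (k + m * t)) (fun t => A (k + m * t)) (fun t => A1 (k + m * t) * m)
    (fun t => A2 (k + m * t) * m * m).
Proof.
move=> dA t Dt; have [p1 p2 p3] := dA _ Dt.
have da : is_derive t (1 : R) (fun t => k + m * t) m.
  have d0 := @derivM R R (fun=> m) id t 1 _ _ (deriv_cst m t 1) (is_derive_id (t : R) (1 : R)).
  apply: (is_derive_eq (derivD (deriv_cst k t (1 : R)) d0)).
  by rewrite mulr1 mulr0 addr0 add0r.
split; first exact: (deriv_comp da p1).
  apply: (is_derive_eq (@derivM R R (fun t => A1 (k + m * t)) (fun=> m) t 1 _ _ (deriv_comp da p2) (deriv_cst m t 1))).
  by rewrite mulr0 add0r mulrC.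
apply: (@contM R R (fun t => A2 (k + m * t) * m) (fun=> m)); last exact: cont_cst.
apply: (@contM R R (fun t => A2 (k + m * t)) (fun=> m)); last exact: cont_cst.
by apply: (@cont_comp R R (fun t => k + m * t) A2) => //; exact: deriv_cont da.
Qed.

(** At [t = |x|^2] this is [rho0^b]; the base is written in the shape that [d2_affine] expects. *)
Definition rpow (b t : R) : R := (2^-1 + (- 2^-1) * t) `^ b.
Definition rpow1 (b t : R) := b * (2^-1 + (- 2^-1) * t) `^ (b - 1) * (- 2^-1).
Definition rpow2 (b t : R) := b * ((b - 1) * (2^-1 + (- 2^-1) * t) `^ (b - 1 - 1)) * (- 2^-1) * (- 2^-1).

Lemma d2_rpow b : d2 (fun t => `|t| < 1) (rpow b) (rpow1 b) (rpow2 b).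
Proof.
move=> t t1; have := (@d2_affine _ _ _ _ (- 2^-1) (2^-1) (d2_powR b)) t; apply.
by move: t1; rewrite ltr_norml => /andP[]; lra.
Qed.

Lemma powR_sub1 (b x : R) : 0 < x -> x `^ (b - 1) = x `^ b / x.
Proof. by move=> x0; rewrite powRD_gt0 // powR_inv1 // ltW. Qed.

Lemma rpow1E b t : t < 1 -> rpow1 b t = - b * rpow b t / (1 - t).
Proof.
move=> t1; have p0 : 0 < 2^-1 + (- 2^-1) * t by lra.
rewrite /rpow1 /rpow powR_sub1 //.
by move: (_ `^ _) => E; field; lra.
Qed.

Lemma rpow2E b t : t < 1 -> rpow2 b t = b * (b - 1) * rpow b t / (1 - t) ^+ 2.
Proof.
move=> t1; have p0 : 0 < 2^-1 + (- 2^-1) * t by lra.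
rewrite /rpow2 /rpow !powR_sub1 //.
by move: (_ `^ _) => E; field; lra.
Qed.

End ScalarC2.

(** * The equation on explicit derivatives, and separation of variables *)

Section Solutions.
Variables (R : realType) (n : nat).
Local Notation V := 'rV[R]_(n.+1).
Implicit Types (x xi : V) (U X : set V).

(** The operator [Delta_+ + s (n - s)] on a value, a gradient and a Hessian given as numbers. The
    sign is opposite to that of the problem, so supersolutions are those with [Lop < 0]. *)
Definition Lop (s : R) x (u : R) (g : 'I_n.+1 -> R) (H : 'I_n.+1 -> 'I_n.+1 -> R) : R :=
  (1 - qn x) / 4 * ((1 - qn x) * \sum_i H i i + 2 * (n%:R - 1) * \sum_i x ord0 i * g i)
  + s * (n%:R - s) * u.

Lemma Lop_lin s x (a b : R) u1 g1 H1 u2 g2 H2 :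
  Lop s x (a * u1 + b * u2) (fun i => a * g1 i + b * g2 i) (fun i j => a * H1 i j + b * H2 i j)
  = a * Lop s x u1 g1 H1 + b * Lop s x u2 g2 H2.
Proof.
rewrite /Lop big_split /= -!mulr_sumr.
have -> : \sum_i x ord0 i * (a * g1 i + b * g2 i) =
  a * (\sum_i x ord0 i * g1 i) + b * (\sum_i x ord0 i * g2 i).
  by rewrite !mulr_sumr -big_split; apply: eq_bigr => i _ /=; ring.
by ring.
Qed.

Lemma c2_lin U X (a b : R) (u1 : V -> V -> R) g1 H1 u2 g2 H2 : c2 U X u1 g1 H1 -> c2 U X u2 g2 H2 ->
  c2 U X (fun x xi => a * u1 x xi + b * u2 x xi)
    (fun i x xi => a * g1 i x xi + b * g2 i x xi)
    (fun i j x xi => a * H1 i j x xi + b * H2 i j x xi).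
Proof.
move=> c1 c2; have := c2D (c2M (@c2_cst R n U X a) c1) (c2M (@c2_cst R n U X b) c2).
by apply: c2_ext => *; ring.
Qed.

(** [X] is the sphere for the Poisson kernel, and [setT] for a function of [x] alone, seen as
    constant in [xi]; one calculus serves both. *)
Definition sol s U X u := exists g H, c2 U X u g H /\ forall x xi, U x -> X xi ->
  Lop s x (u x xi) (fun i => g i x xi) (fun i j => H i j x xi) = 0.

Lemma sol_lin s U X (a b : R) u1 u2 : sol s U X u1 -> sol s U X u2 ->
  sol s U X (fun x xi => a * u1 x xi + b * u2 x xi).
Proof.
move=> [g1 [H1 [c1 e1]]] [g2 [H2 [c2 e2]]]; do 2 eexists; split; first exact: (c2_lin a b c1 c2).
by move=> x xi Ux Xxi; rewrite Lop_lin e1 // e2 // !mulr0 addr0.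
Qed.

Lemma sol_congr s U X u v : open U -> (forall x xi, U x -> u x xi = v x xi) ->
  sol s U X u -> sol s U X v.
Proof.
move=> oU uv [g [H [c e]]]; exists g, H; split; first exact: (c2_congr oU uv c).
by move=> x xi Ux Xxi; rewrite -uv //; exact: e.
Qed.

Lemma sol_of_problem (s : R) U (w : V -> R) : C2_on U w ->
  (forall x, U x -> - hyp_laplacian w x - s * (n%:R - s) * w x = 0) ->
  sol s U setT (fun x _ => w x).
Proof.
move=> C e; have c := @c2_of_C2_on R n U setT w C; do 2 eexists; split; first exact: c.
move=> x xi Ux _; have := e x Ux; rewrite /Lop /hyp_laplacian enorm_sqr /laplacian.
by move: (_ / 4 * _) (s * _ * _) => a b /eqP; rewrite subr_eq0 => /eqP <-; ring.
Qed.

Lemma problem_of_sol s U X (u : V -> V -> R) xi : open U -> X xi -> sol s U X u ->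
  C2_on U (u ^~ xi) /\
  (forall x, U x -> - hyp_laplacian (u ^~ xi) x - s * (n%:R - s) * u x xi = 0).
Proof.
move=> oU Xxi [g [H [c e]]]; split; first exact: (c2_C2_on oU Xxi c).
move=> x Ux; rewrite (c2_hyp_laplacian oU Xxi c) //; have := e x xi Ux Xxi; rewrite /Lop.
by move: (_ / 4 * _) (s * _ * _) => a b /eqP; rewrite addr_eq0 => /eqP ->; ring.
Qed.

Definition ball1 : set V := [set x | qn x < 1].

Lemma ball1_open : open ball1.
Proof. by apply: (@open_comp _ _ (@qn R n) [set t | t < 1]); [move=> x _; exact: qn_continuous|exact: open_lt]. Qed.

Lemma qn_norm x : ball1 x -> `|qn x| < 1.
Proof. by rewrite /ball1 /= ger0_norm // qn_ge0. Qed.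

(** Homogeneity of degree [l] in the form of Euler's identity, which is what separation of variables
    consumes and which passes from coordinates to products and sums. *)
Definition hom (l : nat) (P : V -> V -> R) := exists g H, c2 setT setT P g H /\
  forall x xi, \sum_i x ord0 i * g i x xi = l%:R * P x xi.

Lemma hom_cst (c : R) : hom 0 (fun _ _ => c).
Proof.
do 2 eexists; split; first exact: c2_cst.
by move=> x xi; rewrite big1 ?mul0r // => i _; rewrite mulr0.
Qed.

Lemma hom_coord k : hom 1 (fun x _ => x ord0 k).
Proof.
do 2 eexists; split; first exact: c2_coord.
move=> x xi; rewrite (bigD1 k) //= big1 ?eqxx ?mulr1 ?addr0 ?mul1r //.
by move=> i /negbTE; rewrite eq_sym => ->; rewrite mulr0.
Qed.

Lemma homM l m P Q : hom l P -> hom m Q -> hom (l + m) (fun x xi => P x xi * Q x xi).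
Proof.
move=> [g [H [c e]]] [g' [H' [c' e']]]; do 2 eexists; split; first exact: (c2M c c').
move=> x xi; rewrite natrD mulrDl.
have -> : l%:R * (P x xi * Q x xi) = Q x xi * (l%:R * P x xi) by ring.
have -> : m%:R * (P x xi * Q x xi) = P x xi * (m%:R * Q x xi) by ring.
by rewrite -e -e' !mulr_sumr -big_split /=; apply: eq_bigr => i _; ring.
Qed.

Lemma hom_prod l (k : 'I_l -> 'I_n.+1) : hom l (fun x _ => \prod_(j < l) x ord0 (k j)).
Proof.
elim: l k => [|l IH] k.
  rewrite (_ : (fun x _ => _) = fun _ _ => 1); first exact: hom_cst.
  by apply/funext => x; apply/funext => _; rewrite big_ord0.
rewrite (_ : (fun x _ => _) = fun x _ => x ord0 (k ord0) * \prod_(j < l) x ord0 (k (lift ord0 j))).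
  exact: homM (hom_coord _) (IH _).
by apply/funext => x; apply/funext => _; rewrite big_ord_recl.
Qed.

Lemma hom_sum l (I : Type) (r : seq I) (P : I -> V -> V -> R) : (forall k, hom l (P k)) ->
  hom l (fun x xi => \sum_(k <- r) P k x xi).
Proof.
move=> h; have [g hg] := choice h; have [H hH] := choice hg.
do 2 eexists; split; first exact: (c2_sum r (fun k => (hH k).1)).
move=> x xi; rewrite mulr_sumr.
under [RHS]eq_bigr => k _ do rewrite -(hH k).2.
by rewrite exchange_big; apply: eq_bigr => i _ /=; rewrite mulr_sumr.
Qed.

Lemma hom_poly l (P : V -> R) : homog_poly l P -> hom l (fun x _ => P x).
Proof.
move=> [c hc]; rewrite (_ : (fun x _ => P x) = fun x _ => \sum_k c k * \prod_(j < l) x ord0 (k j)).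
  by apply: hom_sum => k; exact: homM (hom_cst (c k)) (hom_prod k).
by apply/funext => x; apply/funext => _; exact: hc.
Qed.

(** In the Laplacian of [A(|x|^2) P] the term with the Laplacian of [P] vanishes, and the cross term
    is [4 l A' P] by Euler's identity. [P] factors out, leaving an ordinary differential operator in
    [|x|^2]. *)
Lemma radial_data s l (P : V -> R) (A A1 A2 : R -> R) : d2 (fun t => `|t| < 1) A A1 A2 ->
  homog_poly l P -> (forall x, laplacian P x = 0) ->
  exists g H, c2 ball1 setT (fun x _ => A (qn x) * P x) g H /\ forall x xi, ball1 x ->
    Lop s x (A (qn x) * P x) (fun i => g i x xi) (fun i j => H i j x xi) =
    P x * ((1 - qn x) / 4 * ((1 - qn x) * (4 * qn x * A2 (qn x) + (2 * n.+1%:R + 4 * l%:R) * A1 (qn x))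
      + 2 * (n%:R - 1) * (l%:R * A (qn x) + 2 * qn x * A1 (qn x))) + s * (n%:R - s) * A (qn x)).
Proof.
move=> dA hP lP; have [g [H [c e]]] := hom_poly hP.
have cA : c2 ball1 setT (fun x xi => A (qn x)) (fun i x xi => A1 (qn x) * (2 * x ord0 i))
  (fun i j x xi => A1 (qn x) * (2 * (i == j)%:R) + 2 * x ord0 i * (A2 (qn x) * (2 * x ord0 j))).
  by apply: (@c2_comp R n ball1 setT A A1 A2 _ _ _ (@c2_qn R n ball1 setT)) => x xi Bx _; apply: dA; exact: qn_norm.
have cP : c2 ball1 setT (fun x _ => P x) g H by apply: c2_sub c.
do 2 eexists; split; first exact: (c2M cA cP).
move=> x xi Bx; have := lP x.
rewrite (c2_laplacian openT (I : setT xi) c) // => l0.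
have e0 := e x xi.
rewrite /Lop.
have -> : \sum_i x ord0 i * (A (qn x) * g i x xi + P x * (A1 (qn x) * (2 * x ord0 i))) =
  A (qn x) * (l%:R * P x) + P x * A1 (qn x) * 2 * qn x.
  by rewrite -e0 /qn !mulr_sumr -big_split; apply: eq_bigr => i _ /=; ring.
have -> : \sum_i (A (qn x) * H i i x xi + g i x xi * (A1 (qn x) * (2 * x ord0 i)) +
     (P x * (A1 (qn x) * (2 * (i == i)%:R) + 2 * x ord0 i * (A2 (qn x) * (2 * x ord0 i))) +
      A1 (qn x) * (2 * x ord0 i) * g i x xi)) =
  A (qn x) * 0 + 4 * A1 (qn x) * (l%:R * P x) + P x * (A1 (qn x) * (2 * n.+1%:R) + 4 * A2 (qn x) * qn x).
  have Hn : \sum_(i < n.+1) (1 : R) = n.+1%:R by rewrite sumr_const card_ord.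
  rewrite (eq_bigr (fun i => A (qn x) * H i i x xi + 4 * A1 (qn x) * (x ord0 i * g i x xi) +
    (2 * P x * A1 (qn x) * 1 + 4 * P x * A2 (qn x) * x ord0 i ^+ 2))); last first.
    by move=> i _; rewrite eqxx mulr1n; ring.
  by rewrite !big_split /= -!mulr_sumr l0 e0 Hn -/(qn x); ring.
by ring.
Qed.

End Solutions.

(** * Hypergeometric solutions, the supersolution and the Poisson kernel *)

Section SpecialSolutions.
Variables (R : realType) (n : nat).
Local Notation V := 'rV[R]_(n.+1).
Implicit Types (x xi : V).
Variable gamma : R.
Hypothesis gamma0 : 0 < gamma.
Let s : R := n%:R / 2 + gamma.

Lemma one_homog_poly : homog_poly 0 (fun _ : V => 1).
Proof.
exists (fun=> 1) => x; under eq_bigr do rewrite big_ord0.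
by rewrite sumr_const card_ffun !card_ord expn0 mulr1.
Qed.

Lemma one_harmonic x : laplacian (fun _ : V => 1) x = 0.
Proof.
rewrite (@c2_laplacian R n setT setT (fun _ _ => 1) _ _ x openT I (c2_cst 1)) //.
by rewrite big1.
Qed.

Definition hsol (l : nat) (t : R) : R := rpow (n%:R - s) t *
  hyp2F1 (l%:R + n%:R / 2 - gamma) (1 / 2 - gamma) (l%:R + (n%:R + 1) / 2) t.

Lemma hsol_sol l (P : V -> R) : homog_poly l P -> (forall x, laplacian P x = 0) ->
  sol s (@ball1 R n) setT (fun x _ => hsol l (qn x) * P x).
Proof.
move=> hP lP; rewrite /hsol.
set a := l%:R + n%:R / 2 - gamma; set b := 1 / 2 - gamma; set c := l%:R + (n%:R + 1) / 2.
have l0 : 0 <= l%:R :> R by [].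
have n0 : 0 <= n%:R :> R by [].
have c0 : 0 < c by rewrite /c; lra.
have d0 : 0 < c - a - b.
  have -> : c - a - b = 2 * gamma by rewrite /c /a /b; field.
  by rewrite mulr_gt0.
have dF : d2 (fun t => `|t| < 1) (hyp2F1 a b c) (hyp1 a b c) (hyp2 a b c).
  by move=> t t1; split; [exact: hyp_derive|exact: hyp1_derive|exact: hyp2_continuous].
have [g [H [cH e]]] := radial_data s (d2M (d2_rpow (n%:R - s)) dF) hP lP.
exists g, H; split => // x xi Bx _; rewrite e //.
have q1 : qn x < 1 by [].
have := hyp_ode c0 d0 (qn_norm Bx).
rewrite (rpow1E _ q1) (rpow2E _ q1).
move: (hyp2F1 a b c _) (hyp1 a b c _) (hyp2 a b c _) (rpow _ _) (P x) => F F1 F2 E p ode.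
rewrite -[n.+1%:R]natr1.
have q1' : 1 - qn x != 0 by rewrite gt_eqF //; lra.
(* The factor [1 - |x|^2] comes out because [n - s] is a root of the indicial polynomial; what
   remains is the hypergeometric equation, and this fixes [a], [b] and [c]. *)
transitivity (p * ((1 - qn x) * E * (qn x * (1 - qn x) * F2 + (c - (a + b + 1) * qn x) * F1 - a * b * F))).
  by rewrite /a /b /c /s; field.
by rewrite ode !mulr0.
Qed.

Lemma rpow_super : exists g H, c2 (@ball1 R n) setT (fun x _ => rpow (n%:R / 2) (qn x)) g H /\
  forall x xi, ball1 x -> Lop s x (rpow (n%:R / 2) (qn x)) (fun i => g i x xi) (fun i j => H i j x xi) < 0.
Proof.
have [g [H [cH e]]] := radial_data s (d2_rpow (n%:R / 2)) one_homog_poly one_harmonic.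
exists g, H; split; first by apply: c2_ext cH => *; rewrite ?mulr1.
move=> x xi Bx; have := e x xi Bx; rewrite mulr1 => ->.
have q1 : qn x < 1 by [].
rewrite (rpow1E _ q1) (rpow2E _ q1) -[n.+1%:R]natr1.
have E0 : 0 < rpow (n%:R / 2) (qn x) by rewrite /rpow powR_gt0 //; lra.
move: (rpow _ _) E0 => E E0.
have q1' : 1 - qn x != 0 by rewrite gt_eqF //; lra.
(* [- gamma^2] is the indicial polynomial at its vertex [n/2]; the other term is the correction
   inside the ball and has the same sign. *)
rewrite [ltLHS](_ : _ = - (E * (gamma ^+ 2 + n%:R * (1 - qn x) / 4))); last by rewrite /s; field.
rewrite oppr_lt0 mulr_gt0 //; apply: ltr_pwDl; first by rewrite exprn_gt0.
by rewrite divr_ge0 // mulr_ge0 //; lra.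
Qed.

Definition pker x xi : R := ((1 - qn x) / qn (x - xi)) `^ s.

Lemma ball_sphere_dist x xi : ball1 x -> sphere xi -> 0 < qn (x - xi).
Proof.
move=> Bx /sphereE Sxi; apply: qn_gt0; apply/eqP => /subr0_eq h.
by move: Bx; rewrite /ball1 /= h Sxi ltxx.
Qed.

Lemma pker_gt0 x xi : ball1 x -> sphere xi -> 0 < pker x xi.
Proof.
move=> Bx Sxi; rewrite /pker powR_gt0 // divr_gt0 ?ball_sphere_dist //.
by move: Bx; rewrite /ball1 /=; lra.
Qed.

Lemma pkerE x xi : ball1 x -> (1 + (-1) * qn x) `^ s * qn (x - xi) `^ (- s) = pker x xi.
Proof.
move=> Bx; have q1 : qn x < 1 by [].
rewrite /pker powRM ?invr_ge0 ?qn_ge0 //; last by lra.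
have -> : 1 + -1 * qn x = 1 - qn x by ring.
congr (_ * _); rewrite -powR_inv1 ?qn_ge0 // -powRrM; congr (_ `^ _); ring.
Qed.

Lemma dot_diff x xi : sphere xi ->
  \sum_i (x ord0 i - xi ord0 i) * x ord0 i = (qn x - 1 + qn (x - xi)) / 2.
Proof.
move=> /sphereE Sxi; rewrite qnB Sxi.
rewrite [LHS](_ : _ = qn x - dot x xi); first by field.
by rewrite /qn /dot -sumrB; apply: eq_bigr => i _; ring.
Qed.

(** As a product of powers of [1 - |x|^2] and [|x - xi|^2], the kernel has derivatives whose sums
    involve these two quantities only, once [|xi| = 1] is used in [dot_diff]. The remaining rational
    identity holds for every exponent. *)
Lemma pker_sol : sol s (@ball1 R n) sphere pker.
Proof.
apply: (sol_congr (@ball1_open R n) pkerE).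
have hA := @d2_affine R _ _ _ _ (-1) 1 (d2_powR s).
have pA x xi : ball1 x -> sphere xi -> 0 < 1 + -1 * qn x by rewrite /ball1 /= => *; lra.
have cA := c2_comp (@c2_qn R n (@ball1 R n) sphere) (fun x xi Bx Sx => hA (qn x) (pA x xi Bx Sx)).
have cB := c2_comp (@c2_dist R n (@ball1 R n) sphere)
  (fun x xi Bx Sx => d2_powR (- s) (ball_sphere_dist Bx Sx)).
do 2 eexists; split; first exact: (c2M cA cB).
move=> x xi Bx Sxi; have D0 := ball_sphere_dist Bx Sxi.
have q1 : qn x < 1 by [].
have p0 : 0 < 1 + -1 * qn x by lra.
rewrite !(powR_sub1 _ p0) !(powR_sub1 _ D0) /Lop.
have hD := dot_diff x Sxi.
move: (_ `^ s) (_ `^ (- s)) => A B.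
set q := qn x in hD *; set D := qn (x - xi) in hD *.
have Hq : \sum_i x ord0 i * x ord0 i = q by rewrite /q /qn; apply: eq_bigr => i _; rewrite expr2.
have HD : \sum_i (x ord0 i - xi ord0 i) * (x ord0 i - xi ord0 i) = D.
  by rewrite /D /qn; apply: eq_bigr => i _; rewrite !mxE expr2.
have Hn : \sum_(i < n.+1) (1 : R) = n%:R + 1 by rewrite sumr_const card_ord natr1.
pose e1 := - s * (B / D) * 2; pose e2 := s * (A / (1 + -1 * q)) * -1 * 2.
rewrite [\sum_i x ord0 i * (_ + _)](eq_bigr (fun i => A * e1 * ((x ord0 i - xi ord0 i) * x ord0 i) + B * e2 * (x ord0 i * x ord0 i))); last first.
  by move=> i _; rewrite /e1 /e2; ring.
pose c1 := A * e1 + B * e2.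
pose c2 := A * (- s * ((- s - 1) * (B / D / D))) * 4.
pose c3 := B * (s * ((s - 1) * (A / (1 + -1 * q) / (1 + -1 * q))) * -1 * -1) * 4.
rewrite [\sum_i (_ + _ + _)](eq_bigr (fun i => c1 * 1 + c2 * ((x ord0 i - xi ord0 i) * (x ord0 i - xi ord0 i))
  + c3 * (x ord0 i * x ord0 i) + 2 * e1 * e2 * ((x ord0 i - xi ord0 i) * x ord0 i))); last first.
  by move=> i _; rewrite eqxx mulr1n /c1 /c2 /c3 /e1 /e2; ring.
rewrite !big_split /= -!mulr_sumr Hq HD Hn hD /c1 /c2 /c3 /e1 /e2.
have D0' : D != 0 by rewrite gt_eqF.
have p0' : 1 + -1 * q != 0 by rewrite gt_eqF.
rewrite [s * (n%:R - s)](_ : _ = s * (2 * (n%:R / 2) - s)); last by congr (_ * _); lra.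
by move: s => z; field; rewrite p0' D0'.
Qed.

End SpecialSolutions.

(** * The maximum principle *)

Section MaximumPrinciple.
Variables (R : realType) (n : nat).
Local Notation V := 'rV[R]_(n.+1).
Implicit Types (x xi : V).

Lemma deriv_line_at (W : normedModType R) (f : W -> R) (x v : W) (t df : R) :
  is_derive (t *: v + x) v f df -> is_derive t (1 : R) (fun h => f (h *: v + x)) df.
Proof.
have E : (fun h : R => h^-1 *: ((f \o shift (t *: v + x)) (h *: v) - f (t *: v + x))) =
  (fun h : R => h^-1 *: (((fun h => f (h *: v + x)) \o shift t) (h *: (1 : R)) - f (t *: v + x))).
  by apply/funext => h /=; rewrite [h *: 1]mulr1 scalerDl addrA.
by case=> d1 d2; split; [rewrite /derivable -E|rewrite /derive -E].
Qed.

Lemma near_line (W : normedModType R) (x v : W) (P : W -> Prop) : (\forall y \near x, P y) ->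
  exists2 d : R, 0 < d & forall t : R, `|t| < d -> P (t *: v + x).
Proof.
move=> Px.
have c : {for (0 : R), continuous (fun t : R => t *: v + x)}.
  apply: cvgD; last exact: cvg_cst.
  by apply: cvgZr_tmp; exact: cvg_id.
have : \forall t \near (0 : R), P (t *: v + x).
  by apply: c; rewrite scale0r add0r.
move=> /nbhs_ballP[d /= d0 hd]; exists d => // t td; apply: hd.
by rewrite /ball /= sub0r normrN.
Qed.

(** Were the second derivative positive at 0, the first one would be positive just to the right of
    0, and the mean value theorem would give a value above the maximum. *)
Lemma max_second_derivative (f f1 : R -> R) (c d : R) : 0 < d ->
  (forall t, `|t| < d -> is_derive t (1 : R) f (f1 t)) -> is_derive (0 : R) (1 : R) f1 c ->
  (forall t, `|t| < d -> f t <= f 0) -> f1 0 = 0 /\ c <= 0.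
Proof.
move=> d0 df [df1 cE] fmax.
have inD t : t \in `](- d), d[ -> `|t| < d by rewrite in_itv /= ltr_norml.
have f10 : f1 0 = 0.
  have h0 : is_derive (0 : R) (1 : R) f 0.
    apply: (@derive1_at_max R f (- d) d 0); first lra.
    - by move=> t /inD td; have [] := df t td.
    - by rewrite in_itv /=; lra.
    - by move=> t /inD td; exact: fmax.
  have := df 0; rewrite normr0 => /(_ d0) [_ e]; by case: h0 => _; rewrite e.
split => //; rewrite leNgt; apply/negP => cp.
have hc : (fun h : R => h^-1 *: ((f1 \o shift 0) (h *: (1 : R)) - f1 0)) @ (0 : R)^' --> c.
  by rewrite -cE; exact: df1.
have : \forall h \near (0 : R)^', 0 < h^-1 *: ((f1 \o shift 0) (h *: (1 : R)) - f1 0).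
  exact: (cvgr_gt c hc).
move=> /nbhs_ballP[e /= e0 he].
pose h := Num.min d e / 2.
have m0 : 0 < Num.min d e by rewrite lt_min d0.
have h0 : 0 < h by rewrite divr_gt0.
have hm : h < Num.min d e by rewrite /h; lra.
move: (hm); rewrite lt_min => /andP[hd hhe].
have f1pos t : 0 < t -> t <= h -> 0 < f1 t.
  move=> t0 th; have := he t; rewrite /ball /= sub0r normrN gtr0_norm // => /(_ (le_lt_trans th hhe)).
  rewrite gt_eqF // => /(_ isT); rewrite addr0 [t *: 1]mulr1 f10 subr0.
  by rewrite [t^-1 *: _]mulrC ltr_pdivlMr // mul0r.
have [||t] := @MVT R f f1 0 h h0.
- move=> t; rewrite in_itv /= => /andP[t0 th]; apply: df.
  by rewrite gtr0_norm //; exact: lt_trans hd.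
- apply: continuous_in_subspaceT => t; rewrite inE /= in_itv /= => /andP[t0 th].
  have td : `|t| < d by rewrite ger0_norm //; exact: le_lt_trans hd.
  exact: deriv_cont (df t td).
rewrite in_itv /= => /andP[t0 th] fh.
have := fmax h; rewrite gtr0_norm // => /(_ hd); rewrite -subr_le0 fh subr0 leNgt.
by rewrite mulr_gt0 // f1pos // ltW.
Qed.

Lemma max_Lop s (u : V -> V -> R) g H x xi : c2 (@ball1 R n) setT u g H -> ball1 x ->
  (\forall y \near x, u y xi <= 0) -> u x xi = 0 ->
  Lop s x (u x xi) (fun i => g i x xi) (fun i j => H i j x xi) <= 0.
Proof.
move=> c Bx umax u0.
have key i : g i x xi = 0 /\ H i i x xi <= 0.
  have nb : \forall y \near x, ball1 y /\ u y xi <= 0.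
    by apply: filterI => //; exact: open_nbhs_nbhs (conj (@ball1_open R n) Bx).
  have [d d0 hd] := near_line (ecoord R i) nb.
  have e : 0 *: ecoord R i + x = x by rewrite scale0r add0r.
  have := @max_second_derivative (fun t => u (t *: ecoord R i + x) xi)
    (fun t => g i (t *: ecoord R i + x) xi) (H i i x xi) d d0.
  rewrite e; apply.
  - move=> t /hd [By _]; have [_ dg _ _ _] := c _ xi By I; exact: (deriv_line_at (dg i)).
  - have [_ _ _ dH _] := c x xi Bx I; exact: (proj1 (deriv_line _ _ _ _) (dH i i)).
  - by move=> t /hd [_]; rewrite u0.
rewrite /Lop u0 mulr0 addr0 [\sum_i x ord0 i * _]big1 ?mulr0 ?addr0; last first.
  by move=> i _; rewrite (key i).1 mulr0.
have p0 : 0 <= 1 - qn x by move: Bx; rewrite /ball1 /= => h; rewrite subr_ge0 ltW.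
rewrite mulr_ge0_le0 ?divr_ge0 // mulr_ge0_le0 //.
by apply: sumr_le0 => i _; exact: (key i).2.
Qed.

Lemma cont_eps (T : topologicalType) (f : T -> R) (x : T) :
  (forall e, 0 < e -> \forall y \near x, `|f x - f y| <= e) -> {for x, continuous f}.
Proof. by move=> h; apply/cvgrPdist_le. Qed.

Lemma near_lt (f : V -> R) x r : {for x, continuous f} -> f x < r -> \forall y \near x, f y < r.
Proof. by move=> cf h; exact: (cvgr_lt (f x) cf). Qed.

Lemma near_gt (f : V -> R) x r : {for x, continuous f} -> r < f x -> \forall y \near x, r < f y.
Proof. by move=> cf h; exact: (cvgr_gt (f x) cf). Qed.

Definition super s (psi : V -> R) := exists g H, c2 (@ball1 R n) setT (fun x _ => psi x) g H /\
  forall x xi, ball1 x -> Lop s x (psi x) (fun i => g i x xi) (fun i j => H i j x xi) < 0.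

(* At a touching point [w - M psi] has a local maximum with value 0, so the zeroth-order term of
   the operator, whose sign is arbitrary, plays no role. *)
Lemma no_touch s (w psi : V -> R) M x : sol s (@ball1 R n) setT (fun x _ => w x) -> super s psi ->
  ball1 x -> 0 < M -> (\forall y \near x, w y <= M * psi y) -> w x = M * psi x -> False.
Proof.
move=> [g1 [H1 [c1 e1]]] [g2 [H2 [c2 e2]]] Bx M0 le eqx.
have c := c2_lin 1 (- M) c1 c2.
have := max_Lop s c Bx (xi := 0).
rewrite Lop_lin e1 // mulr0 add0r mul1r eqx mulNr subrr => /(_ _ erefl).
have -> : (\forall y \near x, 1 * w y + - M * psi y <= 0) = True.
  by apply/propext; split => // _; apply: filterS le => y; rewrite mul1r mulNr subr_le0.
move=> /(_ I); apply/negP; rewrite -ltNge mulNr oppr_gt0.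
by have := e2 x 0 Bx; rewrite pmulr_rlt0.
Qed.

Lemma closed_ball_compact (r : R) : compact [set x : V | qn x <= r].
Proof.
apply: bounded_closed_compact.
  exists (r + 1); split; first exact: num_real.
  move=> M M1 x /= xr; rewrite [leLHS]/Num.norm /= mx_normrE; apply/bigmax_leP; split.
    by have := qn_ge0 x; lra.
  move=> [k i] _ /=; rewrite (ord1 k).
  have := coord_sqr_le x i; rewrite -[_ ^+ 2](real_normK (num_real _)).
  move: `|_| (normr_ge0 (x ord0 i)) => t t0 tq; have := sqr_ge0 (t - 1); rewrite -subr_ge0.
  move: (qn x) xr tq => q; nra.
have -> : [set x : V | qn x <= r] = @qn R n @^-1` [set t | t <= r] by [].
by apply: preimage_closed; [move=> x _; exact: qn_continuous|exact: closed_le].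
Qed.

Lemma sol_cont s U X (u : V -> V -> R) x xi : sol s U X u -> U x -> X xi -> {for x, continuous (u ^~ xi)}.
Proof. by move=> [g [H [c _]]] Ux Xxi; have [cu _ _ _ _] := c x xi Ux Xxi; exact: jc_left. Qed.

(** If [w] were positive somewhere, the quotient [w / psi] would have a positive maximum at an
    interior point [c]; there [w] touches [Q c * psi] from below, which [no_touch] excludes. *)
Lemma max_principle s (r : R) (w psi : V -> R) : r <= 1 ->
  sol s (@ball1 R n) setT (fun x _ => w x) -> super s psi -> (forall x, ball1 x -> 0 < psi x) ->
  (forall xi, qn xi = r -> forall e, 0 < e -> \forall x \near xi, qn x < r -> w x <= e * psi x) ->
  forall x, qn x < r -> w x <= 0.
Proof.
move=> r1 sw spsi psi0 bd x1 x1r; rewrite leNgt; apply/negP => wx1.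
have inB x : qn x < r -> ball1 x by move=> h; rewrite /ball1 /=; exact: lt_le_trans r1.
have cpsi x : ball1 x -> {for x, continuous psi}.
  by move=> Bx; case: spsi => g [H [c _]]; have [cu _ _ _ _] := c x 0 Bx I; exact: (jc_left cu).
have cw x : ball1 x -> {for x, continuous w} by move=> Bx; exact: (sol_cont (xi := 0) sw Bx I).
(* The boundary hypothesis says exactly that the positive part of the quotient tends to 0. Extension
   by 0 makes it continuous everywhere, so its maximum over the closed ball is attained although
   [psi] may blow up or vanish at the boundary. *)
pose Q x := if qn x < r then Num.max (w x / psi x) 0 else 0.
have cQ : continuous Q.
  move=> x; case: (ltrgtP (qn x) r) => xr.
  - apply: (@cont_near_eq _ _ (fun x => Num.max (w x / psi x) 0)).
      have : \forall y \near x, qn y < r by apply: near_lt => //; exact: qn_continuous.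
      by apply: filterS => y yr; rewrite /Q yr.
    apply: (@continuous_max _ _ (fun x => w x / psi x) (fun=> 0)); last exact: cst_continuous.
    apply: (@contM R V w (fun x => (psi x)^-1) x); first exact: cw (inB _ xr).
    by apply: contV; [rewrite gt_eqF // psi0 //; exact: inB|exact: cpsi (inB _ xr)].
  - apply: (@cont_near_eq _ _ (fun=> 0)); last exact: cst_continuous.
    have : \forall y \near x, r < qn y by apply: near_gt => //; exact: qn_continuous.
    by apply: filterS => y yr; rewrite /Q ltNge (ltW yr).
  - apply: cont_eps => e e0.
    have := bd x xr e e0; apply: filterS => y hy; rewrite /Q xr ltxx sub0r normrN.
    case: ifPn => yr; last by rewrite normr0 ltW.
    rewrite ger0_norm ?le_max ?lexx ?orbT // ge_max (ltW e0) andbT.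
    by rewrite ler_pdivrMr ?psi0 ?hy //; exact: inB.
have ne : [set x : V | qn x <= r] !=set0 by exists x1; exact: ltW.
have [c cK cmax] := compact_EVT_max ne (@closed_ball_compact r) (continuous_subspaceT cQ).
have Qx1 : 0 < Q x1 by rewrite /Q x1r lt_max divr_gt0 // psi0 //; exact: inB.
have Qc : 0 < Q c.
  by apply: (lt_le_trans Qx1); apply: cmax; rewrite inE /=; exact: ltW.
have cr : qn c < r by rewrite ltNge; apply/negP => h; move: Qc; rewrite /Q [qn c < r]ltNge h /= ltxx.
have Qce : Q c = w c / psi c.
  move: Qc; rewrite /Q cr lt_max ltxx orbF => h; exact/max_idPl/ltW.
apply: (no_touch (M := Q c) sw spsi (inB _ cr) Qc).
  have : \forall y \near c, qn y < r by apply: near_lt => //; exact: qn_continuous.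
  apply: filterS => y yr; rewrite -ler_pdivrMr ?psi0 //; last exact: inB.
  have := cmax y; rewrite inE /= => /(_ (ltW yr)); apply: le_trans.
  by rewrite {1}/Q yr le_max lexx.
by rewrite Qce divfK // gt_eqF // psi0 //; exact: inB.
Qed.

End MaximumPrinciple.

(** * Differentiation under the sphere integral *)

Section DifferentiationUnderIntegral.
Variables (R : realType) (n : nat).
Local Notation V := 'rV[R]_(n.+1).
Implicit Types (x xi : V) (k : V -> V -> R) (f : V -> R).
Local Notation S := (@sphere_integral R n).

(** Tube lemma: joint continuity along the compact sphere gives one neighbourhood of [x] that serves
    all [xi]. *)
Lemma jc_uniform k x e : (forall xi, sphere xi -> jc k x xi) -> 0 < e ->
  \forall y \near x, forall xi, sphere xi -> `|k y xi - k x xi| <= e.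
Proof.
move=> jk e0.
have /compact_near_coveringP := @sphere_compact R n.
move=> /(_ V (nbhs x) (fun y xi => `|k y xi - k x xi| <= e) _) h.
apply: h => xi Sxi.
have e2 : 0 < e / 2 by rewrite divr_gt0.
have /cvgrPdist_lt /(_ _ e2) := jk xi Sxi.
move=> [[A1 A2] /= [nA1 nA2] sub].
exists (A2, A1) => //= -[z y] /= [Az Ay].
have h1 := sub (y, z) (conj Ay Az).
have h2 := sub (x, z) (conj (nbhs_singleton nA1) Az).
rewrite /= in h1 h2.
have -> : k y z - k x z = (k x xi - k x z) - (k x xi - k y z) by ring.
apply: (le_trans (ler_normB _ _)); apply: ltW.
by rewrite [e]splitr ltrD.
Qed.

Lemma CS_for f : (forall xi, sphere xi -> {for xi, continuous f}) -> CS f.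
Proof. by move=> cf; apply/CSP => xi Sxi; apply: cvg_within_filter; exact: cf. Qed.

Lemma CS_jc k f x : (forall xi, sphere xi -> jc k x xi) -> CS f -> CS (fun xi => k x xi * f xi).
Proof. by move=> jk cf; apply: CS_mul => //; apply: CS_for => xi Sxi; exact/jc_right/jk. Qed.

Lemma CS_sub f1 f2 : CS f1 -> CS f2 -> CS (fun xi : V => f1 xi - f2 xi).
Proof.
move=> c1 c2; have := CS_lin (a := -1) c2 c1; congr (CS _).
by apply/funext => xi; ring.
Qed.

Lemma S1_ge0 : 0 <= S (fun=> 1).
Proof. by apply: sphere_int_ge0. Qed.

Section Kernel.
Variables (U : set V) (f : V -> R).
Hypotheses (oU : open U) (cf : CS f).

Lemma int_small : exists2 C : R, 0 < C & forall (h : V -> R) e, CS h ->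
  (forall xi, sphere xi -> `|h xi| <= e) -> `|S (fun xi => h xi * f xi)| <= e * C.
Proof.
have [M M0 fM] := CS_bounded cf.
exists (M * S (fun=> 1) + 1); first by rewrite ltr_wpDl // mulr_ge0 // S1_ge0.
move=> h e ch he.
have [xi0 S0] := @sphere_nonempty R n.
have e0 : 0 <= e by apply: le_trans (he xi0 S0).
apply: (@le_trans _ _ (e * M * S (fun=> 1))).
  apply: sphere_int_bound; first exact: CS_mul.
  by move=> xi Sxi; rewrite normrM ler_pM // ?he ?fM.
by rewrite -mulrA ler_wpM2l // lerDl.
Qed.

Lemma int_cont k x : U x -> (forall y xi, U y -> sphere xi -> jc k y xi) ->
  {for x, continuous (fun x => S (fun xi => k x xi * f xi))}.
Proof.
move=> Ux jk; have [C C0 hC] := int_small.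
apply: cont_eps => e e0.
have eC : 0 < e / C by rewrite divr_gt0.
have h1 := jc_uniform (fun xi => jk x xi Ux) eC.
have h2 := open_nbhs_nbhs (conj oU Ux).
have : \forall y \near x, U y /\ forall xi, sphere xi -> `|k y xi - k x xi| <= e / C.
  exact: filterI.
apply: filterS => y [Uy hy].
have cx : CS (k x) by apply: CS_for => xi Sxi; exact/jc_right/jk.
have cy : CS (k y) by apply: CS_for => xi Sxi; exact/jc_right/jk.
rewrite -sphere_intB; [|exact: CS_mul|exact: CS_mul].
rewrite (@sphere_int_ext _ _ _ (fun xi => (k x xi - k y xi) * f xi)); last by move=> xi _; ring.
have -> : e = e / C * C by rewrite divfK // gt_eqF.
by apply: hC; [exact: CS_sub|move=> xi Sxi; rewrite distrC; exact: hy].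
Qed.

Lemma mvt_line (p p1 : R -> R) (h : R) :
  (forall t, `|t| <= `|h| -> is_derive t (1 : R) p (p1 t)) ->
  exists2 t, `|t| <= `|h| & p h - p 0 = p1 t * h.
Proof.
move=> dp; have cp t : `|t| <= `|h| -> {for t, continuous p}.
  by move=> th; exact: deriv_cont (dp t th).
case: (lerP 0 h) => h0.
- have inD t : t \in `[0, h] -> `|t| <= `|h|.
    by rewrite in_itv /= => /andP[t0 th]; rewrite !ger0_norm.
  have [||t] := @MVT_segment R p p1 0 h h0.
  + by move=> t ti; apply: dp; apply: inD; apply: subset_itv_oo_cc.
  + by apply: continuous_in_subspaceT => t; rewrite inE => /inD; exact: cp.
  by move=> /inD th; rewrite subr0 => e; exists t.
- have inD t : t \in `[h, 0] -> `|t| <= `|h|.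
    by rewrite in_itv /= => /andP[th t0]; rewrite !ler0_norm ?lerN2 // ltW.
  have [||t] := @MVT_segment R p p1 h 0 (ltW h0).
  + by move=> t ti; apply: dp; apply: inD; apply: subset_itv_oo_cc.
  + by apply: continuous_in_subspaceT => t; rewrite inE => /inD; exact: cp.
  move=> /inD th e; exists t => //.
  by rewrite -[LHS]opprB e; ring.
Qed.

(** By the mean value theorem the difference quotient of [k] is [g] at an intermediate point of the
    segment. This is close to [g] at [x] uniformly in [xi], so a sup bound replaces dominated
    convergence. *)
Lemma int_deriv k (g : V -> V -> R) x v : U x ->
  (forall y xi, U y -> sphere xi -> jc k y xi) ->
  (forall y xi, U y -> sphere xi -> is_derive y v (k ^~ xi) (g y xi)) ->
  (forall y xi, U y -> sphere xi -> jc g y xi) ->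
  is_derive x v (fun x => S (fun xi => k x xi * f xi)) (S (fun xi => g x xi * f xi)).
Proof.
move=> Ux jk dk jg; have [C C0 hC] := int_small.
set u := fun x => _.
suff hc : (fun h : R => h^-1 *: ((u \o shift x) (h *: v) - u x)) @ (0 : R)^' -->
    S (fun xi => g x xi * f xi).
  by split; [exact: (cvgP _ hc)|exact: (cvg_lim _ hc)].
apply/cvgrPdist_le => e e0.
have eC : 0 < e / C by rewrite divr_gt0.
have h1 := jc_uniform (fun xi => jg x xi Ux) eC.
have h2 := open_nbhs_nbhs (conj oU Ux).
have h12 : \forall y \near x, U y /\ forall xi, sphere xi -> `|g y xi - g x xi| <= e / C.
  exact: filterI.
have [d d0 hd] := near_line v h12.
exists d => //= h /=; rewrite /ball /= sub0r normrN => hhd hn0.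
have [Uh _] := hd h hhd.
have cS y : U y -> CS (k y) by move=> Uy; apply: CS_for => xi Sxi; exact/jc_right/jk.
have cG : CS (g x) by apply: CS_for => xi Sxi; exact/jc_right/jg.
have cD := CS_sub (cS _ Uh) (cS _ Ux).
have cD' : CS (fun xi => h^-1 * (k (h *: v + x) xi - k x xi)) by apply: CS_mul => //; exact: CS_cst.
rewrite /u [h^-1 *: _](_ : _ = S (fun xi => h^-1 * (k (h *: v + x) xi - k x xi) * f xi)); last first.
  rewrite /= -sphere_intB; [|by apply: CS_mul => //; exact: cS|by apply: CS_mul => //; exact: cS].
  rewrite [LHS](_ : _ = h^-1 * S (fun xi => k (h *: v + x) xi * f xi - k x xi * f xi)) //.
  rewrite -sphere_intZ; last by apply: CS_sub; apply: CS_mul => //; exact: cS.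
  by apply: sphere_int_ext => xi _; ring.
rewrite -sphere_intB; [|exact: CS_mul|exact: CS_mul].
rewrite (@sphere_int_ext _ _ _ (fun xi => (g x xi - h^-1 * (k (h *: v + x) xi - k x xi)) * f xi)); last first.
  by move=> xi _; ring.
have -> : e = e / C * C by rewrite divfK // gt_eqF.
apply: hC; first exact: CS_sub.
move=> xi Sxi.
have [|t th] := @mvt_line (fun t => k (t *: v + x) xi) (fun t => g (t *: v + x) xi) h.
  move=> t th; have [Ut _] := hd t (le_lt_trans th hhd).
  exact: deriv_line_at (dk _ xi Ut Sxi).
rewrite scale0r add0r => ->.
rewrite mulrC mulfK // distrC.
by have [_] := hd t (le_lt_trans th hhd); apply.
Qed.

Lemma c2_int k g H : c2 U sphere k g H ->
  c2 U setT (fun x _ => S (fun xi => k x xi * f xi)) (fun i x _ => S (fun xi => g i x xi * f xi))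
    (fun i j x _ => S (fun xi => H i j x xi * f xi)).
Proof.
move=> c.
have jk y xi : U y -> sphere xi -> jc k y xi by move=> Uy Sxi; have [] := c y xi Uy Sxi.
have jg i y xi : U y -> sphere xi -> jc (g i) y xi.
  by move=> Uy Sxi; have [_ _ h _ _] := c y xi Uy Sxi; exact: h.
have jH i j y xi : U y -> sphere xi -> jc (H i j) y xi.
  by move=> Uy Sxi; have [_ _ _ _ h] := c y xi Uy Sxi; exact: h.
move=> x xi Ux _; split.
- by apply: jc_fst; exact: int_cont.
- move=> i; apply: int_deriv => // [y z Uy Sz|y z]; last exact: jg.
  by have [_ h _ _ _] := c y z Uy Sz; exact: h.
- by move=> i; apply: jc_fst; apply: int_cont => // y z; exact: jg.
- move=> i j; apply: int_deriv => // [y z|y z Uy Sz|y z]; [exact: jg| |exact: jH].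
  by have [_ _ _ h _] := c y z Uy Sz; exact: h.
- by move=> i j; apply: jc_fst; apply: int_cont => // y z; exact: jH.
Qed.

Lemma sphere_int_sum (I : Type) (r : seq I) (F : I -> V -> R) : (forall i, CS (F i)) ->
  CS (fun xi => \sum_(i <- r) F i xi) /\
  S (fun xi => \sum_(i <- r) F i xi) = \sum_(i <- r) S (F i).
Proof.
move=> cF; elim: r => [|i r [IH1 IH2]].
  rewrite (_ : (fun xi => _) = fun=> 0 * 1); last by apply/funext => xi; rewrite big_nil mul0r.
  rewrite big_nil; split; first exact: CS_cst.
  by rewrite sphere_intZ ?mul0r //; exact: CS_cst.
rewrite (_ : (fun xi => _) = fun xi => 1 * F i xi + \sum_(j <- r) F j xi); last first.
  by apply/funext => xi; rewrite big_cons mul1r.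
split; first exact: CS_lin.
by rewrite sphere_int_lin // IH2 big_cons mul1r.
Qed.

Lemma sol_int s k : sol s U sphere k -> sol s U setT (fun x _ => S (fun xi => k x xi * f xi)).
Proof.
move=> [g [H [c e]]]; do 2 eexists; split; first exact: (c2_int c).
move=> x xi0 Ux _ /=.
have ck : CS (fun xi => k x xi * f xi) by apply: CS_jc => // xi Sxi; have [] := c x xi Ux Sxi.
have cg i : CS (fun xi => x ord0 i * (g i x xi * f xi)).
  apply: CS_mul; first exact: CS_cst.
  by apply: CS_jc => // xi Sxi; have [_ _ h _ _] := c x xi Ux Sxi; exact: h.
have cg' i : CS (fun xi => g i x xi * f xi).
  by apply: CS_jc => // xi Sxi; have [_ _ h _ _] := c x xi Ux Sxi; exact: h.
have cH i : CS (fun xi => H i i x xi * f xi).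
  by apply: CS_jc => // xi Sxi; have [_ _ _ _ h] := c x xi Ux Sxi; exact: h.
have [c1 e1] := sphere_int_sum (index_enum 'I_n.+1) cH.
have [c2 e2] := sphere_int_sum (index_enum 'I_n.+1) cg.
rewrite /Lop -e1.
have -> : \sum_i x ord0 i * S (fun xi => g i x xi * f xi) =
    S (fun xi => \sum_i x ord0 i * (g i x xi * f xi)).
  by rewrite e2; apply: eq_bigr => i _; rewrite sphere_intZ.
set p := 1 - qn x; set m := 2 * (n%:R - 1); set z := s * (n%:R - s).
have Z0 : S (fun=> 0 * 1) = 0 by rewrite sphere_intZ ?mul0r //; exact: CS_cst.
rewrite -[RHS]Z0.
have czk : CS (fun xi => z * (k x xi * f xi)) by apply: CS_mul => //; exact: CS_cst.
have cl := CS_lin (a := p / 4 * m) c2 czk.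
transitivity (p / 4 * p * S (fun xi => \sum_i H i i x xi * f xi) +
   (p / 4 * m * S (fun xi => \sum_i x ord0 i * (g i x xi * f xi)) + S (fun xi => z * (k x xi * f xi)))).
  by rewrite sphere_intZ //; ring.
rewrite -sphere_int_lin // -sphere_int_lin //; apply: sphere_int_ext => xi Sxi.
have E2 : \sum_i x ord0 i * (g i x xi * f xi) = (\sum_i x ord0 i * g i x xi) * f xi.
  by rewrite mulr_suml; apply: eq_bigr => i _; rewrite mulrA.
have := e x xi Ux Sxi; rewrite /Lop -/p -/m -/z -mulr_suml E2 mul0r.
move: (\sum_i H i i x xi) (\sum_i x ord0 i * g i x xi) => a b h.
transitivity ((p / 4 * (p * a + m * b) + z * k x xi) * f xi); first by ring.
by rewrite h mul0r.
Qed.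

End Kernel.
End DifferentiationUnderIntegral.

(** * Uniqueness, and the Poisson integral of the constant 1 *)

Section Normalization.
Variables (R : realType) (n : nat).
Local Notation V := 'rV[R]_(n.+1).
Implicit Types (x xi : V).
Variable gamma : R.
Hypothesis gamma0 : 0 < gamma.
Let s : R := n%:R / 2 + gamma.
Local Notation S := (@sphere_integral R n).
Local Notation B := (@ball1 R n).

Definition hgF (l : nat) (t : R) : R :=
  hyp2F1 (l%:R + n%:R / 2 - gamma) (1 / 2 - gamma) (l%:R + (n%:R + 1) / 2) t.

Lemma hgF_params l : let a := l%:R + n%:R / 2 - gamma in let b := 1 / 2 - gamma in
  let c := l%:R + (n%:R + 1) / 2 in
  [/\ 0 < c, c - a - b = 2 * gamma, c - a = gamma + 1 / 2 & c - b = l%:R + gamma + n%:R / 2].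
Proof.
split; try by field.
by rewrite ltr_wpDl // divr_gt0 // ltr_wpDl.
Qed.

Lemma hgF_one l : hgF l 1 = Gamma (l%:R + (n%:R + 1) / 2) * Gamma (2 * gamma) /
  (Gamma (gamma + 1 / 2) * Gamma (l%:R + gamma + n%:R / 2)).
Proof.
have [c0 e1 e2 e3] := hgF_params l; rewrite /hgF hyp_Gauss ?e1 ?e2 ?e3 //.
- by rewrite mulr_gt0.
- by rewrite addr_gt0 // divr_gt0.
- by rewrite ltr_wpDr ?divr_ge0 // ltr_wpDl.
Qed.

Lemma hgF_one_gt0 l : 0 < hgF l 1.
Proof.
have [c0 _ _ _] := hgF_params l; rewrite hgF_one divr_gt0 // mulr_gt0 // Gamma_gt0 //.
- by rewrite mulr_gt0.
- by rewrite addr_gt0 // divr_gt0.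
- by rewrite ltr_wpDr ?divr_ge0 // ltr_wpDl.
Qed.

Lemma hgF_near l xi e : sphere xi -> 0 < e ->
  \forall x \near xi, qn x < 1 -> `|hgF l (qn x) - hgF l 1| <= e.
Proof.
move=> /sphereE Sxi e0; have [c0 e1 _ _] := hgF_params l.
have d0 : 0 < 2 * gamma by rewrite mulr_gt0.
rewrite -e1 in d0.
have [d dp hd] := hyp_cont1 c0 d0 e0.
have : \forall x \near xi, 1 - d < qn x.
  by apply: near_gt; [exact: qn_continuous|rewrite Sxi; lra].
apply: filterS => x xd x1; apply: hd; last exact: qn_ge0.
by rewrite (ltW xd) (ltW x1).
Qed.

Lemma hgF_zero l : hgF l 0 = 1.
Proof. exact: hyp2F1_0. Qed.

Lemma rpow_rho b x : rpow b (qn x) = rho0 x `^ b.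
Proof. by rewrite /rpow /rho0 enorm_sqr; congr (_ `^ _); field. Qed.

Lemma rho_gt0 x : B x -> 0 < rho0 x.
Proof. by rewrite /ball1 /rho0 enorm_sqr /= => h; rewrite divr_gt0 // subr_gt0. Qed.

Lemma hsolE l x : hsol n gamma l (qn x) = rho0 x `^ (n%:R - s) * hgF l (qn x).
Proof. by rewrite /hsol rpow_rho. Qed.

Definition hg0 x : R := hsol n gamma 0 (qn x).

Lemma hg0_sol : sol s B setT (fun x _ => hg0 x).
Proof.
have := hsol_sol gamma0 (one_homog_poly R n) (@one_harmonic R n).
by apply: sol_congr => [|x xi Bx]; [exact: ball1_open|rewrite mulr1].
Qed.

Lemma rho_super : super s (fun x => rpow (n%:R / 2) (qn x)).
Proof. exact: rpow_super. Qed.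

Lemma sol_opp (w : V -> R) : sol s B setT (fun x _ => w x) -> sol s B setT (fun x _ => - w x).
Proof.
move=> sw; have := sol_lin (-1) 0 sw sw.
apply: sol_congr => [|x xi Bx]; first exact: ball1_open.
by rewrite mulN1r mul0r addr0.
Qed.

Lemma rpow_gt0 b x : B x -> 0 < rpow b (qn x).
Proof. by move=> Bx; rewrite rpow_rho powR_gt0 // rho_gt0. Qed.

Lemma hg0_near xi : sphere xi ->
  \forall x \near xi, qn x < 1 -> rho0 x `^ (n%:R - s) * (hgF 0 1 / 2) <= hg0 x.
Proof.
move=> Sxi; have F0 : 0 < hgF 0 1 / 2 by rewrite divr_gt0 // hgF_one_gt0.
apply: filterS (hgF_near 0 Sxi F0) => x h x1; rewrite /hg0 hsolE ler_wpM2l ?powR_ge0 //.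
have := h x1; rewrite ler_norml => /andP[]; lra.
Qed.

(* [hg0] is positive near the sphere because [hgF 0 1 > 0], which is all the boundary
   information that the maximum principle needs to exclude interior negative values. *)
Lemma hg0_ge0 x : B x -> 0 <= hg0 x.
Proof.
move=> Bx; rewrite -oppr_le0.
apply: (max_principle (lexx 1) (sol_opp hg0_sol) rho_super (rpow_gt0 (n%:R / 2))) => //.
move=> xi /sphereE Sxi e e0; apply: filterS (hg0_near Sxi) => y h y1.
apply: (@le_trans _ _ 0); last by rewrite mulr_ge0 ?(ltW e0) // ltW // rpow_gt0.
rewrite oppr_le0; apply: le_trans (h y1).
by rewrite mulr_ge0 ?powR_ge0 // ltW // divr_gt0 // hgF_one_gt0.
Qed.

Definition psi0 x : R := hg0 x + rpow (n%:R / 2) (qn x).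

Lemma psi0_super : super s psi0.
Proof.
have [g1 [H1 [c1 e1]]] := hg0_sol; have [g2 [H2 [c2 e2]]] := rho_super.
have c := c2_lin 1 1 c1 c2; do 2 eexists; split.
  by apply: c2_congr c; [exact: ball1_open|move=> x xi _; rewrite !mul1r].
move=> x xi Bx /=; have := Lop_lin s x 1 1 (hg0 x) (fun i => g1 i x xi) (fun i j => H1 i j x xi)
  (rpow (n%:R / 2) (qn x)) (fun i => g2 i x xi) (fun i j => H2 i j x xi).
by rewrite e1 // !mul1r add0r => ->; exact: e2.
Qed.

Lemma psi0_gt0 x : B x -> 0 < psi0 x.
Proof. by move=> Bx; rewrite ltr_wpDl ?hg0_ge0 // rpow_gt0. Qed.

Lemma psi0_cont x : B x -> {for x, continuous psi0}.
Proof.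
move=> Bx; have [g [H [c _]]] := psi0_super.
by have [cu _ _ _ _] := c x 0 Bx I; exact: (jc_left cu).
Qed.

(** Near the sphere [psi0] is at least [F(1) / 2] times [rho0^(n - s)], so smallness of
    [rho0^(s - n) w] gives [w <= e psi0], the boundary hypothesis of [max_principle]. *)
Lemma uniqueness_le (w : V -> R) : sol s B setT (fun x _ => w x) ->
  (forall xi, sphere xi -> forall e, 0 < e -> \forall x \near xi, qn x < 1 ->
     rho0 x `^ (s - n%:R) * w x <= e) ->
  forall x, B x -> w x <= 0.
Proof.
move=> sw bd; apply: (max_principle (lexx 1) sw psi0_super psi0_gt0).
move=> xi /sphereE Sxi e e0.
have F0 : 0 < hgF 0 1 / 2 by rewrite divr_gt0 // hgF_one_gt0.
have b1 := bd xi Sxi _ (mulr_gt0 e0 F0).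
apply: filterS (filterI b1 (hg0_near Sxi)) => x [h1 h2] x1.
have r0 : 0 < rho0 x by exact: rho_gt0.
have -> : w x = rho0 x `^ (n%:R - s) * (rho0 x `^ (s - n%:R) * w x).
  by rewrite mulrA -powRD_gt0 // (_ : n%:R - s + (s - n%:R) = 0) ?powRr0 ?mul1r //; ring.
apply: (@le_trans _ _ (e * (rho0 x `^ (n%:R - s) * (hgF 0 1 / 2)))).
  by rewrite [leRHS]mulrCA ler_wpM2l ?powR_ge0 // h1.
apply: ler_wpM2l; first exact: ltW.
by apply: (le_trans (h2 x1)); rewrite lerDl ltW // rpow_gt0.
Qed.

Lemma uniqueness_zero (w : V -> R) : sol s B setT (fun x _ => w x) ->
  (forall xi, sphere xi -> forall e, 0 < e -> \forall x \near xi, qn x < 1 ->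
     `|rho0 x `^ (s - n%:R) * w x| <= e) ->
  forall x, B x -> w x = 0.
Proof.
move=> sw bd x Bx; apply/eqP; rewrite eq_le -oppr_le0 andbC; apply/andP; split.
  apply: (uniqueness_le (sol_opp sw)) => // xi Sxi e e0.
  apply: filterS (bd xi Sxi e e0) => y h y1; apply: le_trans (h y1).
  by rewrite mulrN -normrN ler_norm.
apply: (uniqueness_le sw) => // xi Sxi e e0.
by apply: filterS (bd xi Sxi e e0) => y h y1; apply: le_trans (h y1); exact: ler_norm.
Qed.

(** Dirichlet uniqueness on a smaller ball. On its boundary [psi0] is continuous and positive, so a
    solution vanishing there is below [e psi0] nearby. *)
Lemma local_uniqueness (r : R) (w : V -> R) : r < 1 -> sol s B setT (fun x _ => w x) ->
  (forall xi, qn xi = r -> w xi = 0) -> forall x, qn x < r -> w x = 0.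
Proof.
move=> r1 sw w0.
have le0 (v : V -> R) : sol s B setT (fun x _ => v x) -> (forall xi, qn xi = r -> v xi = 0) ->
    forall x, qn x < r -> v x <= 0.
  move=> sv v0; apply: (max_principle (ltW r1) sv psi0_super psi0_gt0) => xi xr e e0.
  have Bxi : B xi by rewrite /ball1 /= xr.
  have : \forall x \near xi, v x + (- e) * psi0 x < 0.
    apply: near_lt; last by rewrite v0 // add0r mulNr oppr_lt0 mulr_gt0 // psi0_gt0.
    apply: (@contD R V v (fun x => - e * psi0 x) xi).
      exact: (sol_cont (xi := 0) sv Bxi I).
    by apply: (@contM R V (fun=> - e) psi0 xi); [exact: cont_cst|exact: psi0_cont].
  by apply: filterS => x h _; rewrite -subr_le0 -mulNr ltW.
move=> x xr; apply/eqP; rewrite eq_le le0 //= -oppr_le0.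
by apply: (le0 _ (sol_opp sw)) => // xi xir; rewrite w0 // oppr0.
Qed.

Definition pint (f : V -> R) x : R := S (fun xi => pker gamma x xi * f xi).

Lemma pint_sol f : CS f -> sol s B setT (fun x _ => pint f x).
Proof. by move=> cf; apply: (sol_int (@ball1_open R n) cf); exact: pker_sol. Qed.

Lemma CS_pker x : B x -> CS (pker gamma x).
Proof.
move=> Bx; have [g [H [c _]]] := @pker_sol R n gamma.
by apply: CS_for => xi Sxi; have [h _ _ _ _] := c x xi Bx Sxi; exact: jc_right h.
Qed.

Lemma pint_one_radial a b : (0 < n)%N -> B a -> qn a = qn b -> pint (fun=> 1) a = pint (fun=> 1) b.
Proof.
move=> n0 Ba ab.
(* [m] is the least possible value of [|a - xi|^2]. Truncating the denominator at [m] makes [phi]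
   continuous on the whole line, as [sphere_int_radial] requires, and changes no value taken on the
   sphere. *)
pose q : R := qn a; pose m : R := (1 - Num.sqrt q) ^+ 2.
have q1 : q < 1 by [].
have sq1 : Num.sqrt q < 1 by rewrite -[ltRHS]sqrtr1 ltr_sqrt.
have m0 : 0 < m by rewrite exprn_gt0 // subr_gt0.
pose phi (t : R) : R := ((1 - q) / Num.max (q + 1 + (- 2) * t) m) `^ s.
have dpos t : 0 < Num.max (q + 1 + (- 2) * t) m by rewrite lt_max m0 orbT.
have cphi : continuous phi.
  move=> t; apply: (@cont_comp R R (fun t => (1 - q) / Num.max (q + 1 + (- 2) * t) m) (fun y => y `^ s) t).
    apply: (@contM R R (fun=> 1 - q)); first exact: cont_cst.
    apply: contV; first by rewrite gt_eqF.
    apply: (@continuous_max _ _ (fun t : R => q + 1 + (- 2) * t : R) (fun _ : R => m)); last exact: cst_continuous.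
    apply: (@contD R R (fun=> q + 1)); first exact: cont_cst.
    by apply: (@contM R R (fun=> - 2) id); [exact: cont_cst|exact: cvg_id].
  by apply: powR_continuous; rewrite divr_gt0 // subr_gt0.
have E c : qn c = q -> pint (fun=> 1) c = S (fun xi => phi (dot c xi)).
  move=> cq; apply: sphere_int_ext => xi Sxi; rewrite mulr1 /pker /phi cq; congr (_ `^ _).
  have := dot_sphere c Sxi; rewrite enormE cq ler_norml => /andP[_ dle].
  move: (Sxi) => /sphereE xi1; rewrite qnB cq xi1.
  have sqe : Num.sqrt q ^+ 2 = q by rewrite sqr_sqrtr // -/q qn_ge0.
  have -> : q + 1 - 2 * dot c xi = q + 1 + - 2 * dot c xi by ring.
  congr (_ / _); apply/esym/max_idPl; rewrite /m sqrrB sqe expr1n mul1r.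
  by move: (Num.sqrt q) (dot c xi) dle => z d; lra.
rewrite (E a erefl) (E b (esym ab)).
exact: (sphere_int_radial n0 cphi ab).
Qed.

Lemma pint_one_zero : pint (fun=> 1) 0 = S (fun=> 1).
Proof.
apply: sphere_int_ext => xi /sphereE xi1.
by rewrite /pker qn0 qnB qn0 xi1 /dot big1 ?mulr0 ?subr0 ?add0r ?divr1 ?powR1 ?mulr1 // => i _; rewrite mxE mul0r.
Qed.

Lemma hg0_zero : hg0 0 = (2^-1) `^ (n%:R - s).
Proof.
by rewrite /hg0 /hsol qn0 -/(hgF 0 0) hgF_zero mulr1 /rpow mulr0 addr0.
Qed.

(* Both sides are radial solutions, so a combination of them vanishes on the sphere of radius
   [|x|], hence inside it; the value at the origin gives the constant. *)
Lemma pint_one x : (0 < n)%N -> B x ->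
  pint (fun=> 1) x = S (fun=> 1) * 2 `^ (n%:R - s) * hg0 x.
Proof.
move=> n0 Bx.
have key : hg0 x * pint (fun=> 1) 0 = pint (fun=> 1) x * hg0 0.
  have [q0|q0] := eqVneq (qn x) 0; first by rewrite (qn_eq0 q0) mulrC.
  have sw := sol_lin (hg0 x) (- pint (fun=> 1) x) (pint_sol (@CS_cst R n 1)) hg0_sol.
  have := local_uniqueness (r := qn x) Bx sw; rewrite /= => h.
  have := h _ 0; rewrite qn0 lt0r q0 qn_ge0 => /(_ _ isT) h0.
  apply/eqP; rewrite -subr_eq0 -mulNr h0 // => xi xix.
  rewrite /hg0 xix (@pint_one_radial xi x) //; last by rewrite /ball1 /= xix.
  by ring.
move: key; rewrite pint_one_zero hg0_zero.
have e : (2^-1) `^ (n%:R - s) * 2 `^ (n%:R - s) = 1 :> R.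
  by rewrite -powRM ?invr_ge0 // mulVf // powR1.
move=> k; transitivity (pint (fun=> 1) x * ((2^-1) `^ (n%:R - s) * 2 `^ (n%:R - s))).
  by rewrite e mulr1.
by rewrite mulrA -k; ring.
Qed.

Definition pconst : R := pi `^ (- (n%:R / 2)) * (2 `^ (- s) * Gamma (n%:R / 2 + gamma) / Gamma gamma).

Lemma pconst_gt0 : 0 < pconst.
Proof.
by rewrite /pconst !(mulr_gt0, invr_gt0, powR_gt0, Gamma_gt0, pi_gt0) // ltr_wpDl // divr_ge0.
Qed.

(** [Gamma ((n + 1) / 2)] cancels between the area and [F(1)], and [Gamma (n / 2 + gamma)] between
    the constant and [F(1)]. The powers of 2 combine to [4^(- gamma)], and what remains is the
    duplication formula at [gamma]. *)
Lemma pconst_eq : pconst * (S (fun=> 1) * 2 `^ (n%:R - s)) * hgF 0 1 = 1.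
Proof.
have S1 := @sphere_int_one R n.
have D := Gamma_duplication gamma0.
have g0 := Gamma_gt0 gamma0.
have sg : 0 < n%:R / 2 + gamma by rewrite ltr_wpDl // divr_ge0.
have g1 := Gamma_gt0 sg.
have g2 : 0 < Gamma (gamma + 2^-1) by rewrite Gamma_gt0 // addr_gt0 // invr_gt0.
have pi0 : 0 < pi :> R by exact: pi_gt0.
rewrite hgF_one /pconst.
have -> : 1 / 2 = 2^-1 :> R by rewrite div1r.
have -> : 0%:R + gamma + n%:R / 2 = n%:R / 2 + gamma by rewrite add0r addrC.
have -> : 0%:R + (n%:R + 1) / 2 = n.+1%:R / 2 :> R by rewrite add0r natr1.
have p1 : pi `^ (n.+1%:R / 2) = pi `^ (n%:R / 2) * Num.sqrt pi :> R.
  rewrite -powR12_sqrt ?ltW // -powRD_gt0 //; congr (_ `^ _).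
  by rewrite -natr1; field.
have p2 : 2 `^ (- s) * 2 `^ (n%:R - s) * 4 `^ gamma = 1 :> R.
  have -> : 4 `^ gamma = 2 `^ (2 * gamma) :> R.
    by rewrite powRrM powR_mulrn // -natrX.
  rewrite -!powRD_gt0 // (_ : - s + (n%:R - s) + 2 * gamma = 0) ?powRr0 //.
  by rewrite /s; field.
have p3 : pi `^ (- (n%:R / 2)) * pi `^ (n%:R / 2) = 1 :> R.
  by rewrite -powRD_gt0 // addNr powRr0.
rewrite p1 in S1.
have sp : 0 < Num.sqrt pi :> R by rewrite sqrtr_gt0.
have f4 : 0 < 4 `^ gamma :> R by rewrite powR_gt0.
move: (S _) (Gamma (n.+1%:R / 2)) (pi `^ (n%:R / 2)) (pi `^ (- _)) (Num.sqrt pi) S1 p3 sp D {p1} => sp1 G P1 P2 sq S1 p3 sq0.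
move: (2 `^ (- s)) (2 `^ (n%:R - s)) (4 `^ gamma) p2 f4 => a b c p2 f4.
move: (Gamma gamma) (Gamma (gamma + 2^-1)) (Gamma (2 * gamma)) (Gamma (n%:R / 2 + gamma)) g0 g1 g2.
move=> A A2 A3 A4 h1 h2 h3 D.
have -> : P2 * (a * A4 / A) * (sp1 * b) * (G * A3 / (A2 * A4)) =
   (sp1 * G) * P2 * a * b * A3 / (A * A2).
  by field; rewrite !gt_eqF.
rewrite S1.
have -> : 2 * (P1 * sq) * P2 * a * b * A3 / (A * A2) = (P2 * P1) * (a * b * (2 * sq * A3) / (A * A2)).
  by field; rewrite !gt_eqF.
rewrite p3 -D mul1r -[RHS]p2; field; by rewrite !gt_eqF.
Qed.

End Normalization.

(** * The Poisson integral *)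

Section PoissonIntegral.
Variables (R : realType) (n : nat).
Local Notation V := 'rV[R]_(n.+1).
Implicit Types (x xi : V) (f : V -> R).
Variable gamma : R.
Hypotheses (n_gt0 : (0 < n)%N) (gamma0 : 0 < gamma).
Let s : R := n%:R / 2 + gamma.
Local Notation S := (@sphere_integral R n).
Local Notation B := (@ball1 R n).
Local Notation F := (hgF n gamma).
Local Notation C := (pconst n gamma).

Definition bdval (v : V -> R) xi (a : R) := forall e, 0 < e ->
  \forall x \near xi, B x -> `|a - rho0 x `^ (s - n%:R) * v x| <= e.

Lemma cvg_withinP (T : topologicalType) (D : set T) (h : T -> R) (x : T) (a : R) :
  h @ within D (nbhs x) --> a <-> forall e, 0 < e -> \forall y \near x, D y -> `|a - h y| <= e.
Proof. by split => [/cvgrPdist_le|h1] //; apply/cvgrPdist_le. Qed.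

Lemma rho_powK x : B x -> rho0 x `^ (s - n%:R) * rho0 x `^ (n%:R - s) = 1.
Proof.
move=> Bx; rewrite -powRD_gt0; last exact: rho_gt0.
by rewrite (_ : s - n%:R + (n%:R - s) = 0) ?powRr0 //; ring.
Qed.

(** The mass of the normalized kernel. It is not constant, but tends to 1 at the sphere because [F]
    is continuous at 1. *)
Lemma pint_one_norm x : B x -> rho0 x `^ (s - n%:R) * (C * pint gamma (fun=> 1) x) = F 0 (qn x) / F 0 1.
Proof.
move=> Bx; rewrite (pint_one gamma0 n_gt0 Bx) /hg0 hsolE.
have := pconst_eq n gamma0; have := rho_powK Bx; have := hgF_one_gt0 n gamma0 0.
rewrite -/s; move: (rho0 x `^ _) (rho0 x `^ _) (S _) (2 `^ _) (F 0 1) (F 0 (qn x)) => b a c d f g f0 ab1 k.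
have -> : a * (C * (c * d * (b * g))) = (a * b) * (C * (c * d) * f) * (g / f).
  by field; rewrite gt_eqF.
by rewrite ab1 k !mul1r.
Qed.

Lemma qn_tri (a b c : V) : qn (a - c) <= 2 * qn (a - b) + 2 * qn (b - c).
Proof.
rewrite /qn !mulr_sumr -big_split /=; apply: ler_sum => i _; rewrite !mxE.
move: (a ord0 i) (b ord0 i) (c ord0 i) => u v w.
have := sqr_ge0 ((u - v) - (v - w)); lra.
Qed.

Lemma qn_sym (a b : V) : qn (a - b) = qn (b - a).
Proof. by rewrite /qn; apply: eq_bigr => i _; rewrite !mxE; ring. Qed.

Lemma near_dist xi d : 0 < d -> \forall x \near xi, qn (x - xi) < d.
Proof.
move=> d0; apply: (@near_lt R n (fun x => qn (x - xi))); last by rewrite subrr qn0.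
have [h _ _ _ _] := @c2_dist R n setT setT xi xi I I; exact: jc_left h.
Qed.

Lemma ler_powR_base (a b r : R) : 0 <= r -> 0 <= a -> a <= b -> a `^ r <= b `^ r.
Proof.
by move=> r0 a0 ab; apply: (ge0_ler_powR r0) => //; rewrite nnegrE //; exact: le_trans ab.
Qed.

(** [qn_tri] forces [|x - xi|^2 >= d / 4]; the 8 appears because [1 - |x|^2] is twice [rho0]. *)
Lemma pker_far x xi xi0 d : B x -> sphere xi -> 0 < d -> d <= qn (xi - xi0) ->
  qn (x - xi0) < d / 4 -> pker gamma x xi <= (8 / d) `^ s * rho0 x `^ s.
Proof.
move=> Bx Sxi d0 far near.
have D : d / 4 <= qn (x - xi).
  by have := qn_tri xi x xi0; rewrite (qn_sym xi x); lra.
have r0 := rho_gt0 Bx.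
rewrite -powRM; [|by rewrite divr_ge0 // ltW|exact: ltW].
rewrite /pker; apply: ler_powR_base.
- by rewrite addr_ge0 ?divr_ge0 // ltW.
- by rewrite divr_ge0 ?qn_ge0 // subr_ge0 ltW.
have -> : 8 / d * rho0 x = (1 - qn x) / (d / 4).
  by rewrite /rho0 enorm_sqr; field; rewrite gt_eqF.
rewrite ler_pM2l ?subr_gt0 // lef_pV2 // ?posrE ?divr_gt0 //.
by apply: lt_le_trans D; rewrite divr_gt0.
Qed.

Lemma CS_near f xi0 e : CS f -> sphere xi0 -> 0 < e ->
  exists2 d, 0 < d & forall xi, sphere xi -> qn (xi - xi0) < d -> `|f xi - f xi0| <= e.
Proof.
move=> /CSP cf S0 e0; have /cvg_withinP /(_ e e0) /nbhs_ballP[d /= d0 hd] := cf xi0 S0.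
exists (d ^+ 2); first by rewrite exprn_gt0.
move=> xi Sxi xid; rewrite distrC; apply: hd => //.
apply/rV_ballP => // i; rewrite -ltr_sqr ?nnegrE ?(ltW d0) // real_normK ?num_real //.
apply: le_lt_trans xid; rewrite qn_sym.
by have := coord_sqr_le (xi0 - xi) i; rewrite !mxE.
Qed.

Lemma rho_pow_small xi t : sphere xi -> 0 < t -> \forall x \near xi, B x -> rho0 x `^ (2 * gamma) <= t.
Proof.
move=> /sphereE Sxi t0; pose eta := t `^ (2 * gamma)^-1.
have g2 : 0 < 2 * gamma by rewrite mulr_gt0.
have eta0 : 0 < eta by rewrite powR_gt0.
have : \forall x \near xi, 1 - 2 * eta < qn x.
  by apply: near_gt; [exact: qn_continuous|rewrite Sxi; lra].
apply: filterS => x h Bx.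
have -> : t = eta `^ (2 * gamma) by rewrite /eta -powRrM mulVf ?gt_eqF // powRr1 // ltW.
apply: ler_powR_base; [exact: ltW|exact/ltW/rho_gt0|].
by rewrite /rho0 enorm_sqr; lra.
Qed.

Lemma pintB f1 f2 a x : B x -> CS f1 -> CS f2 ->
  pint gamma (fun xi => f1 xi - a * f2 xi) x = pint gamma f1 x - a * pint gamma f2 x.
Proof.
move=> Bx c1 c2; have ck := @CS_pker R n gamma x Bx.
rewrite /pint -sphere_intZ; last exact: CS_mul.
rewrite -sphere_intB; [|exact: CS_mul|by apply: CS_mul; [exact: CS_cst|exact: CS_mul]].
by apply: sphere_int_ext => xi _; ring.
Qed.

Lemma pint_close f xi0 x e d M : CS f -> B x -> sphere xi0 -> 0 < d -> 0 <= e ->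
  (forall xi, sphere xi -> `|f xi| <= M) ->
  (forall xi, sphere xi -> qn (xi - xi0) < d -> `|f xi - f xi0| <= e) ->
  qn (x - xi0) < d / 4 ->
  `|pint gamma (fun xi => f xi - f xi0 * 1) x| <= e * pint gamma (fun=> 1) x
     + 2 * M * ((8 / d) `^ s * rho0 x `^ s) * S (fun=> 1).
Proof.
move=> cf Bx S0 d0 e0 fM fd near; have ck := @CS_pker R n gamma x Bx.
have c1 := @CS_cst R n.
have cd : CS (fun xi => f xi - f xi0 * 1) by apply: CS_sub => //; exact: c1.
have cKd := CS_mul ck cd.
set A := 2 * M * _.
have cr : CS (fun xi => e * (pker gamma x xi * 1) + A * 1).
  by apply: CS_lin; [apply: CS_mul => //; exact: c1|exact: c1].
apply: (le_trans (sphere_int_norm_le cKd)).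
apply: (@le_trans _ _ (S (fun xi => e * (pker gamma x xi * 1) + A * 1))); last first.
  rewrite sphere_int_lin; [|by apply: CS_mul => //; exact: c1|exact: c1].
  by rewrite sphere_intZ //; exact: c1.
apply: sphere_int_le => //; first exact: CS_norm.
move=> xi Sxi; have k0 := ltW (pker_gt0 gamma Bx Sxi).
rewrite normrM (ger0_norm k0) !mulr1.
have M0 : 0 <= M by apply: le_trans (fM xi0 S0).
have A0 : 0 <= A by rewrite /A !mulr_ge0 ?powR_ge0.
case: (ltrP (qn (xi - xi0)) d) => h.
  apply: (@le_trans _ _ (e * pker gamma x xi)); last by rewrite lerDl.
  by rewrite mulrC ler_wpM2r // fd.
apply: (@le_trans _ _ A); last by rewrite lerDr mulr_ge0.
rewrite /A mulrC; apply: ler_pM => //; last exact: pker_far near.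
apply: (le_trans (ler_normB _ _)).
by rewrite mulr_natl mulr2n lerD // fM.
Qed.

Lemma poisson_bdval f xi0 : CS f -> sphere xi0 -> bdval (fun x => C * pint gamma f x) xi0 (f xi0).
Proof.
move=> cf S0 e e0.
have [M M0 fM] := CS_bounded cf.
have C0 := pconst_gt0 n gamma0.
have k0 := hgF_one_gt0 n gamma0 0.
(* The near part is this tolerance times the normalized mass, which is at most 2, hence contributes
   [e / 3]. *)
have e6 : 0 < e / 6 by rewrite divr_gt0.
have [d d0 fd] := CS_near cf S0 e6.
pose A := C * (2 * M * (8 / d) `^ s * S (fun=> 1)).
have A0 : 0 <= A.
  apply: mulr_ge0; first exact: ltW.
  by apply: mulr_ge0; [rewrite !mulr_ge0 ?powR_ge0|exact: S1_ge0].
have t1 : 0 < e / 3 / (A + 1) by rewrite !divr_gt0 // ltr_wpDl.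
(* The bound 1 keeps the mass below 2; the other one controls the error [f xi0 * (mass - 1)]. *)
have t2 : 0 < Num.min 1 (e / 3 / (M + 1)) by rewrite lt_min ltr01 !divr_gt0 // ltr_wpDl.
have n1 := rho_pow_small S0 t1.
have n2 := hgF_near gamma0 0 S0 (mulr_gt0 t2 k0).
have d4 : 0 < d / 4 by rewrite divr_gt0.
have n3 := near_dist xi0 d4.
apply: filterS (filterI n1 (filterI n2 n3)) => x [h1 [h2 h3]] Bx.
have {}h1 := h1 Bx; have {}h2 := h2 Bx.
have cl := pint_close cf Bx S0 d0 (ltW e6) fM fd h3.
rewrite (pintB (f xi0) Bx cf (@CS_cst R n 1)) in cl.
have nrm := pint_one_norm Bx.
have r0 := rho_gt0 Bx.
set r := rho0 x `^ (s - n%:R) in nrm *.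
have rp : 0 <= r by exact: powR_ge0.
(* The far part carries the exponent [2 s - n = 2 gamma], and is small because [gamma > 0]. *)
have rs : r * rho0 x `^ s = rho0 x `^ (2 * gamma).
  by rewrite /r -powRD_gt0 //; congr (_ `^ _); rewrite /s; field.
set G := F 0 (qn x) / F 0 1 in nrm.
have hG : `|G - 1| <= Num.min 1 (e / 3 / (M + 1)).
  have -> : G - 1 = (F 0 (qn x) - F 0 1) / F 0 1 by rewrite /G; field; rewrite gt_eqF.
  by rewrite normrM normfV [`|F 0 1|]gtr0_norm // ler_pdivrMr.
move: hG; rewrite le_min => /andP[hG1 hG2].
have -> : f xi0 - r * (C * pint gamma f x) =
   - (r * C * (pint gamma f x - f xi0 * pint gamma (fun=> 1) x)) - f xi0 * (r * (C * pint gamma (fun=> 1) x) - 1).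
  by ring.
apply: (le_trans (ler_normB _ _)); rewrite normrN nrm normrM [`|f xi0 * _|]normrM.
have rC : 0 <= r * C by rewrite mulr_ge0 // ltW.
rewrite (ger0_norm rC).
have T12 : r * C * `|pint gamma f x - f xi0 * pint gamma (fun=> 1) x| <= e / 3 + e / 3.
  apply: (le_trans (ler_wpM2l rC cl)).
  have -> : r * C * (e / 6 * pint gamma (fun=> 1) x + 2 * M * ((8 / d) `^ s * rho0 x `^ s) * S (fun=> 1)) =
    e / 6 * (r * (C * pint gamma (fun=> 1) x)) + A * (r * rho0 x `^ s) by rewrite /A; ring.
  rewrite nrm rs lerD //.
    have : G <= 2 by move: hG1; rewrite ler_norml => /andP[]; lra.
    move=> G2; apply: (@le_trans _ _ (e / 6 * 2)); first by rewrite ler_wpM2l // ltW.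
    lra.
  apply: (@le_trans _ _ ((A + 1) * (e / 3 / (A + 1)))).
    by apply: ler_pM => //; [exact: powR_ge0|rewrite lerDl].
  by rewrite mulrC divfK // gt_eqF // ltr_wpDl.
have T3 : `|f xi0| * `|G - 1| <= e / 3.
  apply: (@le_trans _ _ ((M + 1) * (e / 3 / (M + 1)))).
    by apply: ler_pM => //; apply: (le_trans (fM xi0 S0)); rewrite lerDl.
  by rewrite mulrC divfK // gt_eqF // ltr_wpDl.
by apply: (le_trans (lerD T12 T3)); lra.
Qed.

Lemma poisson_sol f : CS f -> sol s B setT (fun x _ => C * pint gamma f x).
Proof.
move=> cf; have := sol_lin C 0 (pint_sol gamma cf) (pint_sol gamma cf).
by apply: sol_congr => [|x xi _]; [exact: ball1_open|rewrite mul0r addr0].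
Qed.

Lemma poisson_unique f (v : V -> R) : CS f -> sol s B setT (fun x _ => v x) ->
  (forall xi, sphere xi -> bdval v xi (f xi)) -> forall x, B x -> v x = C * pint gamma f x.
Proof.
move=> cf sv bv x Bx; apply/eqP; rewrite -subr_eq0; apply/eqP.
have sw : sol s B setT (fun x _ => v x - C * pint gamma f x).
  have := sol_lin 1 (-1) sv (poisson_sol cf).
  by apply: sol_congr => [|y xi _]; [exact: ball1_open|rewrite mul1r mulN1r].
apply: (uniqueness_zero gamma0 sw) => // xi Sxi e e0.
have e2 : 0 < e / 2 by rewrite divr_gt0.
apply: filterS (filterI (bv xi Sxi _ e2) (poisson_bdval cf Sxi e2)) => y [h1 h2] By.
rewrite -/s mulrBr.
have := lerD (h2 By) (h1 By); rewrite -splitr; apply: le_trans.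
rewrite -[X in `|X|](_ : (f xi - rho0 y `^ (s - n%:R) * (C * pint gamma f y)) - (f xi - rho0 y `^ (s - n%:R) * v y) = _).
  exact: ler_normB.
by ring.
Qed.

Lemma homog_polyZ l (P : V -> R) c x : homog_poly l P -> P (c *: x) = c ^+ l * P x.
Proof.
move=> [a ha]; rewrite !ha mulr_sumr; apply: eq_bigr => k _.
under eq_bigr do rewrite mxE.
by rewrite big_split /= prodr_const card_ord mulrCA.
Qed.

Lemma enorm_theta x : enorm x *: theta x = x.
Proof.
rewrite /theta; case: eqP => [->|/eqP x0]; last first.
  by rewrite scalerA divff ?scale1r // enormE gt_eqF // sqrtr_gt0 qn_gt0.
by rewrite enormE qn0 sqrtr0 scale0r.
Qed.

Lemma homog_cont l (P : V -> R) x : homog_poly l P -> {for x, continuous P}.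
Proof.
move=> /hom_poly[g [H [c _]]]; have [h _ _ _ _] := c x 0 I I; exact: (jc_left h).
Qed.

Lemma harmonic_bdval l (P : V -> R) xi : homog_poly l P -> sphere xi ->
  bdval (fun x => rho0 x `^ (n%:R - s) * (F l (qn x) / F l 1 * P x)) xi (P xi).
Proof.
move=> hP Sxi e e0; have k0 := hgF_one_gt0 n gamma0 l.
pose A := `|P xi| + 1.
have A0 : 0 < A by rewrite ltr_wpDl.
have e2 : 0 < e / 2 by rewrite divr_gt0.
have t0 : 0 < e / 2 / A * F l 1 by rewrite mulr_gt0 // divr_gt0.
have n1 := hgF_near gamma0 l Sxi t0.
have cP : {for xi, continuous P} := @homog_cont l P xi hP.
have near_P t : 0 < t -> \forall x \near xi, `|P xi - P x| < t.
  move=> tp; apply: (@near_lt R n (fun x => `|P xi - P x|)); last by rewrite subrr normr0.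
  apply: (@cont_comp R V (fun x => P xi - P x) (fun z => `|z|)); last exact: norm_continuous.
  apply: (@contD R V (fun=> P xi) (fun x => - P x)); first exact: cont_cst.
  by apply: (@cont_comp R V P (fun z => - z)); [exact: cP|exact: opp_continuous].
apply: filterS (filterI n1 (filterI (near_P _ e2) (near_P _ ltr01))) => x [h1 [h2 h3]] Bx.
rewrite mulrA rho_powK // mul1r.
have PA : `|P x| <= A.
  have -> : P x = P xi - (P xi - P x) by ring.
  by apply: (le_trans (ler_normB _ _)); rewrite /A lerD // ltW.
have G : `|F l (qn x) / F l 1 - 1| <= e / 2 / A.
  have -> : F l (qn x) / F l 1 - 1 = (F l (qn x) - F l 1) / F l 1 by field; rewrite gt_eqF.
  by rewrite normrM normfV [`|F l 1|]gtr0_norm // ler_pdivrMr // h1.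
have -> : P xi - F l (qn x) / F l 1 * P x = (P xi - P x) - (F l (qn x) / F l 1 - 1) * P x by ring.
apply: (le_trans (ler_normB _ _)); rewrite [e]splitr lerD ?(ltW h2) // normrM.
have -> : e / 2 = e / 2 / A * A by rewrite divfK // gt_eqF.
by apply: ler_pM.
Qed.

Lemma poisson_harmonic l (P : V -> R) x : homog_poly l P -> (forall x, laplacian P x = 0) ->
  B x -> C * pint gamma P x = rho0 x `^ (n%:R - s) * (F l (qn x) / F l 1 * P x).
Proof.
move=> hP lP Bx; have cP : CS P by apply: CS_for => xi _; exact: (@homog_cont l P xi hP).
apply/esym; apply: (poisson_unique (v := fun x => rho0 x `^ (n%:R - s) * (F l (qn x) / F l 1 * P x))) => //.
  have h := hsol_sol gamma0 hP lP.
  have := sol_lin (F l 1)^-1 0 h h.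
  apply: sol_congr => [|y xi _]; first exact: ball1_open.
  by rewrite hsolE -/s; ring.
by move=> xi Sxi; exact: harmonic_bdval.
Qed.

(** Continuity of evaluation at [x] for the L^2 norm. The inequality
    [|k g| <= eta k^2 / 2 + g^2 / (2 eta)] stands in for Cauchy-Schwarz, with [eta] chosen so that
    the kernel term is at most [e / 2]. *)
Lemma pint_small x e : B x -> 0 < e -> exists2 d, 0 < d & forall g, CS g ->
  S (fun xi => g xi ^+ 2) <= d -> `|pint gamma g x| <= e.
Proof.
move=> Bx e0; have ck := @CS_pker R n gamma x Bx.
have ckk := CS_mul ck ck.
pose A := S (fun xi => pker gamma x xi * pker gamma x xi).
have A0 : 0 <= A by apply: sphere_int_ge0 => xi _; rewrite -expr2 sqr_ge0.
pose eta := e / (A + 1).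
have eta0 : 0 < eta by rewrite divr_gt0 // ltr_wpDl.
exists (e * eta); first by rewrite mulr_gt0.
move=> g cg hg.
have cgg : CS (fun xi => g xi ^+ 2) by apply: CS_mul.
have cS : CS (fun xi => eta^-1 / 2 * g xi ^+ 2) by apply: CS_mul => //; exact: CS_cst.
apply: (le_trans (sphere_int_norm_le (CS_mul ck cg))).
apply: (@le_trans _ _ (S (fun xi => eta / 2 * (pker gamma x xi * pker gamma x xi) + eta^-1 / 2 * g xi ^+ 2))).
  apply: sphere_int_le; [exact/CS_norm/CS_mul|exact: CS_lin|].
  move=> xi _; rewrite normrM; set a := `|_|; set b := `|g xi|.
  have -> : pker gamma x xi * pker gamma x xi = a ^+ 2 by rewrite -expr2 real_normK ?num_real.
  have -> : g xi ^+ 2 = b ^+ 2 by rewrite real_normK ?num_real.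
  rewrite -subr_ge0 [leRHS](_ : _ = eta^-1 / 2 * (eta * a - b) ^+ 2).
    by rewrite mulr_ge0 ?sqr_ge0 // divr_ge0 // invr_ge0 ltW.
  by field; rewrite gt_eqF.
rewrite sphere_int_lin // sphere_intZ // -/A.
have h1 : eta / 2 * A <= e / 2.
  rewrite /eta mulrAC ler_pM2r ?invr_gt0 // mulrAC ler_pdivrMr ?ltr_wpDl //.
  by rewrite ler_pM2l // lerDl.
have h2 : eta^-1 / 2 * S (fun xi => g xi ^+ 2) <= e / 2.
  apply: (@le_trans _ _ (eta^-1 / 2 * (e * eta))).
    by rewrite ler_wpM2l // divr_ge0 // invr_ge0 ltW.
  by rewrite le_eqVlt; apply/orP; left; apply/eqP; field; rewrite gt_eqF.
by rewrite [e]splitr lerD.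
Qed.

End PoissonIntegral.

Lemma unit_ball_ball1 (R : realType) (n : nat) : unit_ball = @ball1 R n.
Proof. by apply/seteqP; split => x /unit_ballE. Qed.

Lemma spherical_harmonic_CS (R : realType) (n l : nat) (Y : 'rV[R]_n.+1 -> R) :
  spherical_harmonic l Y -> CS Y.
Proof.
move=> [P [hP [_ YP]]].
have cP : CS P by apply: CS_for => xi _; exact: (@homog_cont R n l P xi hP).
by move/CSP: cP => cP; apply/CSP => xi Sxi; rewrite YP //; apply: cvg_trans (cP xi Sxi);
  apply: near_eq_cvg; apply: filterS (withinT _ _) => // y Sy; rewrite YP.
Qed.

(** * Expansion in spherical harmonics and assembly of the theorem *)

Section HarmonicExpansion.
Variables (R : realType) (n : nat) (gamma : R).
Hypotheses (n_gt0 : (0 < n)%N) (gamma0 : 0 < gamma).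
Local Notation V := 'rV[R]_n.+1.
Local Notation F := (hgF n gamma).
Let s : R := n%:R / 2 + gamma.

Lemma hgF_quotient l t : F l t / F l 1 = Gamma (gamma + 1 / 2) / Gamma (2 * gamma)
  * (Gamma (l%:R + gamma + n%:R / 2) / Gamma (l%:R + (n%:R + 1) / 2)) * F l t.
Proof.
rewrite (hgF_one n gamma0 l); have [c0 _ _ _] := hgF_params n gamma l.
have h1 := Gamma_gt0 c0.
have h2 : 0 < Gamma (2 * gamma) by rewrite Gamma_gt0 // mulr_gt0.
have h3 : 0 < Gamma (gamma + 1 / 2) by rewrite Gamma_gt0 // addr_gt0 // divr_gt0.
have h4 : 0 < Gamma (l%:R + gamma + n%:R / 2).
  by rewrite Gamma_gt0 // ltr_wpDr ?divr_ge0 // ltr_wpDl.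
move: (F l t) (Gamma (l%:R + (n%:R + 1) / 2)) (Gamma (2 * gamma)) (Gamma (gamma + 1 / 2))
  (Gamma (l%:R + gamma + n%:R / 2)) h1 h2 h3 h4 => z a b c d a0 b0 c0' d0.
by field; rewrite !gt_eqF.
Qed.

(** With [P] the harmonic polynomial behind [Y], homogeneity gives [|x|^l Y(theta x) = P x], at the
    origin too, since [|x| theta x = x] there whatever direction is assigned. *)
Lemma harmonic_term l (Y : V -> R) x : spherical_harmonic l Y -> ball1 x ->
  F l (enorm x ^+ 2) / F l 1 * enorm x ^+ l * Y (theta x) =
  rho0 x `^ (s - n%:R) * (pconst n gamma * pint gamma Y x).
Proof.
move=> [P [hP [lP YP]]] Bx.
rewrite (_ : pint gamma Y x = pint gamma P x); last first.
  by apply: sphere_int_ext => xi Sxi; rewrite YP.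
rewrite (poisson_harmonic n_gt0 gamma0 hP lP Bx) mulrA (rho_powK gamma Bx) mul1r enorm_sqr.
rewrite -mulrA YP; last exact: theta_sphere.
by rewrite -(homog_polyZ _ _ hP) enorm_theta.
Qed.

(** Up to the common factor, a partial sum of the series is the Poisson integral of [f] minus that
    of the remainder [g N]. The remainder tends to 0 in L^2, so [pint_small] concludes pointwise. *)
Lemma poisson_series (f : V -> R) (Y : nat -> V -> R) x : CS f ->
  (forall l, spherical_harmonic l (Y l)) ->
  (fun N => sphere_integral (fun xi => (f xi - \sum_(l < N) Y l xi) ^+ 2)) @ \oo --> 0 ->
  ball1 x ->
  series (fun l => F l (enorm x ^+ 2) / F l 1 * enorm x ^+ l * Y l (theta x)) @ \oo -->
    rho0 x `^ (s - n%:R) * (pconst n gamma * pint gamma f x).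
Proof.
move=> cf hY hf Bx; set r := rho0 x `^ (s - n%:R); set a := fun l => _.
have cY l : CS (Y l) := spherical_harmonic_CS (hY l).
have aE l : a l = r * (pconst n gamma * pint gamma (Y l) x) := harmonic_term (hY l) Bx.
pose g N := fun xi => f xi - \sum_(l < N) Y l xi.
have cg N : CS (g N).
  by apply: CS_sub => //; have [] := sphere_int_sum (index_enum 'I_N) (fun l => cY l).
have gE N : series a N = r * (pconst n gamma * (pint gamma f x - pint gamma (g N) x)).
  rewrite /series /=; elim: N => [|N IH].
    rewrite big_nil (_ : g 0 = f) ?subrr ?mulr0 //.
    by apply/funext => xi; rewrite /g big_ord0 subr0.
  rewrite big_nat_recr //= IH aE -!mulrDr; congr (_ * (_ * _)).
  have -> : g N.+1 = fun xi => g N xi - 1 * Y N xi.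
    by apply/funext => xi; rewrite /g big_ord_recr /= mul1r; ring.
  by rewrite (pintB _ _ Bx) //; ring.
have p0 : pint gamma (g N) x @[N --> \oo] --> 0.
  apply/cvgrPdist_le => e e0; have [d d0 hd] := pint_small gamma Bx e0.
  have /cvgrPdist_le /(_ d d0) := hf; apply: filterS => N; rewrite !sub0r !normrN => h.
  by apply: hd => //; apply: le_trans h; exact: ler_norm.
rewrite (_ : series a = fun N => r * (pconst n gamma * (pint gamma f x - pint gamma (g N) x))); last first.
  by apply/funext => N; exact: gE.
have : pint gamma f x - pint gamma (g N) x @[N --> \oo] --> pint gamma f x - 0.
  by apply: cvgB p0; exact: cvg_cst.
by rewrite subr0 => q0; apply: cvgMr; apply: cvgMr.
Qed.

Lemma poisson_problem (f : V -> R) : CS f ->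
  let u x := pconst n gamma * pint gamma f x in
  [/\ C2_on (@ball1 R n) u,
      forall x, ball1 x -> - hyp_laplacian u x - s * (n%:R - s) * u x = 0 &
      forall xi, sphere xi ->
        (fun x => rho0 x `^ (s - n%:R) * u x) @ within (@ball1 R n) (nbhs xi) --> f xi].
Proof.
move=> cf u.
have [C2u Lu] := problem_of_sol (@ball1_open R n) (I : setT (0 : V)) (poisson_sol gamma cf).
by split => // xi Sxi; apply/cvg_withinP; exact: (poisson_bdval n_gt0 gamma0 cf Sxi).
Qed.

Lemma problem_unique (f v : V -> R) : CS f -> C2_on (@ball1 R n) v ->
  (forall x, ball1 x -> - hyp_laplacian v x - s * (n%:R - s) * v x = 0) ->
  (forall xi, sphere xi ->
    (fun x => rho0 x `^ (s - n%:R) * v x) @ within (@ball1 R n) (nbhs xi) --> f xi) ->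
  forall x, ball1 x -> v x = pconst n gamma * pint gamma f x.
Proof.
move=> cf C2v Lv bv x Bx.
apply: (poisson_unique n_gt0 gamma0 cf (sol_of_problem C2v Lv)) => // xi Sxi.
exact/cvg_withinP/bv.
Qed.

End HarmonicExpansion.

Theorem theorem4p1 (R : realType) (n : nat) (gamma : R)
  (f : 'rV[R]_(n.+1) -> R) :
  (1 <= n)%N ->
  0 < gamma -> (forall m : nat, gamma != m%:R) ->
  {within sphere, continuous f} ->
  let s := n%:R / 2 + gamma in
  let B : set ('rV[R]_(n.+1)) := unit_ball in
  let problem (v : 'rV[R]_(n.+1) -> R) :=
    [/\ C2_on B v,
        (forall x, B x -> - hyp_laplacian v x - s * (n%:R - s) * v x = 0) &
        (forall xi, sphere xi ->
           (fun x => rho0 x `^ (s - n%:R) * v x) @ within B (nbhs xi)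
             --> f xi)] in
  let u (x : 'rV[R]_(n.+1)) :=
    pi `^ (- (n%:R / 2)) * (2 `^ (- s) * Gamma (n%:R / 2 + gamma) / Gamma gamma)
    * sphere_integral (fun xi => ((1 - enorm x ^+ 2) / enorm (x - xi) ^+ 2) `^ s
                                 * f xi) in
  let phi (l : nat) (t : R) :=
    hyp2F1 (l%:R + n%:R / 2 - gamma) (1 / 2 - gamma) (l%:R + (n%:R + 1) / 2) t
    / hyp2F1 (l%:R + n%:R / 2 - gamma) (1 / 2 - gamma) (l%:R + (n%:R + 1) / 2) 1 in
  [/\ problem u,
      (forall v, problem v -> forall x, B x -> v x = u x),
      (forall (l : nat) (t : R), 0 <= t <= 1 ->
         phi l t = Gamma (gamma + 1 / 2) / Gamma (2 * gamma)
                   * (Gamma (l%:R + gamma + n%:R / 2) / Gamma (l%:R + (n%:R + 1) / 2))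
                   * hyp2F1 (l%:R + n%:R / 2 - gamma) (1 / 2 - gamma)
                            (l%:R + (n%:R + 1) / 2) t) &
      (forall Y : nat -> 'rV[R]_(n.+1) -> R,
         (forall l, spherical_harmonic l (Y l)) ->
         (fun N => sphere_integral
                     (fun xi => (f xi - \sum_(l < N) Y l xi) ^+ 2)) @ \oo --> 0 ->
         forall x, B x ->
           let a := fun l : nat =>
             phi l (enorm x ^+ 2) * enorm x ^+ l * Y l (theta x) in
           cvgn (series a) /\
           u x = rho0 x `^ (n%:R - s) * limn (series a))].
Proof.
move=> n1 g0 _ cf s B problem u phi.
have BE : B = @ball1 R n := @unit_ball_ball1 R n.
have uE : u = fun x => pconst n gamma * pint gamma f x.
  apply/funext => x; congr (_ * _); apply: sphere_int_ext => xi _.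
  by rewrite /pker !enorm_sqr.
split.
- rewrite /problem BE uE; exact: (poisson_problem n1 g0 cf).
- move=> v; rewrite /problem BE uE => -[C2v Lv bv].
  exact: (problem_unique n1 g0 cf C2v Lv bv).
- move=> l t _; exact: (hgF_quotient n g0 l t).
move=> Y hY hf x; rewrite BE uE => Bx a.
have sc := poisson_series n1 g0 cf hY hf Bx.
split; first exact: (cvgP _ sc).
rewrite (cvg_lim (@Rhausdorff R) sc) mulrA [rho0 x `^ _ * _]mulrC.
by rewrite (rho_powK gamma Bx) mul1r.
Qed.
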